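(* Let $M$ be a minuscule poset. Then $M$ has NRP rowmotion; that is, for every integer $c>0$, no orbit of rowmotion $\psi$ on the set $J(M\times\mathbf{c})$ of order ideals of $M\times \mathbf{c}$ has cardinality relatively prime to $\mathrm{rank}(M)+c+1$.
   Context: All posets are finite and graded (all maximal chains have the same length). The length of a chain is its number of elements minus one, and $\mathrm{rank}(Q)$ is the length of a longest chain of $Q$. $\mathbf{c}$ denotes a chain with $c$ elements; $P\times Q$ is the product poset with componentwise order. $J(Q)$ is the set of order ideals (down-sets) of $Q$; when regarded as a poset, it is ordered by inclusion. Rowmotion: for a finite poset $Q$ and an order ideal $I\subseteq Q$, $\psi(I)$ is the order ideal of $Q$ generated by the minimal elements of $Q\setminus I$. The map $\psi:J(Q)\to J(Q)$ is a bijection, and orbits are taken under the cyclic group it generates. NRP rowmotion: a finite graded poset $P$ has NRP (''not relatively prime'') rowmotion if, for all positive integers $c$, no $\psi$-orbit of $J(P\times \mathbf{c})$ has cardinality relatively prime to $\mathrm{rank}(P)+c+1$. Minuscule posets: let $\Phi^+$ be the positive roots of a complex connected reductive group $G$ (with respect to a choice of Borel subgroup and maximal torus), partially ordered by the order generated by $\alpha<\beta$ whenever $\beta-\alpha\in\Phi^+$. A simple root $\delta$ is minuscule if the coroot $\delta^\vee$ appears with multiplicity at most one in the simple coroot expansion of $\alpha^\vee$ for every $\alpha\in\Phi^+$. The minuscule poset $M_\delta$ is the subposet of $\Phi^+$ consisting of the positive roots whose simple root expansion involves $\delta$ with nonzero coefficient. By the known classification, the minuscule posets are, up to isomorphism,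 exactly: (1) the rectangles $\mathbf{a}\times\mathbf{b}$, $a,b\ge 1$; (2) the shifted staircases $S_n=\{(x,y): 1\le x\le y\le n\}$, $n\geq 1$, with $(x,y)\le(x',y')$ iff $x\le x'$ and $y\le y'$; (3) the propellers $J^k(\mathbf{2}\times\mathbf{2})$, $k\ge 0$, where $J$ is iterated $k$ times; (4) the Cayley–Moufang poset $J^2(\mathbf{3}\times\mathbf{2})$; (5) the Freudenthal poset $J^3(\mathbf{3}\times\mathbf{2})$. *)

(* Defs.v *)
From HB Require Import structures.
From mathcomp Require Import all_boot all_order all_fingroup all_algebra.
From mathcomp Require Import boolp.
Set Implicit Arguments.
Unset Strict Implicit.
Unset Printing Implicit Defensive.
Import Order.TTheory GRing.Theory Num.Theory.
Local Open Scope ring_scope.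

Section Posets.
Context {d : Order.disp_t} {Q : finPOrderType d}.
Implicit Types (x y : Q) (A I : {set Q}).

Definition is_chain A : bool := [forall x in A, forall y in A, (x >=< y)%O].

(* The length of a chain is its number of elements minus one; the empty set
   is a chain, so an empty poset gets rank 0 by truncation. *)
Definition poset_rank : nat := (\max_(A : {set Q} | is_chain A) #|A|).-1.

Definition is_ideal I : bool :=
  [forall x in I, forall y, (y <= x)%O ==> (y \in I)].

Definition ideal_gen A : {set Q} := [set x | [exists y in A, (x <= y)%O]].

Definition minimals A : {set Q} :=
  [set x in A | [forall y in A, ~~ (y < x)%O]].

Definition row_ideal I : {set Q} := ideal_gen (minimals (~: I)).

Lemma ideal_genP A : is_ideal (ideal_gen A).
Proof.
apply/forall_inP => x; rewrite inE => /exists_inP[z zA xz].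
apply/forallP => y; apply/implyP => yx; rewrite inE.
by apply/exists_inP; exists z => //; apply: le_trans xz.
Qed.

Lemma exists_minimal A x : x \in A -> exists2 y, y \in minimals A & (y <= x)%O.
Proof.
have [n] := ubnP #|[set z : Q | (z < x)%O]|; elim: n x => // n IHn x hn xA.
have [/forall_inP xmin|] := boolP [forall y in A, ~~ (y < x)%O].
  by exists x => //; rewrite inE xA; apply/forall_inP.
case/forall_inPn => y yA; rewrite negbK => yx.
have [|z zA zy] := IHn y _ yA; last by exists z => //; apply: le_trans (ltW yx).
rewrite ltnS in hn; apply: leq_trans hn; apply: proper_card.
rewrite properE; apply/andP; split.
  by apply/subsetP => z; rewrite !inE => /lt_trans; apply.
by apply/subsetPn; exists y; rewrite !inE ?ltxx.
Qed.

Lemma mem_minimals_rowC I x : is_ideal I ->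
  (x \in ~: I) = [exists y in minimals (~: I), (y <= x)%O].
Proof.
move=> /forall_inP Iid; apply/idP/exists_inP => [/exists_minimal[y]|[y]].
  by exists y.
rewrite inE => /andP[yI _] yx; move: yI; rewrite !inE; apply: contraNN => xI.
by have /forallP/(_ y) := Iid _ xI; rewrite yx.
Qed.

(* The minimal elements of the complement of I are the maximal ones of row_ideal I. *)
Lemma minimals_row I :
  minimals (~: I) = [set x in row_ideal I | [forall y in row_ideal I, ~~ (x < y)%O]].
Proof.
apply/setP => x; apply/idP/idP => [xm|].
  rewrite !inE; apply/andP; split; first by apply/exists_inP; exists x.
  apply/forall_inP => y; rewrite inE => /exists_inP[z zm yz].
  apply/negP => /lt_le_trans/(_ yz) xz.
  move: xm zm; rewrite inE => /andP[xI _]; rewrite inE => /andP[_].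
  by move=> /forall_inP/(_ x xI); rewrite xz.
rewrite !inE => /andP[/exists_inP[z zm xz]] /forall_inP/(_ z) hz.
have /hz : z \in row_ideal I by rewrite inE; apply/existsP; exists z; rewrite zm lexx.
by rewrite lt_neqAle xz andbT negbK => /eqP->; rewrite !inE in zm.
Qed.

Lemma row_ideal_inj : {in is_ideal &, injective row_ideal}.
Proof.
move=> I K Iid Kid eqIK; apply: setC_inj; apply/setP => x.
by rewrite !mem_minimals_rowC // !minimals_row eqIK.
Qed.

End Posets.

Definition J {d : Order.disp_t} (Q : finPOrderType d) : finType :=
  {I : {set Q} | is_ideal I}.

Definition rowmotion_fun {d : Order.disp_t} {Q : finPOrderType d} (I : J Q) : J Q :=
  exist is_ideal (row_ideal (val I)) (ideal_genP (minimals (~: val I))).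

Lemma rowmotion_fun_inj {d : Order.disp_t} {Q : finPOrderType d} :
  injective (@rowmotion_fun d Q).
Proof.
move=> [I Iid] [K Kid] [] /(row_ideal_inj Iid Kid) eqIK; exact: val_inj.
Qed.

Definition rowmotion {d : Order.disp_t} (Q : finPOrderType d) : {perm J Q} :=
  perm (@rowmotion_fun_inj d Q).

Definition NRP_rowmotion {d : Order.disp_t} (P : finPOrderType d) : Prop :=
  forall c : nat, (0 < c)%N ->
  forall O : {set J (P *p 'I_c)}, O \in porbits (rowmotion (P *p 'I_c)) ->
    ~~ coprime #|O| (@poset_rank d P + c + 1)%N.

(* A reduced root datum, with character lattice Z^n (row vectors), cocharacter
   lattice Z^n (column vectors), and the roots indexed by a finite type so
   that rd_root i <-> rd_coroot i is the bijection between roots and coroots.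
   Complex connected reductive groups with a maximal torus are classified by
   reduced root data, and every reduced root datum arises. *)
Record root_datum := RootDatum {
  rd_dim : nat;
  rd_index : finType;
  rd_root : rd_index -> 'rV[int]_rd_dim;
  rd_coroot : rd_index -> 'cV[int]_rd_dim;
  rd_pairing := fun a b : rd_index => (rd_root a *m rd_coroot b) ord0 ord0;
  root_inj : injective rd_root;
  coroot_inj : injective rd_coroot;
  pairing_diag : forall a, rd_pairing a a = 2;
  root_refl : forall a b, exists c, rd_root c = rd_root b - rd_pairing b a *: rd_root a;
  coroot_refl : forall a b,
    exists c, rd_coroot c = rd_coroot b - rd_pairing a b *: rd_coroot a;
  root_reduced : forall a b, rd_root b <> rd_root a *+ 2
}.

(* A base (set of simple roots); bases correspond to the Borel subgroups
   containing the given maximal torus. *)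
Record base (R : root_datum) := Base {
  simples : {set rd_index R};
  simple_free : forall m : rd_index R -> int,
    \sum_(i in simples) m i *: rd_root i = 0 -> forall i, i \in simples -> m i = 0;
  simple_sign : forall a, exists m : rd_index R -> nat,
    rd_root a = \sum_(i in simples) rd_root i *+ m i \/
    rd_root a = - \sum_(i in simples) rd_root i *+ m i
}.

Section Positive.
Context {R : root_datum} (B : base R).

Definition root_expansion (a : rd_index R) (m : rd_index R -> nat) : Prop :=
  rd_root a = \sum_(i in simples B) rd_root i *+ m i.

Definition coroot_expansion (a : rd_index R) (m : rd_index R -> nat) : Prop :=
  rd_coroot a = \sum_(i in simples B) rd_coroot i *+ m i.

Definition is_positive (a : rd_index R) : bool := `[< exists m, root_expansion a m >].

Definition involves (e a : rd_index R) : bool :=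
  `[< exists2 m, root_expansion a m & m e != 0%N >].

(* The simple coroots form a base of the coroots, so the expansion exists for
   every positive root a, and is unique. *)
Definition minuscule (e : rd_index R) : Prop :=
  e \in simples B /\
  forall a, is_positive a -> exists2 m, coroot_expansion a m & (m e <= 1)%N.

Definition pos_root : Type := {a : rd_index R | is_positive a}.

HB.instance Definition _ := Finite.on pos_root.

Definition pos_root_step : rel pos_root := fun a b : pos_root =>
  [exists g : pos_root, rd_root (val b) - rd_root (val a) == rd_root (val g)].

Definition pos_root_le : rel pos_root := connect pos_root_step.

Lemma root_neq0 (a : rd_index R) : rd_root a != 0.
Proof.
apply/eqP => a0; have := pairing_diag a.
by rewrite /rd_pairing a0 mul0mx mxE.
Qed.

Lemma root_expansion_uniq (c c' : rd_index R -> int) :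
  \sum_(i in simples B) c i *: rd_root i = \sum_(i in simples B) c' i *: rd_root i ->
  {in simples B, c =1 c'}.
Proof.
move=> eqc i iB; apply/eqP; rewrite -subr_eq0; apply/eqP.
apply: (@simple_free _ B (fun j => c j - c' j)) => //.
under eq_bigr do rewrite scalerBl.
by rewrite sumrB eqc subrr.
Qed.

Let coef (a : pos_root) : rd_index R -> nat :=
  projT1 (cid (asboolW (valP a))).
Let coefP (a : pos_root) : root_expansion (val a) (coef a).
Proof. exact: projT2 (cid (asboolW (valP a))). Qed.
Let ht (a : pos_root) := (\sum_(i in simples B) coef a i)%N.

Let coefZ (a : pos_root) : rd_root (val a) = \sum_(i in simples B) (coef a i)%:Z *: rd_root i.
Proof.
by rewrite coefP; apply: eq_bigr => i _; rewrite -scaler_nat natz.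
Qed.

Let ht_step a b : pos_root_step a b -> (ht a < ht b)%N.
Proof.
case/existsP => g /eqP eqg.
have eqb : {in simples B, forall i, coef b i = coef a i + coef g i}%N.
  move=> i iB; suff [] : (coef b i)%:Z = (coef a i)%:Z + (coef g i)%:Z by [].
  apply: (@root_expansion_uniq (fun i => (coef b i)%:Z)
            (fun i => (coef a i)%:Z + (coef g i)%:Z)) iB.
  under [RHS]eq_bigr do rewrite scalerDl.
  by rewrite big_split -!coefZ -eqg /= addrC subrK.
rewrite /ht (eq_bigr _ eqb) big_split /= -[ltnLHS]addn0 ltn_add2l lt0n.
apply: contra_neq (root_neq0 (val g)) => /eqP; rewrite sum_nat_eq0.
move=> /forall_inP g0; rewrite coefP big1 // => i /g0/eqP->.
by rewrite mulr0n.
Qed.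

Let ht_le a b : pos_root_le a b -> a = b \/ (ht a < ht b)%N.
Proof.
case/connectP => p; elim: p a => [|x p IHp] a /=; first by left.
case/andP => /ht_step ax /IHp/[apply] -[<-|/(ltn_trans ax)]; by right.
Qed.

Lemma pos_root_le_refl : reflexive pos_root_le.
Proof. exact: connect0. Qed.

Lemma pos_root_le_trans : transitive pos_root_le.
Proof. exact: connect_trans. Qed.

Lemma pos_root_le_anti : antisymmetric pos_root_le.
Proof.
move=> a b /andP[/ht_le[//|ab] /ht_le[//|ba]].
by have := ltn_trans ab ba; rewrite ltnn.
Qed.

End Positive.

Fact root_display : Order.disp_t. Proof. exact: Order.Disp tt tt. Qed.

HB.instance Definition _ (R : root_datum) (B : base R) :=
  Order.Le_isPOrder.Build root_display (pos_root B)
    (@pos_root_le_refl R B) (@pos_root_le_anti R B) (@pos_root_le_trans R B).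

Definition minuscule_poset {R : root_datum} (B : base R) (e : rd_index R) : Type :=
  {a : pos_root B | involves B e (val a)}.

Section MinusculePoset.
Context (R : root_datum) (B : base R) (e : rd_index R).
HB.instance Definition _ := SubFinite.on (minuscule_poset B e).
HB.instance Definition _ :=
  [SubChoice_isSubPOrder of minuscule_poset B e by <: with root_display].
End MinusculePoset.

(* Main.v *)
Require Import Defs.
From mathcomp Require Import all_boot all_order all_fingroup all_algebra.
From mathcomp Require Import zify ring boolp.
Set Implicit Arguments.
Unset Strict Implicit.
Unset Printing Implicit Defensive.
Import Order.TTheory GRing.Theory Num.Theory.
Local Open Scope ring_scope.

(* Record the rowmotion orbit of an ideal of P x c as a space-time field b t x z, the membership of
   (x, z) in the t-th iterate.  Read along the time slices t = j + rk x, the columns of the field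
   are increasing labelings of P by 1, ..., R + c + 1 that evolve by K-promotion.  When P carries an
   order-reversing involution, the labels of suitable x and of the dual of x at shifted times
   determine each other, so the bits at such an x have period R + c + 1 in time.  If the length of
   the orbit is prime to R + c + 1 they are then constant in time, the column of x is always full or
   always empty, and propagating this along the poset contradicts the duality.  The relation between
   dual labels comes for rectangles from the longest increasing runs of the row reading word (a
   K-Knuth invariant), for shifted staircases by unfolding to a square, and for the two exceptional
   posets from a finite computation with windows of bounded width, label contents being rotated by
   K-promotion.

   The minuscule posets of a root datum are identified by determining the component of delta in the
   Dynkin diagram.  Affine diagrams are excluded by the null vectors of their Cartan matrices, and
   the remaining positions of delta by a root whose coroot dominates a given one, or by an explicit
   sequence of reflections for F4.  The roots involving delta are then listed by their coefficient
   vectors: all of them are reached by reflections in the other simple roots from delta or, in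
   types B and C, from one further long root. *)

(** * Rowmotion fields and K-promotion *)

(** The six rules of a field are local and, as a set, are preserved by duality and by a suitable
    reversal of time. This is why a one-sided statement about labels, [frame_at], suffices: duality
    turns it into an equivalence between a bit and a dual bit, reversal supplies a second
    equivalence at another time, and comparing the two yields the period [R + 1 + c].

    For the exceptional posets only the top cell of a column is examined. Its frame property
    concerns [R + 1 + c - w] promotion steps with [w = rk x + 1], hence only the w largest labels.
    This window does not grow with c, so that one computation is valid for all c.

    For propellers and the Freudenthal poset duality does not end the argument, because the dual of
    the last element forced to be full lies above it. What remains is a diamond with one side that
    alternates in time and forces c = 1; then the period and [R + 1 + c] are both even. *)

Record field (T : Type) (S : pred T) (nb : rel T) (c : nat) (b : int -> T -> nat -> bool) :
    Prop := Field {
  f_down : forall t x y z, S x -> S y -> nb x y -> (z < c)%N -> b t y z -> b t x z;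
  f_downz : forall t x z, S x -> (z.+1 < c)%N -> b t x z.+1 -> b t x z;
  f_past : forall t x y z, S x -> S y -> nb x y -> (z < c)%N -> b (t + 1) y z -> b t x z;
  f_pastz : forall t x z, S x -> (z.+1 < c)%N -> b (t + 1) x z.+1 -> b t x z;
  f_in : forall t x z, S x -> (z < c)%N -> ~~ b t x z ->
    (forall w, S w -> nb w x -> b t w z) -> ((0 < z)%N -> b t x z.-1) -> b (t + 1) x z;
  f_out : forall t x z, S x -> (z < c)%N -> b (t + 1) x z ->
    (forall y, S y -> nb x y -> ~~ b (t + 1) y z) ->
    ((z.+1 < c)%N -> ~~ b (t + 1) x z.+1) -> ~~ b t x z }.

Definition periodic (T : Type) (N : nat) (b : int -> T -> nat -> bool) : Prop :=
  forall t x z, b (t + N%:Z) x z = b t x z.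

Lemma periodicM (T : Type) N (b : int -> T -> nat -> bool) k : periodic N b -> periodic (k * N) b.
Proof.
move=> h; elim: k => [|k IH] t x z; first by rewrite mul0n addr0.
by rewrite (_ : t + _ = t + (k * N)%N%:Z + N%:Z) ?h ?IH //; lia.
Qed.

Record symmetric_graded (T : Type) (S : pred T) (nb : rel T) (rk : T -> nat) (rot : T -> T)
    (R : nat) : Prop := SymmetricGraded {
  sg_rk : forall x y, nb x y -> rk y = (rk x).+1;
  sg_le : forall x, S x -> (rk x <= R)%N;
  sg_low : forall x, S x -> (0 < rk x)%N -> exists2 w, S w & nb w x;
  sg_rot : forall x, S x -> S (rot x);
  sg_rotK : forall x, S x -> rot (rot x) = x;
  sg_nb : forall x y, S x -> S y -> nb x y = nb (rot y) (rot x);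
  sg_rkrot : forall x, S x -> rk (rot x) = (R - rk x)%N }.

(** * Symmetries of fields *)

Section Fields.
Variables (T : Type) (S : pred T) (nb : rel T) (rk : T -> nat) (rot : T -> T) (R c : nat).
Hypothesis sg : symmetric_graded S nb rk rot R.

Local Notation field := (field S nb c).

(** The time reflection carries the shift [rk x + z] so that [f_down] and [f_past] trade places, as
    do [f_downz] and [f_pastz], while [f_in] and [f_out] each turn into their own contrapositive. *)
Definition rev_field (b : int -> T -> nat -> bool) : int -> T -> nat -> bool :=
  fun t x z => b ((rk x + z)%N%:Z - t) x z.

Lemma field_rev b : field b -> field (rev_field b).
Proof.
move=> [h1 h2 h3 h4 h5 h6]; rewrite /rev_field; have nrk := sg_rk sg.
split.
- move=> t x y z Sx Sy xy zc; rewrite (nrk _ _ xy) => h; apply: (h3 _ x y) => //.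
  by move: h; congr (b _ y z); lia.
- move=> t x z Sx zc h; apply: h4 => //; move: h; congr (b _ x _); lia.
- move=> t x y z Sx Sy xy zc; rewrite (nrk _ _ xy) => h; apply: (h1 _ x y) => //.
  by move: h; congr (b _ y z); lia.
- move=> t x z Sx zc h; apply: h2 => //; move: h; congr (b _ x _); lia.
- move=> t x z Sx zc nh hw hz; apply: contraR nh => nh.
  rewrite (_ : _ - t = (rk x + z)%N%:Z - (t + 1) + 1); last by lia.
  apply: h5 => //.
  + move=> w Sw wx; have := hw w Sw wx; rewrite (nrk _ _ wx); congr (b _ w z); lia.
  + move=> z0; have := hz z0; congr (b _ x _); lia.
- move=> t x z Sx zc h hy hz; apply/negP => nh.
  have : ~~ b ((rk x + z)%N%:Z - (t + 1)) x z.
    apply: h6 => //.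
    + by move: nh; congr (b _ x z); lia.
    + move=> y Sy xy; have := hy y Sy xy; rewrite (nrk _ _ xy); congr (~~ b _ y z); lia.
    + move=> z0; have := hz z0; congr (~~ b _ x _); lia.
  by rewrite h.
Qed.

(** Complement and rotation turn ideals into ideals; reversing time as well makes [f_in] and [f_out]
    change roles. *)
Definition dual_field (b : int -> T -> nat -> bool) : int -> T -> nat -> bool :=
  fun t x z => ~~ b (- t) (rot x) (c - z.+1)%N.

Lemma field_dual b : field b -> field (dual_field b).
Proof.
move=> [h1 h2 h3 h4 h5 h6]; rewrite /dual_field.
have Srot := sg_rot sg; have rotK := sg_rotK sg; have nb_rot := sg_nb sg.
have zE z : (z.+1 < c)%N -> (c - z.+1)%N = (c - z.+2).+1 by lia.
split.
- move=> t x y z Sx Sy xy zc; apply: contraNN.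
  by apply: h1 => //; [exact: Srot|exact: Srot|rewrite -nb_rot|lia].
- move=> t x z Sx zc; apply: contraNN; rewrite zE //.
  by apply: h2 => //; [exact: Srot|lia].
- move=> t x y z Sx Sy xy zc; apply: contraNN => h.
  apply: (h3 _ _ (rot x)) => //; [exact: Srot|exact: Srot|by rewrite -nb_rot|lia|].
  by move: h; congr (b _ _ _); lia.
- move=> t x z Sx zc; apply: contraNN; rewrite zE // => h.
  apply: h4 => //; [exact: Srot|lia|].
  by move: h; congr (b _ _ _); lia.
- move=> t x z Sx zc; rewrite negbK => h hw hz.
  have := h6 (- (t + 1)) (rot x) (c - z.+1)%N; apply => //; [exact: Srot|lia|..].
  + by move: h; congr (b _ _ _); lia.
  + move=> y Sy xy; have Sy' := Srot _ Sy; have := hw (rot y) Sy'.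
    rewrite rotK // nb_rot // rotK // => /(_ xy); congr (~~ b _ _ _); lia.
  + move=> z0; have := hz _; rewrite (_ : (c - z.-1.+1 = (c - z.+1).+1)%N); last by lia.
    move=> H; have {H} := H ltac:(lia); congr (~~ b _ _ _); lia.
- move=> t x z Sx zc h hy hz; rewrite negbK.
  have := h5 (- (t + 1)) (rot x) (c - z.+1)%N (Srot _ Sx) ltac:(lia) h.
  rewrite (_ : - (t + 1) + 1 = - t); last by lia.
  apply.
  + move=> w Sw wx; have Sw' := Srot _ Sw; have := hy (rot w) Sw'.
    by rewrite rotK // nb_rot // rotK // negbK => /(_ wx).
  + move=> z0; have := hz _; rewrite negbK.
    rewrite (_ : (c - z.+2 = (c - z.+1).-1)%N); last by lia.
    by move=> H; have {H} := H ltac:(lia).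
Qed.

Lemma periodic_dual N b : periodic N b -> periodic N (dual_field b).
Proof.
move=> h t x z; rewrite /dual_field -(h (- (t + N%:Z))); congr (~~ b _ _ _); lia.
Qed.

(** * Increasing labelings read off a field *)

Section Labels.
Variable b : int -> T -> nat -> bool.

Definition height t x : nat := (\sum_(z < c) b t x z)%N.

(* Reading the columns of b along the slanted time slice t = j + rk x turns rowmotion into
   K-promotion of increasing labelings. *)
Definition lab (j : int) (x : T) : int :=
  j + (rk x)%:Z + 1 + c%:Z - (height (j + (rk x)%:Z) x)%:Z.

Lemma labE j x : lab j x = j + (rk x)%:Z + 1 + c%:Z - (height (j + (rk x)%:Z) x)%:Z.
Proof. by []. Qed.

Hypothesis fb : field b.

Lemma heightP t x z : S x -> (z < c)%N -> b t x z = (z < height t x)%N.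
Proof.
move=> Sx zc.
have down k z' : (z' + k < c)%N -> b t x (z' + k)%N -> b t x z'.
  elim: k => [|k IH]; rewrite ?addn0 // addnS => h /(f_downz fb Sx h); apply: IH; lia.
rewrite /height -(big_mkord xpredT (fun z => nat_of_bool (b t x z))).
rewrite (big_cat_nat (n := z)) //=; last by lia.
case bz: (b t x z).
  rewrite [X in (_ < X + _)%N](_ : _ = z).
    by rewrite big_ltn // bz /=; lia.
  rewrite -[RHS]muln1 -[in RHS](subn0 z) -sum_nat_const_nat; apply: eq_big_nat => i /= hi.
  by rewrite (down (z - i)%N) // subnKC //; lia.
rewrite [X in (_ + X)%N](_ : _ = 0)%N; last first.
  rewrite big_nat_cond big1 // => i; rewrite andbT => /andP[hi hi'].
  case bi: (b t x i) => //.
  by have := down (i - z)%N z; rewrite subnKC // bi bz => /(_ hi' isT).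
apply/esym/negbTE; rewrite -leqNgt addn0.
rewrite -[leqRHS]muln1 -[in leqRHS](subn0 z) -sum_nat_const_nat.
by apply: leq_sum => i _; case: (b t x i).
Qed.

Lemma height_le t x : (height t x <= c)%N.
Proof.
rewrite -[leqRHS]card_ord -sum1_card; apply: leq_sum => i _; by case: (b t x i).
Qed.

Lemma height_leP t t' x y : S x -> S y ->
  (forall z, (z < c)%N -> b t' y z -> b t x z) -> (height t' y <= height t x)%N.
Proof.
move=> Sx Sy h; case E: (height t' y) => [//|k].
have kc : (k < c)%N by have := height_le t' y; lia.
by have := h k kc; rewrite !heightP // E; lia.
Qed.

Lemma lab_nb j x y : S x -> S y -> nb x y -> lab j x < lab j y.
Proof.
move=> Sx Sy xy; rewrite /lab (sg_rk sg xy).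
have : (height (j + (rk x).+1%:Z) y <= height (j + (rk x)%:Z) x)%N.
  apply: height_leP => // z zc; have := f_past fb Sx Sy xy zc (t := j + (rk x)%:Z).
  by rewrite (_ : j + (rk x).+1%:Z = j + (rk x)%:Z + 1); last lia.
by move: (height _ y) (height _ x) => ? ?; lia.
Qed.

Lemma lab_next_nb j x y : S x -> S y -> nb x y -> lab (j + 1) x <= lab j y.
Proof.
move=> Sx Sy xy; rewrite /lab (sg_rk sg xy).
rewrite (_ : j + 1 + (rk x)%:Z = j + (rk x).+1%:Z); last by lia.
have : (height (j + (rk x).+1%:Z) y <= height (j + (rk x).+1%:Z) x)%N.
  by apply: height_leP => // z zc; apply: (f_down fb).
by move: (height _ y) (height _ x) => ? ?; lia.
Qed.

Lemma lab_gt j x : j < lab j x.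
Proof. by rewrite /lab; have := height_le (j + (rk x)%:Z) x; lia. Qed.

Lemma lab_max j x : S x -> lab j x <= j + (R + 1 + c)%N%:Z.
Proof. by move=> /(sg_le sg); rewrite /lab; lia. Qed.

(** Every label except the smallest value of the window survives a step. Either the column of [x]
    gains exactly one cell, which compensates the shift of the slice, or a lower neighbour of equal
    height blocks it and inherits the label. A complete column at rank 0 would carry the excluded
    smallest value. *)
Lemma lab_slide j x : S x -> j + 1 < lab j x ->
  lab (j + 1) x = lab j x \/
  exists w, [/\ S w, nb w x & lab (j + 1) w = lab j x].
Proof.
move=> Sx hx; set s := j + (rk x)%:Z; set H := height s x.
have labw w : S w -> nb w x -> height s w = H -> lab (j + 1) w = lab j x.
  move=> Sw wx hw; rewrite /lab -/s -/H.
  rewrite (_ : j + 1 + (rk w)%:Z = s); last by rewrite /s (sg_rk sg wx); lia.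
  by rewrite hw /s (sg_rk sg wx).
have hge w : S w -> nb w x -> (H <= height s w)%N.
  by move=> Sw wx; apply: height_leP => // z zc; apply: (f_down fb).
have [Hc|Hc] := ltnP H c; last first.
  have Hc' : H = c by have := height_le s x; rewrite -/H; lia.
  have [x0|/(sg_low sg Sx)[w Sw wx]] := posnP (rk x).
    by move: hx; rewrite /lab -/s -/H Hc' /s x0; lia.
  right; exists w; split => //; apply: labw => //.
  by apply/eqP; rewrite eqn_leq hge // Hc' height_le.
have [[w [Sw wx hw]]|noW] := pselect (exists w, [/\ S w, nb w x & (height s w <= H)%N]).
  right; exists w; split => //; apply: labw => //.
  by apply/eqP; rewrite eqn_leq hw hge.
left; have allw w : S w -> nb w x -> (H < height s w)%N.
  by move=> Sw wx; rewrite ltnNge; apply/negP => hw; apply: noW; exists w.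
have s1 : j + 1 + (rk x)%:Z = s + 1 by rewrite /s; lia.
suff E : height (s + 1) x = H.+1 by rewrite /lab s1 E -/s -/H; lia.
apply/eqP; rewrite eqn_leq; apply/andP; split.
  rewrite leqNgt; apply/negP => hH.
  have hc : (H.+1 < c)%N by apply: leq_trans (height_le (s + 1) x).
  have : b (s + 1) x H.+1 by rewrite heightP.
  by move=> /(f_pastz fb Sx hc); rewrite heightP // ?ltnn //; lia.
rewrite -heightP //; apply: (f_in fb) => //.
- by rewrite heightP // ltnn.
- by move=> w Sw wx; rewrite heightP //; apply: allw.
- by move=> H0; rewrite heightP // /H; lia.
Qed.

(** Mirror image of [lab_slide]. The neighbour [y0] settles the case of an empty new column, in
    which a top element would receive the fresh largest value. *)
Lemma lab_fill j x y0 : S x -> S y0 -> nb x y0 ->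
  lab (j + 1) x = lab j x \/
  exists y, [/\ S y, nb x y & lab (j + 1) x = lab j y].
Proof.
move=> Sx Sy0 xy0; set s := j + (rk x)%:Z.
have s1 : j + 1 + (rk x)%:Z = s + 1 by rewrite /s; lia.
set H := height (s + 1) x.
have laby y : S y -> nb x y -> height (s + 1) y = H -> lab (j + 1) x = lab j y.
  move=> Sy xy hy; rewrite /lab s1 -/H (sg_rk sg xy).
  rewrite (_ : j + (rk x).+1%:Z = s + 1); last by rewrite /s; lia.
  by rewrite hy /s; lia.
have hle y : S y -> nb x y -> (height (s + 1) y <= H)%N.
  by move=> Sy xy; apply: height_leP => // z zc; apply: (f_down fb).
have [[y [Sy xy hy]]|noY] := pselect (exists y, [/\ S y, nb x y & (H <= height (s + 1) y)%N]).
  right; exists y; split => //; apply: laby => //.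
  by apply/eqP; rewrite eqn_leq hy hle.
have [H0|Hp] := posnP H.
  by case: noY; exists y0; split => //; rewrite H0.
left; have Hc : (H.-1 < c)%N by have := height_le (s + 1) x; rewrite -/H; lia.
suff E : height s x = H.-1 by rewrite /lab s1 E -/H /s; lia.
apply/eqP; rewrite eqn_leq; apply/andP; split.
  rewrite leqNgt -heightP //; apply: (f_out fb) => //.
  - by rewrite heightP // -/H; lia.
  - move=> y Sy xy; rewrite heightP // -leqNgt; have [h|h] := leqP H (height (s + 1) y).
      by case: noY; exists y.
    by lia.
  - by move=> h; rewrite heightP // -/H; lia.
case EH : H.-1 => [//|k]; have kc : (k.+1 < c)%N by rewrite -EH.
rewrite -heightP //; last exact: ltnW.
by apply: (f_pastz fb Sx) => //; rewrite heightP // -/H -EH; lia.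
Qed.

End Labels.

(** After k steps the values up to [j + k] have left the window and those above [j + R + 1 + c] are
    fresh: a dual label that outlives the k steps forces an old value at [x]. *)
Definition frame_at (x : T) (k : nat) : Prop := forall b, field b -> forall j : int,
  j + k%:Z < lab b j (rot x) -> lab b (j + k%:Z) x <= j + (R + 1 + c)%N%:Z.

(** * Reciprocity between dual columns, and periodicity *)

Section Reciprocity.
Variables (x : T) (z : nat).
Hypotheses (Sx : S x) (zc : (z < c)%N) (hx : frame_at x (R + 1 + z - rk x)).

(** With k = [R + 1 + z - rk x] steps, a missing bit at height [z] says exactly that the label of
    [x] is fresh. By the frame property the dual label is then among the k expelled values, which is
    the bit on the right. *)
Lemma bits_half b t : field b -> ~~ b t x z ->
  b (t - (rk x + z + 1)%N%:Z) (rot x) (c - z.+1)%N.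
Proof.
move=> fb; have Sj := sg_rot sg Sx; have rx := sg_le sg Sx.
rewrite !heightP //; last by lia.
move=> hh; rewrite ltnNge; apply/negP => hh'.
set k := (R + 1 + z - rk x)%N.
set j := t - (rk x)%:Z - k%:Z.
have := hx fb (j := j); rewrite -/k /lab (sg_rkrot sg Sx).
rewrite (_ : j + k%:Z + (rk x)%:Z = t); last by rewrite /j; lia.
rewrite (_ : j + (R - rk x)%N%:Z = t - (rk x + z + 1)%N%:Z); last by rewrite /j /k; lia.
have k_n : k%:Z = R%:Z + 1 + z%:Z - (rk x)%:Z by rewrite /k; lia.
by move: hh hh'; rewrite -leqNgt => hh hh' H; have := H ltac:(lia); rewrite /j; lia.
Qed.

(** The converse of [bits_half] is [bits_half] for the dual field. *)
Lemma bits_rot b t : field b ->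
  b t x z = ~~ b (t - (rk x + z + 1)%N%:Z) (rot x) (c - z.+1)%N.
Proof.
move=> fb; apply/idP/idP; last by apply: contraNT => h; apply: bits_half.
have := bits_half (t := - (t - (rk x + z + 1)%N%:Z)) (field_dual fb).
rewrite /dual_field opprK negbK => h bt; apply/negP => /h.
rewrite (sg_rotK sg) //.
have -> : - (- (t - (rk x + z + 1)%N%:Z) - (rk x + z + 1)%N%:Z) = t.
  by move: (rk x + z + 1)%N => k; lia.
by have -> : (c - (c - z.+1).+1)%N = z; [lia|rewrite bt].
Qed.

(** Reciprocity relates the bit at the later time to a dual bit in its past; through the reversed
    field it relates the bit at time [t] to a dual bit in its future. Both are the same dual bit. *)
Lemma bits_periodic b t : field b -> b (t + (R + 1 + c)%N%:Z) x z = b t x z.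
Proof.
move=> fb; have rx := sg_le sg Sx; rewrite (bits_rot _ fb).
have := bits_rot ((rk x + z)%N%:Z - t) (field_rev fb); rewrite /rev_field (sg_rkrot sg Sx).
rewrite (_ : _ - (_ - t) = t); last by lia.
move=> ->; congr (~~ b _ _ _); lia.
Qed.

Lemma bits_const b N : field b -> (0 < N)%N -> periodic N b -> coprime N (R + 1 + c) ->
  forall t t', b t x z = b t' x z.
Proof.
move=> fb N0 pb co; pose q := (R + 1 + c)%N.
have perq k t : b (t + (k * q)%N%:Z) x z = b t x z.
  elim: k => [|k IH]; first by rewrite mul0n addr0.
  by rewrite (_ : t + _ = t + (k * q)%N%:Z + q%:Z) ?bits_periodic //; lia.
have step t : b (t + 1) x z = b t x z.
  case: (egcdnP q N0) => u v e _; move: co; rewrite /coprime => /eqP co.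
  rewrite -(perq v (t + 1)).
  have -> : t + 1 + (v * q)%N%:Z = t + (u * N)%N%:Z.
    by rewrite e; move: (v * q)%N => w; rewrite -/q in co; rewrite co; lia.
  exact: (periodicM u pb).
have stepn k t : b (t + k%:Z) x z = b t x z.
  elim: k => [|k IH]; first by rewrite addr0.
  by have -> : t + k.+1%:Z = t + k%:Z + 1 by [lia]; rewrite step.
move=> t t'; have [h|h] := leP t t'.
  by rewrite -(stepn `|t' - t|%N t); congr (b _ _ _); lia.
by rewrite -(stepn `|t - t'|%N t'); congr (b _ _ _); lia.
Qed.

End Reciprocity.

(** * Columns that are always full or always empty *)

Section Full.
Variable b : int -> T -> nat -> bool.
Hypotheses (c0 : (0 < c)%N) (fb : field b).

Definition full x := forall t, b t x c.-1.
Definition empty x := forall t, ~~ b t x 0%N.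

(** Otherwise the top cell of [x] would be maximal in the ideal at time [t], and by [f_out] absent
    one step earlier. *)
Lemma full_up x t : S x -> full x -> exists y, [/\ S y, nb x y & b t y c.-1].
Proof.
move=> Sx fx; apply: contrapT => no.
have : ~~ b (t - 1) x c.-1; last by rewrite fx.
have cc : (c.-1 < c)%N by lia.
apply: (f_out fb Sx cc); [exact: fx| |by lia].
move=> y Sy xy; rewrite subrK; apply/negP => h; apply: no; by exists y.
Qed.

Lemma full_up1 x y : S x -> full x -> (forall y', S y' -> nb x y' -> y' = y) -> full y.
Proof. by move=> Sx fx u t; have [y' [Sy' xy' h]] := full_up t Sx fx; rewrite -(u y'). Qed.

Lemma full_col x t z : S x -> b t x c.-1 -> (z < c)%N -> b t x z.
Proof. by move=> Sx h zc; move: h; rewrite !(heightP fb) //; lia. Qed.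

(** Over full lower neighbours the lowest missing cell enters at the next step, which constancy in
    time forbids. *)
Lemma const_full x : S x -> (forall z t t', (z < c)%N -> b t x z = b t' x z) ->
  (forall w, S w -> nb w x -> full w) -> full x.
Proof.
move=> Sx cst fw.
suff all z : (z < c)%N -> forall t, b t x z by move=> t; apply: all; lia.
elim: z => [|z IH] zc t; case e: (b t x _) => //.
  suff : b (t + 1) x 0%N by rewrite (cst _ _ t) ?e.
  apply: (f_in fb) => //; first by rewrite e.
  by move=> w Sw wx; apply: full_col => //; apply: fw.
suff : b (t + 1) x z.+1 by rewrite (cst _ _ t) ?e.
apply: (f_in fb) => //; first by rewrite e.
  by move=> w Sw wx; apply: full_col => //; apply: fw.
by move=> _; apply: IH; lia.
Qed.

(* Between a full element u and an empty element v, the column of x is forced to be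
   all or nothing, hence to alternate. *)
Lemma diamond_alternates u v x y : S u -> S v -> S x -> S y ->
  full u -> empty v ->
  (forall w, S w -> nb w x -> w = u) -> (forall w, S w -> nb x w -> w = v) ->
  (forall w, S w -> nb u w -> w = x \/ w = y) -> (forall w, S w -> nb w v -> w = x \/ w = y) ->
  c = 1%N /\ forall t, b (t + 1) x 0%N = ~~ b t x 0%N.
Proof.
move=> Su Sv Sx Sy fu ev lx ux uu lv.
have vempty t z : (z < c)%N -> ~~ b t v z.
  by move=> zc; have := ev t; rewrite !(heightP fb) //; lia.
(* All or nothing: if the top cell of [x] is missing, fullness of [u] completes the column of [y];
   then both lower neighbours of [v] reach level 0 and [v] enters. *)
have aon t : b t x 0%N -> b t x c.-1.
  move=> h; apply: contraT => h'.
  have [w [Sw uw bw]] := full_up t Su fu.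
  have : b t y c.-1.
    by case: (uu w Sw uw) bw => -> // bx; move: h'; rewrite bx.
  move=> /(full_col Sy) /(_ c0) hy.
  suff : b (t + 1) v 0%N by rewrite (negbTE (ev _)).
  by apply: (f_in fb) => // w' Sw' w'v; case: (lv w' Sw' w'v) => ->.
have into t : ~~ b t x 0%N -> b (t + 1) x 0%N.
  move=> h; apply: (f_in fb) => // w Sw wx; rewrite (lx w Sw wx); exact: full_col.
have out t : b (t + 1) x c.-1 -> ~~ b t x c.-1.
  have cc : (c.-1 < c)%N by lia.
  move=> h; apply: (f_out fb Sx cc h); last by lia.
  by move=> w Sw xw; rewrite (ux w Sw xw); apply: vempty; lia.
(* For c at least 2, a column that is nonempty at time t is full, hence was empty at time t - 1; but
   [f_pastz] gives it c - 1 cells at that time. *)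
have c1 : c = 1%N.
  apply/eqP; rewrite eqn_leq c0 andbT leqNgt; apply/negP => c2.
  have none t : ~~ b t x 0%N.
    apply/negP => h0; have := aon _ h0 => h.
    have : ~~ b (t - 1) x c.-1 by apply: out; rewrite subrK.
    move=> h1; have n1 : ~~ b (t - 1) x 0%N by apply: contra h1; apply: aon.
    move: h; rewrite -[t](subrK 1) (_ : c.-1 = c.-2.+1); last by lia.
    move=> /(f_pastz fb Sx) -/(_ ltac:(lia)) h2.
    move: n1 h2; rewrite !(heightP fb) //; last by lia.
    by move: (height _ _ _) => k; lia.
  by have := into 0 (none 0); rewrite (negbTE (none _)).
split=> // t; move: aon into out; rewrite c1 /= => _ into out.
by apply/idP/idP; [exact: out|exact: into].
Qed.

End Full.

Lemma periodic_alt_even b x N : (forall t, b (t + 1) x 0%N = ~~ b t x 0%N) ->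
  @periodic T N b -> ~~ odd N.
Proof.
move=> alt /(_ 0 x 0%N).
have -> : forall n t, b (t + n%:Z) x 0%N = odd n (+) b t x 0%N.
  elim=> [|n IH] t; first by rewrite addr0.
  by rewrite (_ : t + _ = t + n%:Z + 1) ?alt ?IH /= ?addNb //; lia.
by case: odd; case: (b 0 x 0%N).
Qed.

(* The content of an increasing labeling is rotated by K-promotion. *)
Lemma frame_min x0 : (forall x, S x -> rk x = 0%N -> x = x0) -> S x0 -> rk x0 = 0%N ->
  forall k, frame_at x0 k.
Proof.
move=> u0 S0 r0 k b fb j hj.
suff [y Sy hy] : exists2 y, S y & lab b (j + k%:Z) y = lab b j (rot x0).
  apply: (@le_trans _ _ (lab b (j + k%:Z) y)); last by rewrite hy lab_max // (sg_rot sg).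
  move: (rk y) {-2}y (erefl (rk y)) Sy {hy} => n; elim: n => [|n IH] {}y yn Sy.
    by rewrite (u0 y).
  have [|w Sw wy] := sg_low sg Sy; first by rewrite yn.
  apply: (le_trans (IH w _ Sw)); first by have := sg_rk sg wy; lia.
  by apply/ltW/lab_nb.
elim: k hj => [|k IH] hj; first by exists (rot x0); rewrite ?addr0 ?(sg_rot sg).
have [|y Sy hy] := IH; first by lia.
have e : j + k.+1%:Z = j + k%:Z + 1 by lia.
have [|h|[w [Sw wy h]]] := @lab_slide b fb (j + k%:Z) y Sy; first by rewrite hy -e.
  by exists y; rewrite // e h.
by exists w; rewrite // e h.
Qed.

End Fields.

(** Any positive period is allowed, so that a field can be replaced by an unfolding of it without
    tracking orbit sizes. *)
Definition field_NRP (T : Type) (S : pred T) (nb : rel T) (R : nat) : Prop :=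
  forall c b N, (0 < c)%N -> (0 < N)%N -> field S nb c b -> periodic N b ->
  ~~ coprime N (R + 1 + c).

(** * Rectangles, shifted staircases and propellers *)

Notation cell := (nat * nat)%type.

Definition gridnb (x y : cell) : bool := (y == (x.1.+1, x.2)) || (y == (x.1, x.2.+1)).

Definition gridrk (x : cell) : nat := (x.1 + x.2)%N.

Definition gridrot (m n : nat) (x : cell) : cell := (m - x.1, n - x.2)%N.

Definition le2 (x y : cell) : bool := ((x.1 <= y.1) && (x.2 <= y.2))%N.

Lemma gridnb_rk x y : gridnb x y -> gridrk y = (gridrk x).+1.
Proof. by case: x y => [r s] [r' s'] /orP[] /eqP[-> ->]; rewrite /gridrk /=; lia. Qed.

Lemma gridnbE r s r' s' : gridnb (r, s) (r', s') =
  ((r' == r.+1) && (s' == s)) || ((r' == r) && (s' == s.+1)).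
Proof. by rewrite /gridnb !xpair_eqE. Qed.

(** Coordinates start at 0: this is the product of chains with [m + 1] and [n + 1] elements, of rank
    [m + n]. *)
Definition rect (m n : nat) : pred cell := fun x => (x.1 <= m)%N && (x.2 <= n)%N.

Lemma rect_sg m n : symmetric_graded (rect m n) gridnb gridrk (gridrot m n) (m + n).
Proof.
split.
- exact: gridnb_rk.
- by case=> r s; rewrite /rect /gridrk /=; lia.
- case=> [[|r] s]; rewrite /rect /gridrk /= => Sx h.
    by exists (0, s.-1)%N; rewrite ?gridnbE /=; lia.
  by exists (r, s); rewrite ?gridnbE /=; lia.
- by case=> r s; rewrite /rect /gridrot /=; lia.
- by case=> r s; rewrite /rect /gridrot /= => h; congr (_, _); lia.
- by case=> r s [r' s']; rewrite /rect /gridrot /= !gridnbE; lia.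
- by case=> r s; rewrite /rect /gridrot /gridrk /=; lia.
Qed.

(** * Increasing runs in a rectangle *)

Section Rectangle.
Variables (m n c : nat).
Local Notation S := (rect m n).
Let sg := rect_sg m n.

Section Labels.
Variable b : int -> cell -> nat -> bool.
Hypothesis fb : field S gridnb c b.
Local Notation lab := (lab gridrk c b).

Lemma rect_low x y : S x -> S y -> le2 x y -> x != y ->
  exists y', [/\ S y', gridnb y' y & le2 x y'].
Proof.
case: x y => r s [r' s']; rewrite /rect /le2 /= xpair_eqE => Sx Sy xy nxy.
have [h|h] := ltnP r r'.
  by exists (r'.-1, s'); rewrite gridnbE /=; split; lia.
by exists (r', s'.-1); rewrite gridnbE /=; split; lia.
Qed.

Lemma lab_le_aux j x y : S x -> S y -> le2 x y ->
  lab j x <= lab j y /\ (x != y -> lab j x < lab j y /\ lab (j + 1) x <= lab j y).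
Proof.
move=> Sx; have [k] := ubnP (gridrk y); elim: k y => // k IH y yk Sy xy.
have [<-//|nxy] := eqVneq x y.
have [y' [Sy' y'y xy']] := rect_low Sx Sy xy nxy.
have [|h1 h2] := IH y' _ Sy' xy'; first by have := gridnb_rk y'y; lia.
have h := lab_nb sg fb j Sy' Sy y'y.
split; first exact: le_trans h1 (ltW h).
move=> _; split; first exact: le_lt_trans h1 h.
have [->|nxy'] := eqVneq x y'; first exact: (lab_next_nb sg).
by have [_ h3] := h2 nxy'; apply: le_trans h3 (ltW h).
Qed.

Lemma lab_lt j x y : S x -> S y -> le2 x y -> x != y -> lab j x < lab j y.
Proof. by move=> Sx Sy xy; have [_ h] := lab_le_aux j Sx Sy xy; case/h. Qed.

Lemma lab_next_le j x y : S x -> S y -> le2 x y -> x != y -> lab (j + 1) x <= lab j y.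
Proof. by move=> Sx Sy xy; have [_ h] := lab_le_aux j Sx Sy xy; case/h. Qed.

(* Increasing subsequences of the row reading word: they never go down, and strictly to the
   right.  Their maximal length is a K-Knuth invariant. *)
Definition ne (j : int) (x y : cell) : bool :=
  [&& (y.1 <= x.1)%N, (x.2 < y.2)%N & lab j x < lab j y].

(** The last alternative does not keep the label: a cell may go up merely to follow the earlier part
    of its run, and then only the bound on its label survives. *)
Definition moved j (x y : cell) : Prop :=
  [/\ S y, lab (j + 1) y <= lab j x &
   [\/ y = x /\ lab (j + 1) y = lab j x,
       (0 < x.2)%N /\ y = (x.1, x.2.-1) /\ lab (j + 1) y = lab j x |
       (0 < x.1)%N /\ y = (x.1.-1, x.2)]].

Lemma moved_start j x : S x -> j + 1 < lab j x ->
  exists2 y, moved j x y & lab (j + 1) y = lab j x.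
Proof.
move=> Sx /(lab_slide sg fb Sx) [h|[w [Sw wx h]]].
  by exists x => //; split => //; [rewrite h|constructor 1].
exists w => //; split; rewrite ?h //.
case: x w wx Sx Sw h => [r s] [r' s'] /orP[] /eqP[-> ->] /= Sx Sw h.
- by constructor 3.
- by constructor 2.
Qed.

(** [x1] follows its own label, unless [x0] went up within the same row. The only danger is that
    [x1] slides left into the column of [x0]: in the same row the two would share a cell with
    different labels, and in a higher row the label of [x1] would be at most that of [x0]. *)
Lemma ne_step j x0 y0 x1 : S x0 -> S x1 -> j + 1 < lab j x0 -> ne j x0 x1 -> moved j x0 y0 ->
  exists2 y1, moved j x1 y1 & ne (j + 1) y0 y1.
Proof.
move=> Sx0 Sx1 hj /and3P[hr hs hl] [Sy0 hy0 hm].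
have [y1 my1 e1] := moved_start Sx1 (lt_trans hj hl).
have lt01 : lab (j + 1) y0 < lab (j + 1) y1 by rewrite e1 (le_lt_trans hy0).
have [/andP[/eqP r01 /andP[/eqP yup x00]]|nup] := boolP
  ((x1.1 == x0.1) && ((y0 == (x0.1.-1, x0.2)) && (0 < x0.1)%N)).
  (* The rest of the run in this row is lifted to the row above. *)
  case: x0 x1 Sx0 Sx1 hr hs hl r01 yup x00 hj hm hy0 my1 e1 => [r0 s0] [r1 s1] /=.
  move=> Sx0 Sx1 _ hs hl r01 yup r0p hj hm hy0 my1 e1; subst r1 y0.
  have Sy : S (r0.-1, s1) by move: Sx1; rewrite /rect /=; lia.
  exists (r0.-1, s1).
    split => //; last by constructor 3.
    by apply: (lab_next_nb sg) => //; rewrite gridnbE; lia.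
  apply/and3P; split => //=; apply: lab_lt => //.
    by rewrite /le2 /= leqnn ltnW.
  by rewrite xpair_eqE eqxx /= neq_ltn hs.
exists y1 => //; rewrite /ne lt01 andbT.
case: x0 x1 y0 y1 Sx0 Sx1 Sy0 hr hs hl hm hy0 my1 e1 nup lt01 hj => [r0 s0] [r1 s1] [r0' s0'] [r1' s1'] /=.
move=> Sx0 Sx1 Sy0 hr hs hl hm hy0 [Sy1 _ my1] e1 nup lt01 hj.
have hr0' : (r1 <= r0')%N.
  case: hm nup => [[[-> ->]]|[_ [[-> ->] _]]|[r0p [-> ->]]] //.
  by rewrite eqxx r0p !andbT; lia.
have hs0' : (s0' <= s0)%N.
  by case: hm => [[[_ ->]]|[_ [[_ ->] _]]|[r0p [_ ->]]] //=; rewrite ?leq_pred.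
case: my1 => [[[er es] _]|[s1p [[er es] _]]|[r1p [er es]]]; simpl in *; subst r1' s1'; last 1 first.
- by lia.
- by lia.
rewrite hr0' /=; have [//|hbad] := ltnP s0' s1.-1.
have Es : (s0' = s0 /\ s1 = s0.+1)%N by lia.
case: Es => E1 E2; subst s0' s1; simpl in *.
have [er|nr] := eqVneq r1 r0.
  subst r1; case: hm => [[[e] e']|[h [[e e''] _]]|[h [e]]].
  - by move: lt01; subst r0'; rewrite ltxx.
  - by lia.
  - by move: nup; rewrite e h !eqxx.
have : lab (j + 1) (r1, s0) <= lab j (r0, s0).
  apply: lab_next_le => //; first by rewrite /le2 /= leqnn hr.
  by rewrite xpair_eqE eqxx andbT.
by rewrite e1 => h; have := lt_le_trans hl h; rewrite ltxx.
Qed.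

Lemma ne_path j x0 y0 l : S x0 -> all S l -> j + 1 < lab j x0 -> path (ne j) x0 l ->
  moved j x0 y0 ->
  exists l', [/\ size l' = size l, path (ne (j + 1)) y0 l', all S l' &
    lab (j + 1) (last y0 l') <= lab j (last x0 l)].
Proof.
elim: l x0 y0 => [|x1 l IH] x0 y0 Sx0 /=; first by move=> _ _ _ [_ h _]; exists [::].
case/andP => Sx1 Sl hj /andP[h01 hp] m0.
have [y1 m1 n1] := ne_step Sx0 Sx1 hj h01 m0.
have hj1 : j + 1 < lab j x1 by case/and3P: h01 => _ _; apply: lt_trans.
have [l' [sl pl Sl' ll]] := IH x1 y1 Sx1 Sl hj1 hp m1.
exists (y1 :: l'); split => //=; first by rewrite sl.
  by rewrite n1.
by case: m1 => ->.
Qed.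

Lemma ne_iter (j : int) (k : nat) x0 l : S x0 -> all S l -> j + k%:Z < lab j x0 ->
  path (ne j) x0 l ->
  exists y0 l', [/\ size l' = size l, path (ne (j + k%:Z)) y0 l', all S (y0 :: l'),
    lab (j + k%:Z) (last y0 l') <= lab j (last x0 l) & lab (j + k%:Z) y0 = lab j x0].
Proof.
move=> Sx0 Sl hj pl; elim: k hj => [|k IH] hj.
  by exists x0, l; rewrite addr0 /= Sx0.
have [|y0 [l' [sl pl' /= /andP[Sy0 Sl'] hl e0]]] := IH; first by apply: le_lt_trans hj; lia.
have jk : j + k.+1%:Z = j + k%:Z + 1 by lia.
have hj' : j + k%:Z + 1 < lab (j + k%:Z) y0 by rewrite e0 -jk.
have [y1 m1 e1] := moved_start Sy0 hj'.
have [l'' [sl'' pl'' Sl'' hl'']] := ne_path Sy0 Sl' hj' pl' m1.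
exists y1, l''; rewrite jk; split => //.
- by rewrite sl''.
- by rewrite /= Sl''; case: m1 => ->.
- exact: le_trans hl'' hl.
- by rewrite e1.
Qed.

Lemma ne_last j y0 l : path (ne j) y0 l -> (size l <= (last y0 l).2)%N.
Proof.
suff: path (ne j) y0 l -> (y0.2 + size l <= (last y0 l).2)%N by move=> h /h; lia.
elim: l y0 => [|x l IH] y0 /=; first by rewrite addn0.
by case/andP => /and3P[_ h _] /IH; lia.
Qed.

End Labels.


(** The dual of [(0, i)] starts a run of [i + 1] cells along the last row. While its label survives,
    a run of this length persists and the label at its end does not grow. That end lies in column i
    or beyond, hence above [(0, i)]. *)
Lemma rect_frame i k : (i <= n)%N ->
  frame_at S gridnb gridrk (gridrot m n) (m + n) c (0, i)%N k.
Proof.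
move=> hi b fb j; rewrite /gridrot subn0 /= => hj.
have i_n i' : (i' <= i)%N -> S (m, n - i')%N by rewrite /rect /=; lia.
pose l := [seq (m, n - (i - u.+1))%N | u <- iota 0 i].
have Sl : all S l.
  by apply/allP => x /mapP[u]; rewrite mem_iota => hu ->; apply: i_n; lia.
have pl : path (ne b j) (m, n - i)%N l.
  suff : forall d v, (v + d = i)%N ->
     path (ne b j) (m, n - (i - v))%N [seq (m, n - (i - u.+1))%N | u <- iota v d].
    by move=> /(_ i 0%N); rewrite subn0; apply.
  elim=> [//|d IH] v vd /=; rewrite IH ?andbT; last by lia.
  apply/and3P; split => //=; first by lia.
  by apply: (lab_nb sg) => //; [apply: i_n; lia|apply: i_n; lia|rewrite gridnbE; lia].
have [y0 [l' [sl pl' /= /andP[Sy0 Sl'] hl _]]] := ne_iter fb (i_n i (leqnn i)) Sl hj pl.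
have Sy : S (last y0 l').
  by have := mem_last y0 l'; rewrite inE => /orP[/eqP->|/(allP Sl')].
apply: (@le_trans _ _ (lab gridrk c b (j + k%:Z) (last y0 l'))).
  have := ne_last pl'; rewrite sl size_map size_iota => h.
  by have [] := lab_le_aux fb (j + k%:Z) (x := (0, i)%N) _ Sy; rewrite /rect /le2 /= ?hi ?h.
apply: (le_trans hl). apply: (lab_max _ sg).
by have := mem_last (m, n - i)%N l; rewrite inE => /orP[/eqP->|/(allP Sl)//]; apply: i_n.
Qed.

End Rectangle.

Lemma rect_NRP m n : field_NRP (rect m n) gridnb (m + n).
Proof.
move=> c b N c0 N0 fb pb; apply/negP => co.
have sg := rect_sg m n.
have row i : (i <= n)%N -> full c b (0, i)%N.
  elim: i => [|i IH] hi.
    apply: (const_full c0 fb) => [|z t t' zc|[r s] _]; last by rewrite gridnbE; lia.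
      by rewrite /rect.
    by apply: (bits_const sg _ zc _ fb N0 pb co) => //; apply: rect_frame.
  apply: (const_full c0 fb) => [|z t t' zc|[r s] Sw]; first by rewrite /rect.
    by apply: (bits_const sg _ zc _ fb N0 pb co); [rewrite /rect|apply: rect_frame].
  by rewrite gridnbE /= => h; have -> : (r, s) = (0, i)%N by [congr (_, _); lia]; apply: IH; lia.
(* On the last column each cell has a single upper neighbour, so fullness climbs to the maximum,
   which has none. *)
have col r : (r <= m)%N -> full c b (r, n).
  elim: r => [|r IH] hr; first exact: row.
  apply: (full_up1 c0 fb (x := (r, n))) => [||[r' s']]; first by rewrite /rect /=; lia.
    by apply: IH; lia.
  by rewrite /rect /= => S'; rewrite gridnbE => h; congr (_, _); lia.
have Smn : rect m n (m, n) by rewrite /rect /= !leqnn.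
have [[r s] [Sy]] := full_up c0 fb 0 Smn (col m (leqnn m)).
by move: Sy; rewrite /rect /= gridnbE; lia.
Qed.

(** * Shifted staircases *)

Definition stair (n : nat) : pred cell := fun x => (x.1 <= x.2)%N && (x.2 <= n)%N.

Definition sorted2 (x : cell) : cell := (minn x.1 x.2, maxn x.1 x.2).

(* A field on the shifted staircase unfolds to a symmetric field on the square. *)
Lemma stair_unfold n c b : field (stair n) gridnb c b ->
  field (rect n n) gridnb c (fun t x => b t (sorted2 x)).
Proof.
move=> fb.
have S2 x : rect n n x -> stair n (sorted2 x).
  by case: x => r s; rewrite /rect /stair /sorted2 /=; lia.
have nb2 x y : gridnb x y -> gridnb (sorted2 x) (sorted2 y).
  by case: x y => r s [r' s']; rewrite /sorted2 !gridnbE /=; lia.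
have low2 x w : rect n n x -> stair n w -> gridnb w (sorted2 x) ->
  exists w', [/\ rect n n w', gridnb w' x & sorted2 w' = w].
  case: x w => r s [r' s']; rewrite /rect /stair /sorted2 gridnbE /= => Sx Sw h.
  have [rs|rs] := leqP r s.
    by exists (r', s'); rewrite /rect /sorted2 gridnbE /=; split; [lia|lia|congr (_, _); lia].
  by exists (s', r'); rewrite /rect /sorted2 gridnbE /=; split; [lia|lia|congr (_, _); lia].
have up2 x w : rect n n x -> stair n w -> gridnb (sorted2 x) w ->
  exists w', [/\ rect n n w', gridnb x w' & sorted2 w' = w].
  case: x w => r s [r' s']; rewrite /rect /stair /sorted2 gridnbE /= => Sx Sw h.
  have [rs|rs] := leqP r s.
    by exists (r', s'); rewrite /rect /sorted2 gridnbE /=; split; [lia|lia|congr (_, _); lia].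
  by exists (s', r'); rewrite /rect /sorted2 gridnbE /=; split; [lia|lia|congr (_, _); lia].
split.
- by move=> t x y z Sx Sy xy; apply: (f_down fb) => //; [apply: S2|apply: S2|apply: nb2].
- by move=> t x z Sx; apply: (f_downz fb); apply: S2.
- by move=> t x y z Sx Sy xy; apply: (f_past fb) => //; [apply: S2|apply: S2|apply: nb2].
- by move=> t x z Sx; apply: (f_pastz fb); apply: S2.
- move=> t x z Sx zc h hw hz; apply: (f_in fb) => //; first exact: S2.
  by move=> w Sw wx; have [w' [Sw' w'x <-]] := low2 _ _ Sx Sw wx; apply: hw.
- move=> t x z Sx zc h hy hz; apply: (f_out fb) => //; first exact: S2.
  by move=> y Sy xy; have [y' [Sy' xy' <-]] := up2 _ _ Sx Sy xy; apply: hy.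
Qed.

Lemma stair_NRP n : field_NRP (stair n) gridnb (n + n).
Proof.
move=> c b N c0 N0 fb pb; apply: (rect_NRP c0 N0 (stair_unfold fb)).
by move=> t x z; apply: pb.
Qed.

(** * Propellers: a diamond at [(0, k)] with a chain attached below and one above *)

Definition propeller (k : nat) : pred cell := fun x =>
  ((x.1 == 0) && (x.2 <= k.+1) || (x.1 == 1) && (k <= x.2 <= k.*2.+1))%N.

Lemma propeller_sg k :
  symmetric_graded (propeller k) gridnb gridrk (gridrot 1 k.*2.+1) k.*2.+2.
Proof.
split.
- exact: gridnb_rk.
- by case=> r s; rewrite /propeller /gridrk /=; lia.
- case=> r s; rewrite /propeller /gridrk /= => Sx h.
  have [e|e] := eqVneq (r, s) (1, k)%N.
    by case: e => -> ->; exists (0, k)%N; rewrite ?gridnbE /=; lia.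
  by exists (r, s.-1)%N; move: e; rewrite xpair_eqE ?gridnbE /=; lia.
- by case=> r s; rewrite /propeller /gridrot /=; lia.
- by case=> r s; rewrite /propeller /gridrot /= => h; congr (_, _); lia.
- by case=> r s [r' s']; rewrite /propeller /gridrot /= !gridnbE; lia.
- by case=> r s; rewrite /propeller /gridrot /gridrk /=; lia.
Qed.

Lemma propeller_full k c b N : (0 < c)%N -> (0 < N)%N -> field (propeller k) gridnb c b ->
  periodic N b -> coprime N (k.*2.+2 + 1 + c) -> full c b (0, k)%N.
Proof.
move=> c0 N0 fb pb co; have sg := propeller_sg k.
have row i : (i <= k)%N -> full c b (0, i)%N.
  elim: i => [|i IH] hi.
    apply: (const_full c0 fb) => [//|z t t' zc|[r s] _]; last by rewrite gridnbE; lia.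
    apply: (bits_const sg _ zc _ fb N0 pb co) => //; apply: (frame_min sg) => //.
    by case=> r s _; rewrite /gridrk /= => h; congr (_, _); lia.
  apply: (full_up1 c0 fb (x := (0, i)%N)) => [||[r' s']]; first by rewrite /propeller /=; lia.
    by apply: IH; lia.
  by rewrite /propeller /= => S'; rewrite gridnbE => h; congr (_, _); lia.
exact: row.
Qed.

Lemma propeller_NRP k : field_NRP (propeller k) gridnb k.*2.+2.
Proof.
move=> c b N c0 N0 fb pb; apply/negP => co; have sg := propeller_sg k.
have fu := propeller_full c0 N0 fb pb co.
have fd := propeller_full c0 N0 (field_dual sg fb) (periodic_dual _ _ pb) co.
(* The dual of [(0, k)] is [(1, k + 1)], so fullness in the dual field is emptiness there. *)
have ev : empty b (1, k.+1)%N.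
  move=> t; have := fd (- t); rewrite /dual_field /gridrot /= opprK.
  by rewrite prednK // subnn; congr (~~ b _ (_, _) _); lia.
have [] := diamond_alternates c0 fb (u := (0, k)%N) (v := (1, k.+1)%N) (x := (1, k)%N) (y := (0, k.+1)%N).
- by rewrite /propeller /=; lia.
- by rewrite /propeller /=; lia.
- by rewrite /propeller /=; lia.
- by rewrite /propeller /=; lia.
- by [].
- by [].
- by case=> r s; rewrite /propeller gridnbE /= => Sw h; congr (_, _); lia.
- by case=> r s; rewrite /propeller gridnbE /= => Sw h; congr (_, _); lia.
- case=> r s; rewrite /propeller gridnbE /= => Sw h.
  by have [r0|r0] := eqVneq r 0%N; [right|left]; congr (_, _); lia.
- case=> r s; rewrite /propeller gridnbE /= => Sw h.
  by have [r0|r0] := eqVneq r 0%N; [right|left]; congr (_, _); lia.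
move=> c1 alt; have := periodic_alt_even alt pb => oddN.
(* With c = 1 the modulus is 2k + 4. *)
have : (2 %| gcdn N (k.*2.+2 + 1 + c))%N.
  by rewrite dvdn_gcd !dvdn2 oddN c1 /= !oddD /= odd_double.
by move: co; rewrite /coprime => /eqP ->.
Qed.

(** * Posets given by tables *)

Section Tables.
Variables (n : nat) (upt lowt : seq (seq nat)) (rkt rott : seq nat) (R : nat).

Definition tS : pred nat := fun x => (x < n)%N.
Definition tnb : rel nat := fun x y => y \in nth [::] upt x.
Definition trk (x : nat) : nat := nth 0%N rkt x.
Definition trot (x : nat) : nat := nth 0%N rott x.

Definition table_ok : bool :=
  [&& (size upt == n) && (size lowt == n),
      all (fun x => all (fun y => (y < n)%N && (trk y == (trk x).+1)) (nth [::] upt x)) (iota 0 n),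
      all (fun x => nth [::] lowt x == [seq w <- iota 0 n | tnb w x]) (iota 0 n),
      all (fun x => (trk x == 0) || (0 < size (nth [::] lowt x)))%N (iota 0 n),
      all (fun x => (trk x == R) || (0 < size (nth [::] upt x)))%N (iota 0 n),
      all (fun x => [&& trot x < n, trot (trot x) == x, trk x <= R &
                        trk (trot x) == R - trk x])%N (iota 0 n) &
      all (fun x => all (fun y => tnb x y == tnb (trot y) (trot x)) (iota 0 n)) (iota 0 n)].

Hypothesis ok : table_ok.

Lemma table_all (P : pred nat) x : all P (iota 0 n) -> tS x -> P x.
Proof. by move=> /allP h Sx; apply: h; rewrite mem_iota. Qed.

Lemma tnb_dom x y : tnb x y -> tS x /\ tS y /\ trk y = (trk x).+1.
Proof.
move=> xy; case/and5P: ok => un h _ _ _.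
have xn : tS x.
  rewrite /tS ltnNge; apply/negP => h'; move: xy; rewrite /tnb nth_default //.
  by case/andP: un => /eqP-> _.
by have /allP/(_ _ xy)/andP[yn /eqP] := table_all h xn.
Qed.

Lemma lowtE x w : tS x -> (w \in nth [::] lowt x) = tnb w x.
Proof.
move=> Sx; case/and5P: ok => _ _ h _ _; have /eqP-> := table_all h Sx.
rewrite mem_filter mem_iota /=; case e: (tnb w x) => //=.
by have [Sw _] := tnb_dom e.
Qed.

Lemma table_sg : symmetric_graded tS tnb trk trot R.
Proof.
case/and5P: ok => _ _ _ h0 /and3P[hR hrot hnb].
split.
- by move=> x y /tnb_dom[_ []].
- by move=> x /(table_all hrot)/and4P[].
- move=> x Sx x0; have := table_all h0 Sx; rewrite gtn_eqF //= => hs.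
  case e: (nth [::] lowt x) hs => [//|w l] _.
  have : tnb w x by rewrite -lowtE // e mem_head.
  by move=> wx; exists w => //; have [] := tnb_dom wx.
- by move=> x /(table_all hrot)/and4P[].
- by move=> x /(table_all hrot)/and4P[_ /eqP].
- by move=> x y Sx Sy; apply/eqP; apply: (table_all (table_all hnb Sx)).
- by move=> x /(table_all hrot)/and4P[_ _ _ /eqP].
Qed.

Lemma table_up x : tS x -> trk x <> R -> exists2 y, tS y & tnb x y.
Proof.
move=> Sx xR; case/and5P: ok => _ _ _ _ /and3P[hR _ _].
have := table_all hR Sx; move/eqP: xR => /negbTE -> /=.
case e: (nth [::] upt x) => [//|y l] _.
have xy : tnb x y by rewrite /tnb e mem_head.
by exists y => //; have [_ []] := tnb_dom xy.
Qed.

(* An ideal is encoded by its characteristic bit sequence; the part of an increasing labeling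
   with labels in a window of width w becomes a chain of w + 1 ideals, and a promotion step
   slides this chain when some of the maximal elements of its smallest ideal are removed. *)
Definition slide1 (a b d : bitseq) : bitseq :=
  [seq let: ((x, y, z), (u, l)) := p in
       if z then if x then true else
         if y then has (fun y => nth false d y && ~~ nth false b y) u
         else ~~ has (fun w => nth false b w && ~~ nth false a w) l
       else false
  | p <- zip (zip (zip a b) d) (zip upt lowt)].

Fixpoint slide (a b : bitseq) (C : seq bitseq) : seq bitseq :=
  if C is d :: C' then let a' := slide1 a b d in a' :: slide a' d C' else [::].

Definition maximals (b : bitseq) : seq nat :=
  [seq x <- iota 0 n | nth false b x && ~~ has (nth false b) (nth [::] upt x)].

Fixpoint sublists (l : seq nat) : seq (seq nat) :=
  if l is x :: l' then let r := sublists l' in r ++ map (cons x) r else [:: [::]].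

(** The elements carrying one label are maximal in the ideal of all labels up to it, and there may
    be none; hence every subset of the maximal elements is allowed. *)
Definition removals (b : bitseq) : seq bitseq :=
  [seq [seq p.1 && (p.2 \notin s) | p <- zip b (iota 0 n)] | s <- sublists (maximals b)].

Definition window := seq bitseq.

Definition slidew (a : bitseq) (C : window) : window :=
  if C is b :: C' then a :: slide a b C' else [::].

Fixpoint top_windows (w : nat) : seq window :=
  if w is w'.+1 then
    flatten [seq [seq a :: C | a <- removals (head [::] C)] | C <- top_windows w']
  else [:: [:: nseq n true]].

(** Windows are stored by their concatenated bits in a binary trie, which keeps membership tests
    cheap under [vm_compute]. *)
Inductive trie := TLeaf | TNode of bool & trie & trie.

Fixpoint tmem (s : bitseq) (t : trie) {struct t} : bool :=
  if t is TNode m l r then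
    if s is x :: s' then tmem s' (if x then r else l) else m
  else false.

Fixpoint tadd (s : bitseq) (t : trie) : trie :=
  let: (m, l, r) := if t is TNode m l r then (m, l, r) else (false, TLeaf, TLeaf) in
  if s is x :: s' then
    if x then TNode m l (tadd s' r) else TNode m (tadd s' l) r
  else TNode true l r.

Lemma tmem_add s s' t : tmem s (tadd s' t) -> s = s' \/ tmem s t.
Proof.
elim: s' s t => [|x s' IH] [|y s] t; first by left.
- by case: t => [|m l r] /=; [case: y|right].
- by case: t => [|m l r] /=; case: x => //=; right.
- have IH' t' : tmem s (tadd s' t') -> x :: s = x :: s' \/ tmem s t'.
    by case/IH => [->|]; [left|right].
  case: t => [|m l r] /=; case: x IH' => IH'; case: y => //=; try by right.
  + by case/IH' => [->|//]; left.
  + by case/IH' => [->|//]; left.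
  + exact: IH'.
  + exact: IH'.
Qed.

Definition tset (L : seq window) : trie := foldr (fun C => tadd (flatten C)) TLeaf L.

Lemma tsetP C L : tmem (flatten C) (tset L) -> exists2 C', C' \in L & flatten C' = flatten C.
Proof.
elim: L => //= C' L IH /tmem_add [->|/IH [C2 h e]]; first by exists C'; rewrite ?mem_head.
by exists C2; rewrite // inE h orbT.
Qed.

(** An unverified depth-first search: [frame_check] certifies afterwards that the list it returns
    contains the starting windows and is closed under steps. *)
Fixpoint explore (fuel : nat) (todo : seq window) (t : trie) (L : seq window) : seq window :=
  if fuel is k.+1 then
    if todo is C :: todo' then
      if tmem (flatten C) t then explore k todo' t L
      else explore k ([seq slidew a C | a <- removals (head [::] C)] ++ todo')
                   (tadd (flatten C) t) (C :: L)
    else L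
  else L.

(** Labels below the window act only through the ideal at its head, which is allowed to lose any of
    its maximal elements at each step. This over-approximation makes the states finite in number and
    independent of c. An empty head means that all labels lie above the lower end of the window, and
    then [x] has to lie in the last ideal. *)
Definition frame_check (x w : nat) : bool :=
  let st := [seq C <- top_windows w | ~~ nth false (head [::] C) (trot x)] in
  let L := explore (2 ^ 14) st TLeaf [::] in
  let t := tset L in
  [&& all (fun C => shape C == nseq w.+1 n) L,
      all (fun C => tmem (flatten C) t) st,
      all (fun C => all (fun a => tmem (flatten (slidew a C)) t) (removals (head [::] C))) L &
      all (fun C => has id (head [::] C) || nth false (last [::] C) x) L].

(** * Soundness of the finite computation *)

Section Soundness.
Variables (c : nat) (b : int -> nat -> nat -> bool).
Hypothesis fb : field tS tnb c b.
Local Notation lab := (lab trk c b).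

Definition ideal (j k : int) : bitseq := mkseq (fun x => lab j x <= k) n.

Lemma nth_ideal j k x : tS x -> nth false (ideal j k) x = (lab j x <= k).
Proof. by move=> Sx; rewrite nth_mkseq. Qed.

Lemma lab_mono j x : tS x -> lab j x <= lab (j + 1) x.
Proof.
move=> Sx; have [h|h] := leP (lab j x) (j + 1).
  by apply: le_trans h _; apply: ltW; apply: lab_gt.
have [->//|[w [Sw wx <-]]] := lab_slide table_sg fb Sx h.
by apply/ltW/(lab_nb table_sg fb).
Qed.

(** A vacated element takes the value [k + 1] only from an upper neighbour. An element of top rank
    has none and receives the fresh value [j + 1 + (R + 1 + c)], which exceeds [k + 1]. *)
Lemma lab_moved j x (k : int) : tS x -> lab j x <= k -> k < lab (j + 1) x ->
  k < j + (R + 1 + c)%N%:Z ->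
  (lab (j + 1) x <= k + 1) = has (fun y => lab j y == k + 1) (nth [::] upt x).
Proof.
move=> Sx h1 h2 hk; have [xR|/(table_up Sx)[y0 Sy0 xy0]] := pselect (trk x = R).
  rewrite [RHS](_ : _ = false); last first.
    apply/hasPn => y xy; have [_ [/(sg_le table_sg) h e]] := tnb_dom xy.
    by move: h; rewrite e xR ltnn.
  apply/negbTE; rewrite -ltNge; move: (h2); rewrite !labE xR.
  suff -> : height c b (j + 1 + R%:Z) x = 0%N by lia.
  apply/eqP; rewrite -leqn0 leqNgt; apply/negP => Hp.
  set H := height c b (j + 1 + R%:Z) x in Hp.
  have Hc : (H.-1 < c)%N by have := height_le c b (j + 1 + R%:Z) x; rewrite -/H; lia.
  have noup y : tS y -> tnb x y -> False.
    move=> Sy xy; have [_ [/(sg_le table_sg) h e]] := tnb_dom xy.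
    by move: h; rewrite e xR ltnn.
  have : ~~ b (j + R%:Z) x H.-1.
    apply: (f_out fb) => //.
    - rewrite (_ : j + R%:Z + 1 = j + 1 + R%:Z); last by lia.
      by rewrite (heightP fb) // -/H; lia.
    - by move=> y Sy /(noup y Sy).
    - rewrite (_ : j + R%:Z + 1 = j + 1 + R%:Z); last by lia.
      by move=> h; rewrite (heightP fb) // -/H; lia.
  rewrite (heightP fb) // -leqNgt => h.
  by move: h1 h2; rewrite !labE xR -/H; lia.
apply/idP/hasP => [h|[y xy /eqP <-]]; last first.
  by have [_ [Sy _]] := tnb_dom xy; apply: (lab_next_nb table_sg fb).
have [e|[y [Sy xy e]]] := lab_fill table_sg fb j Sx Sy0 xy0.
  by move: h2; rewrite e ltNge h1.
by exists y; rewrite // -e eq_le h lezD1.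
Qed.

Lemma slide1E a b' d : size a = n -> size b' = n -> size d = n ->
  slide1 a b' d = mkseq (fun x => nth false d x && (nth false a x ||
     (if nth false b' x then has (fun y => nth false d y && ~~ nth false b' y) (nth [::] upt x)
      else ~~ has (fun w => nth false b' w && ~~ nth false a w) (nth [::] lowt x)))) n.
Proof.
move=> sa sb sd; case/and5P: ok => /andP[/eqP su /eqP sl] _ _ _ _.
have sz : size (zip (zip (zip a b') d) (zip upt lowt)) = n.
  by rewrite !size_zip sa sb sd su sl !minnn.
apply: (@eq_from_nth _ false); first by rewrite size_map sz size_mkseq.
move=> i; rewrite size_map sz => hi; rewrite nth_mkseq //.
rewrite (nth_map ((false, false, false), ([::], [::]))) ?sz //.
rewrite !nth_zip //; by rewrite ?size_zip ?sa ?sb ?sd ?su ?sl ?minnn.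
Qed.

(** One swap of K-jeu de taquin between vacated elements and the value [k + 1]: a vacated element
    takes it from an upper neighbour, and an element labelled [k + 1] loses it to a vacated lower
    neighbour. The bounds on k ensure that [k + 1] is neither the expelled value nor the fresh
    one. *)
Lemma slide1_ideal (j k : int) : j + 1 <= k -> k < j + (R + 1 + c)%N%:Z ->
  slide1 (ideal (j + 1) k) (ideal j k) (ideal j (k + 1)) = ideal (j + 1) (k + 1).
Proof.
move=> jk kq; rewrite slide1E ?size_mkseq //; apply/eq_in_map => x.
rewrite mem_iota /= => Sx; rewrite !nth_ideal //.
have up_in y : y \in nth [::] upt x -> tS y by move=> xy; have [_ []] := tnb_dom xy.
have low_in w : w \in nth [::] lowt x -> tS w by rewrite lowtE // => /tnb_dom[].
have mono := lab_mono j Sx.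
have [dx|dx] := leP (lab j x) (k + 1); last first.
  by apply/esym/negbTE; rewrite -ltNge; apply: lt_le_trans mono.
have [ax|ax] /= := leP (lab (j + 1) x) k; first by apply/esym/(le_trans ax); lia.
have [bx|bx] := leP (lab j x) k.
  rewrite lab_moved //; apply: eq_in_has => y /up_in Sy; rewrite !nth_ideal //; lia.
have lx : lab j x = k + 1 by lia.
apply/idP/idP => [/hasPn h|h].
  have [|->|[w [Sw wx hw]]] := lab_slide table_sg fb Sx (j := j); [lia|lia|].
  have wl : w \in nth [::] lowt x by rewrite lowtE.
  have := h w wl; rewrite !nth_ideal // hw lx.
  have := lab_nb table_sg fb j Sw Sx wx; lia.
apply/hasPn => w wl; have Sw := low_in _ wl; move: wl; rewrite lowtE // => wx.
rewrite !nth_ideal //; have := lab_nb table_sg fb (j + 1) Sw Sx wx.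
by have := lab_next_nb table_sg fb j Sw Sx wx; lia.
Qed.

Lemma mem_sublists (P : pred nat) l : [seq x <- l | P x] \in sublists l.
Proof.
elim: l => //= x l IH; rewrite mem_cat; case: (P x); last by rewrite IH.
by rewrite map_f ?orbT.
Qed.

Lemma mem_removals (f g : pred nat) : (forall x, tS x -> g x -> f x) ->
  (forall x y, tS x -> tnb x y -> f y -> f x -> g x) ->
  mkseq g n \in removals (mkseq f n).
Proof.
move=> gf fg; apply/mapP.
exists [seq x <- maximals (mkseq f n) | ~~ g x]; first exact: mem_sublists.
rewrite {1}/mkseq; apply: (@eq_from_nth _ false).
  by rewrite !size_map size_zip size_mkseq size_iota minnn.
move=> x; rewrite size_map size_iota => Sx.
rewrite (nth_map 0%N) ?size_iota // nth_iota // add0n.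
rewrite (nth_map (false, 0%N)) ?size_zip ?size_mkseq ?size_iota ?minnn //.
rewrite nth_zip ?size_mkseq ?size_iota //= nth_iota // add0n.
rewrite nth_mkseq // !mem_filter mem_iota /= nth_mkseq //.
have -> : (x < n)%N by [].
rewrite andbT; case gx: (g x) => /=; first by rewrite (gf x).
case fx: (f x) => //=; rewrite negbK; apply/esym/hasP => -[y xy].
have [_ [Sy _]] := tnb_dom xy.
by rewrite nth_mkseq // => fy; move: gx; rewrite (fg x y).
Qed.

Definition labwin (j p : int) (w : nat) : window :=
  ideal j p :: [seq ideal j (p + i.+1%:Z) | i <- iota 0 w].

Lemma labwinS j p w : labwin j p w.+1 = ideal j p :: labwin j (p + 1) w.
Proof.
rewrite /labwin /=; congr (_ :: _ :: _); rewrite (iotaDl 1 0) -map_comp.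
by apply: eq_map => i /=; congr (ideal _ _); lia.
Qed.

Lemma shape_labwin j p w : shape (labwin j p w) = nseq w.+1 n.
Proof.
rewrite /shape /labwin /= size_mkseq; congr (_ :: _); rewrite -[in RHS](size_iota 0 w).
by elim: (iota 0 w) => //= i l ->; rewrite size_mkseq.
Qed.

Lemma ideal_down j (k : int) : ideal j k \in removals (ideal j (k + 1)).
Proof.
apply: mem_removals => [x Sx h|x y Sx xy hy hx]; first by apply: (le_trans h); lia.
have [_ [Sy _]] := tnb_dom xy.
by have := lab_nb table_sg fb j Sx Sy xy; lia.
Qed.

Lemma ideal_next j (k : int) : ideal (j + 1) k \in removals (ideal j k).
Proof.
apply: mem_removals => [x Sx|x y Sx xy hy hx]; first exact: le_trans (lab_mono j Sx).
have [_ [Sy _]] := tnb_dom xy; exact: le_trans (lab_next_nb table_sg fb j Sx Sy xy) hy.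
Qed.

Lemma labwin_top j w :
  labwin j (j + (R + 1 + c)%N%:Z - w%:Z) w \in top_windows w.
Proof.
elim: w => [|w IH].
  rewrite /= inE; apply/eqP; congr (_ :: _).
  apply: (@eq_from_nth _ false); first by rewrite size_mkseq size_nseq.
  move=> i; rewrite size_mkseq => hi; rewrite nth_ideal // nth_nseq hi.
  by rewrite subr0 (lab_max c table_sg).
set p := _ - w.+1%:Z; have pw : p + 1 = j + (R + 1 + c)%N%:Z - w%:Z by rewrite /p; lia.
rewrite labwinS; apply/flattenP.
exists [seq a :: labwin j (p + 1) w | a <- removals (head [::] (labwin j (p + 1) w))].
  by apply/mapP; exists (labwin j (p + 1) w); rewrite // pw.
by apply/mapP; exists (ideal j p); first exact: ideal_down.
Qed.

Lemma slide_labwin j p w : j + 1 <= p -> p + w%:Z <= j + (R + 1 + c)%N%:Z ->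
  slidew (ideal (j + 1) p) (labwin j p w) = labwin (j + 1) p w.
Proof.
elim: w p => [//|w IH] p jp pq; rewrite !labwinS /= slide1_ideal //; last by lia.
by congr (_ :: _); rewrite -IH //; lia.
Qed.

(** The window of the values from p + 1 to p + w stays fixed while time runs from [j] to p =
    [j + (R + 1 + c - w)]. It starts as the top part of the labels, and at time p all labels exceed
    p, so that its head has become empty. *)
Lemma frame_check_sound x w : (0 < w)%N -> (w <= R + 1 + c)%N -> tS x -> frame_check x w ->
  forall j : int, j + (R + 1 + c - w)%N%:Z < lab j (trot x) ->
  lab (j + (R + 1 + c - w)%N%:Z) x <= j + (R + 1 + c)%N%:Z.
Proof.
move=> w0 wq Sx; rewrite /frame_check.
set st := [seq C <- _ | _]; set L := explore _ _ _ _ => /and4P[shL stL clL endL] j hj.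
set K := (R + 1 + c - w)%N in hj *; set p := j + K%:Z in hj *.
have Srx := sg_rot table_sg Sx.
(* The trie only knows concatenations; the common shape recovers the window. *)
have memL j' : tmem (flatten (labwin j' p w)) (tset L) -> labwin j' p w \in L.
  case/tsetP => C CL e; suff <- : C = labwin j' p w by [].
  by apply: eq_from_flatten_shape; rewrite // shape_labwin; apply/eqP/(allP shL).
have inL (i : nat) : (i <= K)%N -> labwin (j + i%:Z) p w \in L.
  elim: i => [|i IH] hi.
    rewrite addr0; apply: memL; apply: (allP stL); rewrite mem_filter /=.
    rewrite nth_ideal // -ltNge hj /=.
    by rewrite (_ : p = j + (R + 1 + c)%N%:Z - w%:Z) ?labwin_top // /p /K; lia.
  have := IH ltac:(lia); set j' := j + i%:Z => inL.
  have -> : j + i.+1%:Z = j' + 1 by rewrite /j'; lia.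
  have := allP clL _ inL => /allP/(_ _ (ideal_next j' p)); rewrite slide_labwin.
  - exact: memL.
  - by rewrite /j' /p; lia.
  - by rewrite /j' /p /K; lia.
have := inL K (leqnn K); rewrite -/p => /(allP endL).
have -> : has id (head [::] (labwin p p w)) = false.
  apply/negbTE/hasPn => y /mapP[i]; rewrite mem_iota => hi ->.
  by rewrite -ltNge lab_gt.
rewrite /= -(prednK w0) -addn1 iotaD map_cat last_cat /= add0n.
rewrite nth_ideal //; congr (_ <= _); rewrite /p /K; lia.
Qed.

End Soundness.
End Tables.

Section TableFields.
Variables (n : nat) (upt lowt : seq (seq nat)) (rkt rott : seq nat) (R : nat).
Hypothesis ok : table_ok n upt lowt rkt rott R.
Local Notation S := (tS n).
Local Notation nb := (tnb upt).
Let sg := table_sg ok.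
Variables (c N : nat) (b : int -> nat -> nat -> bool).
Hypotheses (c0 : (0 < c)%N) (N0 : (0 < N)%N) (fb : field S nb c b) (pb : periodic N b).
Hypothesis co : coprime N (R + 1 + c).

Definition never x := forall t, ~~ b t x c.-1.

Lemma frame_dichotomy x : S x -> frame_check n upt lowt rott x (trk rkt x).+1 ->
  full c b x \/ never x.
Proof.
move=> Sx fx; have rx := sg_le sg Sx; have cc : (c.-1 < c)%N by lia.
have fr : frame_at S nb (trk rkt) (trot rott) R c x (R + 1 + c.-1 - trk rkt x).
  (* At height [c - 1] the prescribed number of steps leaves a window of [rk x + 1] values. *)
  move=> b' fb' j; have -> : (R + 1 + c.-1 - trk rkt x = R + 1 + c - (trk rkt x).+1)%N by lia.
  by apply: (frame_check_sound ok fb') => //; lia.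
have cst := bits_const sg Sx cc fr fb N0 pb co.
by case e: (b 0 x c.-1); [left|right] => t; rewrite (cst t 0) e.
Qed.

Lemma full_min x : S x -> trk rkt x = 0%N -> (forall y, S y -> trk rkt y = 0%N -> y = x) ->
  full c b x.
Proof.
move=> Sx rx ux; apply: (const_full c0 fb) => // [z t t' zc|w Sw wx].
  by apply: (bits_const sg Sx zc _ fb N0 pb co); apply: (frame_min sg).
by have := sg_rk sg wx; rewrite rx.
Qed.

Lemma full_ups x : S x -> full c b x -> forall t, has (fun y => b t y c.-1) (nth [::] upt x).
Proof.
by move=> Sx fx t; have [y [Sy xy h]] := full_up c0 fb t Sx fx; apply/hasP; exists y.
Qed.

Lemma never_up x y : nb x y -> never x -> never y.
Proof.
move=> xy nx t; have [Sx [Sy _]] := tnb_dom ok xy.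
by apply: contra (nx t); apply: (f_down fb) => //; rewrite ltn_predL.
Qed.

End TableFields.

(** * The Cayley-Moufang and Freudenthal posets, numbered along a linear extension *)

Definition e6_up : seq (seq nat) :=
  [:: [:: 1]; [:: 2]; [:: 3; 4]; [:: 5]; [:: 5; 6]; [:: 7; 8]; [:: 8]; [:: 9; 10]; [:: 10]; [:: 11]; [:: 11; 12]; [:: 13]; [:: 13]; [:: 14]; [:: 15]; [::]].
Definition e6_low : seq (seq nat) :=
  [:: [::]; [:: 0]; [:: 1]; [:: 2]; [:: 2]; [:: 3; 4]; [:: 4]; [:: 5]; [:: 5; 6]; [:: 7]; [:: 7; 8]; [:: 9; 10]; [:: 10]; [:: 11; 12]; [:: 13]; [:: 14]].
Definition e6_rk : seq nat := [:: 0; 1; 2; 3; 3; 4; 4; 5; 5; 6; 6; 7; 7; 8; 9; 10].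
Definition e6_rot : seq nat := [:: 15; 14; 13; 12; 11; 10; 9; 8; 7; 6; 5; 4; 3; 2; 1; 0].

Definition e7_up : seq (seq nat) :=
  [:: [:: 1]; [:: 2]; [:: 3]; [:: 4; 5]; [:: 6]; [:: 6; 7]; [:: 8; 9]; [:: 8]; [:: 10]; [:: 10; 11]; [:: 12; 13]; [:: 13; 14]; [:: 15]; [:: 15; 16]; [:: 16]; [:: 17; 18]; [:: 18]; [:: 19; 20]; [:: 20]; [:: 22]; [:: 21; 22]; [:: 23]; [:: 23]; [:: 24]; [:: 25]; [:: 26]; [::]].
Definition e7_low : seq (seq nat) :=
  [:: [::]; [:: 0]; [:: 1]; [:: 2]; [:: 3]; [:: 3]; [:: 4; 5]; [:: 5]; [:: 6; 7]; [:: 6]; [:: 8; 9]; [:: 9]; [:: 10]; [:: 10; 11]; [:: 11]; [:: 12; 13]; [:: 13; 14]; [:: 15]; [:: 15; 16]; [:: 17]; [:: 17; 18]; [:: 20]; [:: 19; 20]; [:: 21; 22]; [:: 23]; [:: 24]; [:: 25]].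
Definition e7_rk : seq nat := [:: 0; 1; 2; 3; 4; 4; 5; 5; 6; 6; 7; 7; 8; 8; 8; 9; 9; 10; 10; 11; 11; 12; 12; 13; 14; 15; 16].
Definition e7_rot : seq nat := [:: 26; 25; 24; 23; 21; 22; 20; 19; 17; 18; 15; 16; 12; 13; 14; 10; 11; 8; 9; 7; 6; 4; 5; 3; 2; 1; 0].

Lemma e6_ok : table_ok 16 e6_up e6_low e6_rk e6_rot 10.
Proof. by vm_compute. Qed.

Lemma e6_frame4 : frame_check 16 e6_up e6_low e6_rot 4 4.
Proof. by vm_compute. Qed.

Lemma e6_frame6 : frame_check 16 e6_up e6_low e6_rot 6 5.
Proof. by vm_compute. Qed.

Lemma e7_ok : table_ok 27 e7_up e7_low e7_rk e7_rot 16.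
Proof. by vm_compute. Qed.

Lemma e7_frame4 : frame_check 27 e7_up e7_low e7_rot 4 5.
Proof. by vm_compute. Qed.

Lemma e7_frame7 : frame_check 27 e7_up e7_low e7_rot 7 6.
Proof. by vm_compute. Qed.

(** If 6 is full, fullness climbs through 8 to 10. If its top cell never occurs, neither does that
    of anything above it; then each alternative for 4 produces a full element (9 or 3) whose only
    upper neighbour never has its top cell. *)
Lemma e6_full10 c b N : (0 < c)%N -> (0 < N)%N -> field (tS 16) (tnb e6_up) c b ->
  periodic N b -> coprime N (10 + 1 + c) -> full c b 10%N.
Proof.
move=> c0 N0 fb pb co.
have up := full_ups c0 fb.
have nu := never_up e6_ok c0 fb.
have f0 : full c b 0%N.
  apply: (full_min e6_ok c0 N0 fb pb co) => //.
  by move=> y Sy; do 16 (case: y Sy => [//|y Sy]).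
have f1 : full c b 1%N by move=> t; have := up 0%N isT f0 t; rewrite /= orbF.
have f2 : full c b 2%N by move=> t; have := up 1%N isT f1 t; rewrite /= orbF.
have [f6|n6] := frame_dichotomy e6_ok c0 N0 fb pb co (x := 6) isT e6_frame6.
  have f8 : full c b 8%N by move=> t; have := up 6%N isT f6 t; rewrite /= orbF.
  by move=> t; have := up 8%N isT f8 t; rewrite /= orbF.
have n8 := nu 6%N 8%N isT n6; have n10 := nu 8%N 10%N isT n8.
have n11 := nu 10%N 11%N isT n10.
have [f4|n4] := frame_dichotomy e6_ok c0 N0 fb pb co (x := 4) isT e6_frame4.
  have f5 : full c b 5%N.
    by move=> t; have := up 4%N isT f4 t; rewrite /= (negbTE (n6 t)) !orbF.
  have f7 : full c b 7%N.
    by move=> t; have := up 5%N isT f5 t; rewrite /= (negbTE (n8 t)) !orbF.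
  have f9 : full c b 9%N.
    by move=> t; have := up 7%N isT f7 t; rewrite /= (negbTE (n10 t)) !orbF.
  by have := up 9%N isT f9 0; rewrite /= (negbTE (n11 0)).
have n5 := nu 4%N 5%N isT n4.
have f3 : full c b 3%N.
  by move=> t; have := up 2%N isT f2 t; rewrite /= (negbTE (n4 t)) !orbF.
by have := up 3%N isT f3 0; rewrite /= (negbTE (n5 0)).
Qed.

(** The dual of 10 is 5, which lies below 10: it would be empty by duality and occupied because 10
    is. *)
Lemma e6_NRP : field_NRP (tS 16) (tnb e6_up) 10.
Proof.
move=> c b N c0 N0 fb pb; apply/negP => co; have sg := table_sg e6_ok.
have f10 := e6_full10 c0 N0 fb pb co.
have d10 := e6_full10 c0 N0 (field_dual sg fb) (periodic_dual _ _ pb) co.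
have cc : (c.-1 < c)%N by lia.
have b8 : b 0 8%N c.-1 by apply: (f_down fb (y := 10%N)) => //; apply: f10.
have b5 : b 0 5%N c.-1 by apply: (f_down fb (y := 8%N)).
have := d10 0; rewrite /dual_field /= oppr0 prednK // subnn.
by rewrite (full_col c0 fb _ b5).
Qed.

(** As for [e6_full10], with 7 in place of 6; the full elements that get stuck are 14 and 5. *)
Lemma e7_full10 c b N : (0 < c)%N -> (0 < N)%N -> field (tS 27) (tnb e7_up) c b ->
  periodic N b -> coprime N (16 + 1 + c) -> full c b 10%N.
Proof.
move=> c0 N0 fb pb co.
have up := full_ups c0 fb.
have nu := never_up e7_ok c0 fb.
have f0 : full c b 0%N.
  apply: (full_min e7_ok c0 N0 fb pb co) => //.
  by move=> y Sy; do 27 (case: y Sy => [//|y Sy]).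
have f1 : full c b 1%N by move=> t; have := up 0%N isT f0 t; rewrite /= orbF.
have f2 : full c b 2%N by move=> t; have := up 1%N isT f1 t; rewrite /= orbF.
have f3 : full c b 3%N by move=> t; have := up 2%N isT f2 t; rewrite /= orbF.
have [f7|n7] := frame_dichotomy e7_ok c0 N0 fb pb co (x := 7) isT e7_frame7.
  have f8 : full c b 8%N by move=> t; have := up 7%N isT f7 t; rewrite /= orbF.
  by move=> t; have := up 8%N isT f8 t; rewrite /= orbF.
have n8 := nu 7%N 8%N isT n7; have n10 := nu 8%N 10%N isT n8.
have n13 := nu 10%N 13%N isT n10; have n16 := nu 13%N 16%N isT n13.
have [f4|n4] := frame_dichotomy e7_ok c0 N0 fb pb co (x := 4) isT e7_frame4.
  have f6 : full c b 6%N by move=> t; have := up 4%N isT f4 t; rewrite /= orbF.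
  have f9 : full c b 9%N.
    by move=> t; have := up 6%N isT f6 t; rewrite /= (negbTE (n8 t)) !orbF.
  have f11 : full c b 11%N.
    by move=> t; have := up 9%N isT f9 t; rewrite /= (negbTE (n10 t)) !orbF.
  have f14 : full c b 14%N.
    by move=> t; have := up 11%N isT f11 t; rewrite /= (negbTE (n13 t)) !orbF.
  by have := up 14%N isT f14 0; rewrite /= (negbTE (n16 0)).
have n6 := nu 4%N 6%N isT n4.
have f5 : full c b 5%N.
  by move=> t; have := up 3%N isT f3 t; rewrite /= (negbTE (n4 t)) !orbF.
by have := up 5%N isT f5 0; rewrite /= (negbTE (n6 0)) (negbTE (n7 0)).
Qed.

(** Here the dual 15 of 10 lies above it, and 10, 12, 13, 15 form a diamond in which 12 has no
    further neighbours. For c = 1 the modulus is 18. *)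
Lemma e7_NRP : field_NRP (tS 27) (tnb e7_up) 16.
Proof.
move=> c b N c0 N0 fb pb; apply/negP => co; have sg := table_sg e7_ok.
have f10 := e7_full10 c0 N0 fb pb co.
have d10 := e7_full10 c0 N0 (field_dual sg fb) (periodic_dual _ _ pb) co.
have e15 : empty b 15%N.
  by move=> t; have := d10 (- t); rewrite /dual_field /= opprK prednK // subnn.
have [] := diamond_alternates c0 fb (u := 10%N) (v := 15%N) (x := 12%N) (y := 13%N) => //.
- by move=> w _; rewrite -(lowtE e7_ok) //= inE => /eqP.
- by move=> w _; rewrite /tnb /= inE => /eqP.
- by move=> w _; rewrite /tnb /= !inE => /orP[] /eqP; [left|right].
- by move=> w _; rewrite -(lowtE e7_ok) //= !inE => /orP[] /eqP; [left|right].
move=> c1 alt; have := periodic_alt_even alt pb => oddN.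
have : (2 %| gcdn N (16 + 1 + c))%N by rewrite dvdn_gcd !dvdn2 oddN c1.
by move: co; rewrite /coprime => /eqP ->.
Qed.

(** * From fields to rowmotion orbits *)

Section Rowmotion.
Context {d : Order.disp_t} {Q : finPOrderType d}.
Implicit Types (x y : Q) (A : {set Q}).

Lemma idealP A x y : is_ideal A -> x \in A -> (y <= x)%O -> y \in A.
Proof. by move=> /forall_inP h /h /forallP/(_ y)/implyP. Qed.

Lemma row_below A x y : (x < y)%O -> y \in row_ideal A -> x \in A.
Proof.
move=> xy; rewrite inE => /exists_inP[m]; rewrite inE => /andP[_ /forall_inP h] ym.
by apply: contraT => xA; have := h x; rewrite inE xA (lt_le_trans xy ym) => /(_ isT).
Qed.

Lemma row_enter A x : x \notin A -> (forall y, (y < x)%O -> y \in A) -> x \in row_ideal A.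
Proof.
move=> xA h; rewrite inE; apply/exists_inP; exists x; last exact: lexx.
rewrite inE inE xA /=; apply/forall_inP => y; rewrite inE => yA.
by apply: contra yA => /h.
Qed.

Lemma row_leave A x : x \in row_ideal A -> (forall y, (x < y)%O -> y \notin row_ideal A) ->
  x \notin A.
Proof.
rewrite inE => /exists_inP[m mm xm] h.
have [->|nxm] := eqVneq x m; first by move: mm; rewrite inE inE => /andP[].
have := h m; rewrite lt_neqAle nxm xm => /(_ isT); rewrite inE => /negP[].
by apply/exists_inP; exists m.
Qed.

End Rowmotion.

Section Transfer.
Context {d : Order.disp_t} {P : finPOrderType d}.
Variables (T : Type) (S : pred T) (nb : rel T) (rk : T -> nat) (R : nat) (phi : P -> T).
Hypotheses (phiS : forall p, S (phi p)) (phi_inj : injective phi)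
  (phi_surj : forall x, S x -> exists p, phi p = x).
Hypothesis phi_lt : forall p q, nb (phi p) (phi q) -> (p < q)%O.
Hypothesis phi_low : forall p q, (p < q)%O -> exists2 r, nb (phi r) (phi q) & (p <= r)%O.
Hypothesis phi_up : forall p q, (p < q)%O -> exists2 r, nb (phi p) (phi r) & (r <= q)%O.
Hypotheses (nb_rk : forall x y, nb x y -> rk y = (rk x).+1)
  (rk_le : forall x, S x -> (rk x <= R)%N)
  (rk_low : forall x, S x -> (0 < rk x)%N -> exists2 w, S w & nb w x)
  (rk_top : exists2 x, S x & rk x = R).

Lemma phi_rk p q : (p < q)%O -> (rk (phi p) < rk (phi q))%N.
Proof.
have [k] := ubnP (rk (phi q)); elim: k q => // k IH q qk pq.
have [r rq pr] := phi_low pq; have e := nb_rk rq; rewrite e ltnS.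
have [->//|npr] := eqVneq p r; apply/ltnW/IH; first by rewrite -ltnS -e.
by rewrite lt_neqAle npr.
Qed.

Lemma rank_transfer : poset_rank (Q := P) = R.
Proof.
rewrite /poset_rank; suff -> : \max_(A : {set P} | is_chain A) #|A| = R.+1 by [].
apply/eqP; rewrite eqn_leq; apply/andP; split.
  apply/bigmax_leqP => A /forall_inP cA.
  have lt p : (rk (phi p) < R.+1)%N by rewrite ltnS rk_le.
  pose f p : 'I_R.+1 := Ordinal (lt p).
  rewrite -[leqRHS]card_ord -(@card_in_imset _ _ f) ?max_card // => p q pA qA /(congr1 val) /= e.
  have /forall_inP/(_ q qA)/orP[] := cA p pA; rewrite le_eqVlt.
  - by case/orP=> [/eqP//|/phi_rk]; rewrite e ltnn.
  - by case/orP=> [/eqP//|/phi_rk]; rewrite e ltnn.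
have [x0 Sx0 rx0] := rk_top; have [p0 e0] := phi_surj Sx0.
have chain k : forall p, rk (phi p) = k -> exists A : {set P},
    [/\ is_chain A, #|A| = k.+1 & forall q, q \in A -> (q <= p)%O].
  elim: k => [|k IH] p pk.
    exists [set p]; rewrite cards1; split => //.
      by apply/forall_inP => x /set1P->; apply/forall_inP => y /set1P->; rewrite comparablexx.
    by move=> q /set1P->.
  have [|w Sw wp] := rk_low (phiS p); first by rewrite pk.
  have [r er] := phi_surj Sw; rewrite -er in wp.
  have [|A [cA sA hA]] := IH r; first by have := nb_rk wp; rewrite pk => -[].
  have rp := phi_lt wp.
  have pA : p \notin A by apply/negP => /hA /(lt_le_trans rp); rewrite ltxx.
  have hA' q : q \in p |: A -> (q <= p)%O.
    by case/setU1P => [->//|/hA qr]; apply: le_trans qr (ltW rp).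
  exists (p |: A); split => //; last by rewrite cardsU1 pA sA.
  apply/forall_inP => x xA; apply/forall_inP => y yA; rewrite /Order.comparable.
  case/setU1P: (xA) => [->|xA']; first by rewrite (hA' y yA) orbT.
  case/setU1P: (yA) => [->|yA']; first by rewrite (hA' x xA).
  by move/forall_inP: cA => /(_ x xA')/forall_inP/(_ y yA').
have [|A [cA <- _]] := chain R p0; first by rewrite e0.
exact: (leq_bigmax_cond A cA).
Qed.

Section Orbit.
Variables (c : nat) (I0 : J (P *p 'I_c)).
Let psi := rowmotion (P *p 'I_c).
Let N := #|porbit psi I0|.

(** Reducing time modulo the orbit length extends the forward orbit to all integers. *)
Let state (t : int) : {set P *p 'I_c} := val (iter `|(t %% N%:Z)%Z|%N psi I0).

Let N0 : (0 < N)%N.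
Proof. by apply/card_gt0P; exists I0; apply: porbit_id. Qed.

Let stateN t : state (t + N%:Z) = state t.
Proof. by rewrite /state modzDr. Qed.

Let stateS t : state (t + 1) = row_ideal (state t).
Proof.
rewrite /state -modzDml; set k := (t %% N%:Z)%Z.
have k0 : 0 <= k by apply: modz_ge0; rewrite -lt0n.
have kN : k < N%:Z by have := @ltz_pmod t N%:Z; apply; rewrite ltz_nat.
have -> : row_ideal (val (iter `|k| psi I0)) = val (iter `|k|.+1 psi I0).
  by rewrite iterS permE.
have [e|ne] := eqVneq `|k|%N.+1 N.
  have -> : k + 1 = N%:Z by lia.
  by rewrite modzz e /= iter_porbit.
by rewrite modz_small; [congr (val (iter _ psi I0)); lia|lia].
Qed.

Let state_ideal t : is_ideal (state t).
Proof. exact: valP. Qed.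

(** The existential makes the field total: it is false off the image of [phi] and at heights from c
    on. *)
Definition orbit_field (t : int) (x : T) (z : nat) : bool :=
  `[< exists p (i : 'I_c), [/\ phi p = x, val i = z & (p, i) \in state t] >].

Let orbit_fieldE t p (i : 'I_c) : orbit_field t (phi p) (val i) = ((p, i) \in state t).
Proof.
apply/asboolP/idP => [[q [j [/phi_inj-> /val_inj->]]]//|h]; by exists p, i.
Qed.

Let Ord z (zc : (z < c)%N) : exists i : 'I_c, val i = z.
Proof. by exists (Ordinal zc). Qed.

Let lt_nb p q (i : 'I_c) : nb (phi p) (phi q) ->
  (((p, i) : P *p 'I_c) < ((q, i) : P *p 'I_c))%O.
Proof.
move=> /phi_lt pq; rewrite ltEprod /= lexx (ltW pq) !andbT.
by apply: contraTneq pq => -[->]; rewrite ltxx.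
Qed.

Let lt_succ p (i j : 'I_c) : (val i < val j)%N -> (((p, i) : P *p 'I_c) < ((p, j) : P *p 'I_c))%O.
Proof.
move=> ij; rewrite ltEprod /= lexx leEord (ltnW ij) !andbT.
by apply: contraTneq ij => -[->]; rewrite ltnn.
Qed.

Lemma orbit_field_field : field S nb c orbit_field.
Proof.
split.
- move=> t x y z /phi_surj[p <-] /phi_surj[q <-] pq /Ord[i <-].
  by rewrite !orbit_fieldE => h; apply: (idealP (state_ideal t) h); apply/ltW/lt_nb.
- move=> t x z /phi_surj[p <-] zc; have [i ei] := Ord zc; have [j ej] := Ord (ltnW zc).
  rewrite -ei -ej !orbit_fieldE => h; apply: (idealP (state_ideal t) h).
  by apply/ltW/lt_succ; rewrite ei ej.
- move=> t x y z /phi_surj[p <-] /phi_surj[q <-] pq /Ord[i <-].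
  by rewrite !orbit_fieldE stateS; apply: row_below; apply: lt_nb.
- move=> t x z /phi_surj[p <-] zc; have [i ei] := Ord zc; have [j ej] := Ord (ltnW zc).
  rewrite -ei -ej !orbit_fieldE stateS; apply: row_below.
  by apply/lt_succ; rewrite ei ej.
- move=> t x z /phi_surj[p <-] zc; have [i ei] := Ord zc; rewrite -{1 5}ei !orbit_fieldE.
  move=> nh hw hz; rewrite stateS; apply: row_enter => // -[q j].
  rewrite ltEprod /= => /andP[nqp /andP[qp ji]].
  have [eqp|nqp'] := eqVneq q p.
    have jlt : (val j < z)%N.
      rewrite -ei ltn_neqAle; move: ji; rewrite leEord => ->; rewrite andbT.
      by apply: contra nqp => /eqP/val_inj ->; rewrite eqp.
    have z0 : (0 < z)%N by apply: leq_ltn_trans jlt.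
    have zc' : (z.-1 < c)%N by apply: leq_ltn_trans zc; apply: leq_pred.
    have [i' ei'] := Ord zc'; have := hz z0; rewrite -ei' orbit_fieldE => h.
    apply: (idealP (state_ideal t) h); rewrite leEprod /= eqp lexx leEord ei' /=.
    by rewrite -ltnS prednK.
  have [|r rp qr] := @phi_low q p; first by rewrite lt_neqAle nqp'.
  have := hw (phi r) (phiS r) rp; rewrite -ei orbit_fieldE => h.
  by apply: (idealP (state_ideal t) h); rewrite leEprod /= qr.
- move=> t x z /phi_surj[p <-] zc; have [i ei] := Ord zc; rewrite -{1 5}ei !orbit_fieldE.
  move=> h hy hz; move: (h); rewrite stateS => /row_leave; apply => -[q j].
  rewrite ltEprod /= -stateS => /andP[npq /andP[pq ij]].
  have [eqp|npq'] := eqVneq p q.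
    have ilt : (z < val j)%N.
      rewrite -ei ltn_neqAle; move: ij; rewrite leEord => ->; rewrite andbT.
      by apply: contra npq => /eqP/val_inj ->; rewrite eqp.
    have zc' : (z.+1 < c)%N by apply: leq_ltn_trans (ltn_ord j).
    have [i' ei'] := Ord zc'; have := hz zc'; rewrite -ei' orbit_fieldE; apply: contra => h'.
    by apply: (idealP (state_ideal _) h'); rewrite leEprod /= eqp lexx leEord ei'.
  have [|r pr rq] := @phi_up p q; first by rewrite lt_neqAle npq'.
  have := hy (phi r) (phiS r) pr; rewrite -ei orbit_fieldE; apply: contra => h'.
  by apply: (idealP (state_ideal _) h'); rewrite leEprod /= rq.
Qed.

Lemma orbit_field_periodic : periodic N orbit_field.
Proof. by move=> t x z; rewrite /orbit_field stateN. Qed.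

Lemma orbit_NRP : (0 < c)%N -> field_NRP S nb R -> ~~ coprime N (R + c + 1).
Proof.
move=> c0 h; rewrite addnAC.
exact: (h c orbit_field N c0 N0 orbit_field_field orbit_field_periodic).
Qed.

End Orbit.

Lemma NRP_transfer : field_NRP S nb R -> NRP_rowmotion P.
Proof.
by move=> h c c0 O /imsetP[I0 _ ->]; rewrite rank_transfer; apply: orbit_NRP.
Qed.

End Transfer.

(** * Roots and coroots *)

Section RootDatum.
Variable R : root_datum.
Local Notation I := (rd_index R).
Local Notation rt := (@rd_root R).
Local Notation co := (@rd_coroot R).
Local Notation pr := (@rd_pairing R).
Implicit Types (a b : I) (x : 'rV[int]_(rd_dim R)) (u v : 'cV[int]_(rd_dim R)).

Definition dp x u : int := (x *m u) ord0 ord0.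

Lemma dpDl x y u : dp (x + y) u = dp x u + dp y u.
Proof. by rewrite /dp mulmxDl mxE. Qed.
Lemma dpDr x u v : dp x (u + v) = dp x u + dp x v.
Proof. by rewrite /dp mulmxDr mxE. Qed.
Lemma dpNl x u : dp (- x) u = - dp x u.
Proof. by rewrite /dp mulNmx mxE. Qed.
Lemma dpNr x u : dp x (- u) = - dp x u.
Proof. by rewrite /dp mulmxN mxE. Qed.
Lemma dpZl k x u : dp (k *: x) u = k * dp x u.
Proof. by rewrite /dp -scalemxAl mxE. Qed.
Lemma dpZr k x u : dp x (k *: u) = k * dp x u.
Proof. by rewrite /dp -scalemxAr mxE. Qed.
Lemma dp_suml (J : finType) (P : pred J) F u :
  dp (\sum_(i | P i) F i) u = \sum_(i | P i) dp (F i) u.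
Proof. by rewrite /dp mulmx_suml summxE. Qed.
Lemma dp_sumr (J : finType) (P : pred J) x F :
  dp x (\sum_(i | P i) F i) = \sum_(i | P i) dp x (F i).
Proof. by rewrite /dp mulmx_sumr summxE. Qed.

Lemma prE a b : pr a b = dp (rt a) (co b).
Proof. by []. Qed.

Definition sref a b : I := sval (cid (root_refl a b)).

Lemma rt_sref a b : rt (sref a b) = rt b - pr b a *: rt a.
Proof. exact: (svalP (cid (root_refl a b))). Qed.

Lemma pr_srefl a b c : pr (sref a b) c = pr b c - pr b a * pr a c.
Proof. by rewrite prE rt_sref dpDl dpNl dpZl. Qed.

Lemma srefK a : involutive (sref a).
Proof.
move=> b; apply: root_inj; rewrite rt_sref rt_sref pr_srefl pairing_diag.
by rewrite mulr_natr mulr2n opprD addNKr scaleNr opprK subrK.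
Qed.

Lemma rt_opp a : rt (sref a a) = - rt a.
Proof. by rewrite rt_sref pairing_diag scaler_nat mulr2n opprD addNKr. Qed.

Definition cos a u := u - dp (rt a) u *: co a.

Lemma dp_cos a b u : dp (rt b) (cos a u) = dp (rt (sref a b)) u.
Proof. by rewrite /cos dpDr dpNr dpZr rt_sref dpDl dpNl dpZl -prE mulrC. Qed.

Lemma cos_co a : cos a (co a) = - co a.
Proof. by rewrite /cos -prE pairing_diag scaler_nat mulr2n opprD addNKr. Qed.

Lemma cosK a : involutive (cos a).
Proof. by move=> u; rewrite {1}/cos dp_cos rt_opp dpNl scaleNr opprK subrK. Qed.

(* The canonical Weyl-invariant form on the cocharacter lattice. *)
Definition Fm u v : int := \sum_a dp (rt a) u * dp (rt a) v.

Lemma FmC u v : Fm u v = Fm v u.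
Proof. by apply: eq_bigr => a _; rewrite mulrC. Qed.
Lemma FmDr u v w : Fm u (v + w) = Fm u v + Fm u w.
Proof. by rewrite /Fm -big_split; apply: eq_bigr => a _; rewrite dpDr mulrDr. Qed.
Lemma FmZr k u v : Fm u (k *: v) = k * Fm u v.
Proof. by rewrite /Fm mulr_sumr; apply: eq_bigr => a _; rewrite dpZr mulrCA. Qed.
Lemma FmNr u v : Fm u (- v) = - Fm u v.
Proof. by rewrite -scaleN1r FmZr mulN1r. Qed.
Lemma Fm_sumr (J : finType) (P : pred J) u F :
  Fm u (\sum_(i | P i) F i) = \sum_(i | P i) Fm u (F i).
Proof.
rewrite /Fm exchange_big; apply: eq_bigr => a _.
by rewrite dp_sumr mulr_sumr.
Qed.

Lemma Fm_cos a u v : Fm (cos a u) (cos a v) = Fm u v.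
Proof.
rewrite [RHS](reindex_inj (inv_inj (srefK a))) /=.
by apply: eq_bigr => b _; rewrite !dp_cos.
Qed.

Definition Nm a : int := Fm (co a) (co a).

(** Invariance of the form under the reflection in [a], which negates [co a]. *)
Lemma Fm_co a u : 2 * Fm (co a) u = dp (rt a) u * Nm a.
Proof.
have := Fm_cos a (co a) u; rewrite cos_co FmC FmNr FmC {1}/cos FmDr FmNr FmZr -/(Nm a).
set F := Fm _ _; set D := _ * _ => e; have -> : 2 * F = F + F by ring.
by rewrite -{1}e; ring.
Qed.

Lemma Fm_ge0 u : 0 <= Fm u u.
Proof. by apply: sumr_ge0 => a _; rewrite -expr2 sqr_ge0. Qed.

Lemma Fm_eq0 u : Fm u u <= 0 -> forall a, dp (rt a) u = 0.
Proof.
move=> h a; have /eqP := le_anti (introT andP (conj h (Fm_ge0 u))).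
rewrite psumr_eq0 => [/allP/(_ a (mem_index_enum a))|b _]; last by rewrite -expr2 sqr_ge0.
by rewrite -expr2 /= sqrf_eq0 => /eqP.
Qed.

Lemma Nm_gt0 a : 0 < Nm a.
Proof.
rewrite lt_neqAle Fm_ge0 andbT eq_sym; apply/eqP => h.
have := @Fm_eq0 (co a) _ a; rewrite -/(Nm a) h lexx => /(_ isT).
by rewrite -prE pairing_diag.
Qed.

Lemma pr_sym a b : Nm b * pr b a = Nm a * pr a b.
Proof. by rewrite mulrC [RHS]mulrC !prE -!Fm_co FmC. Qed.

Lemma pr_gt0 a b : (0 < pr a b) = (0 < pr b a).
Proof. by rewrite -(pmulr_rgt0 _ (Nm_gt0 a)) -pr_sym pmulr_rgt0 ?Nm_gt0. Qed.
Lemma pr_lt0 a b : (pr a b < 0) = (pr b a < 0).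
Proof. by rewrite -(pmulr_rlt0 _ (Nm_gt0 a)) -pr_sym pmulr_rlt0 ?Nm_gt0. Qed.
Lemma pr_eq0 a b : (pr a b == 0) = (pr b a == 0).
Proof. by rewrite !eq_le !leNgt pr_gt0 pr_lt0. Qed.

(* If the difference d of two roots kills all coroots, then rt c + (2 ^ n - 1) d is a root for
   every n, which is impossible for d <> 0. *)
Lemma root_eq_on_coroots c e : (forall a, pr c a = pr e a) -> c = e.
Proof.
move=> h; pose d := rt c - rt e.
have d0 a : dp d (co a) = 0 by rewrite /d dpDl dpNl -!prE h subrr.
have ex n : exists f, rt f = rt e + (2 ^ n)%N%:Z *: d.
  elim: n => [|n [f ef]]; first by exists c; rewrite scale1r addrC subrK.
  exists (sref (sref f e) (sref f e)); rewrite rt_opp rt_sref.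
  have -> : pr e f = 2.
    have := pairing_diag f; rewrite [in LHS]prE ef dpDl dpZl d0 mulr0 addr0.
    by rewrite -prE.
  rewrite ef expnS PoszM; set K := Posz (2 ^ n).
  by apply/rowP => i; rewrite !mxE; ring.
have [d00|dn0] := eqVneq d 0.
  by apply: root_inj; apply/eqP; rewrite -subr_eq0 -/d d00.
pose f n := sval (cid (ex n)).
have fE n : rt (f n) = rt e + (2 ^ n)%N%:Z *: d := svalP (cid (ex n)).
have finj : injective f.
  case/rV0Pn: dn0 => i di.
  move=> n n' /(congr1 rt); rewrite !fE => /addrI/(congr1 (fun v : 'rV_ _ => v ord0 i)).
  by rewrite [LHS]mxE [RHS]mxE => e2; have [/eqP] := mulIf di e2; rewrite eqn_exp2l // => /eqP.
have := leq_card (fun i : 'I_(#|I|).+1 => f i) (fun i j h => val_inj (finj _ _ h)).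
by rewrite card_ord ltnn.
Qed.

(** The axioms reflect roots and coroots separately and do not say that the resulting indices agree.
    The index [c] of the reflected coroot has the norm of [b], so by [Fm_co] its root pairs with
    every coroot as the reflected root does. *)
Lemma co_sref a b : co (sref a b) = co b - pr a b *: co a.
Proof.
have [c ec] := coroot_refl a b; rewrite -ec; congr co; symmetry.
have ec' : co c = cos a (co b) by rewrite ec.
have NE : Nm c = Nm b by rewrite /Nm ec' Fm_cos.
apply: root_eq_on_coroots => e.
apply: (mulIf (lt0r_neq0 (Nm_gt0 c))); rewrite !prE -Fm_co NE -dp_cos -Fm_co.
by rewrite -(Fm_cos a) ec' cosK.
Qed.

End RootDatum.

(** * Positive roots, simple coroots and null vectors *)

Section Base.
Variables (R : root_datum) (B : base R).
Local Notation I := (rd_index R).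
Local Notation rt := (@rd_root R).
Local Notation co := (@rd_coroot R).
Local Notation pr := (@rd_pairing R).
Local Notation simp := (simples B).
Local Notation pos := (is_positive B).
Implicit Types (a b i j k : I).

Lemma cf_exists a : exists m : I -> int,
  rt a = \sum_(i in simp) m i *: rt i /\
  ((forall i, i \in simp -> 0 <= m i) \/ (forall i, i \in simp -> m i <= 0)).
Proof.
have [m [e|e]] := simple_sign B a; [exists (fun i => (m i)%:Z)|exists (fun i => - (m i)%:Z)].
  split; last by left.
  by rewrite e; apply: eq_bigr => i _; rewrite -scaler_nat natz.
split; last by right=> i _; rewrite oppr_le0.
by rewrite e -sumrN; apply: eq_bigr => i _; rewrite scaleNr -scaler_nat natz.
Qed.

Definition cf a : I -> int := sval (cid (cf_exists a)).

Lemma cfE a : rt a = \sum_(i in simp) cf a i *: rt i.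
Proof. by rewrite /cf; case: cid => m []. Qed.

Lemma cf_sign a : (forall i, i \in simp -> 0 <= cf a i) \/ (forall i, i \in simp -> cf a i <= 0).
Proof. by rewrite /cf; case: cid => m []. Qed.

Lemma cf_uniq a (m : I -> int) : rt a = \sum_(i in simp) m i *: rt i ->
  forall i, i \in simp -> cf a i = m i.
Proof. by rewrite cfE; apply: root_expansion_uniq. Qed.

Lemma delta_sum (V : lmodType int) (F : I -> V) (m : I -> int) (x : int) i : i \in simp ->
  \sum_(j in simp) (m j + x * (j == i)%:Z) *: F j = \sum_(j in simp) m j *: F j + x *: F i.
Proof.
move=> si; under eq_bigr do rewrite scalerDl; rewrite big_split /=; congr (_ + _).
rewrite (bigD1 i) //= eqxx mulr1 big1 ?addr0 // => j /andP[_ /negbTE->].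
by rewrite mulr0 scale0r.
Qed.

Lemma cf_simple i j : i \in simp -> j \in simp -> cf i j = (j == i)%:Z.
Proof.
move=> si; apply: (cf_uniq (m := fun j => (j == i)%:Z)) => /=.
under eq_bigr do rewrite -[(_ == _)%:Z]add0r -[(_ == _)%:Z]mul1r.
by rewrite delta_sum // scale1r big1 ?add0r // => k _; rewrite scale0r.
Qed.

Lemma cf_sref i a j : i \in simp -> j \in simp ->
  cf (sref i a) j = cf a j - pr a i * (j == i)%:Z.
Proof.
move=> si; rewrite -mulNr; move: j; apply: (cf_uniq (m := fun j => cf a j + - pr a i * (j == i)%:Z)).
by rewrite delta_sum // scaleNr -cfE rt_sref.
Qed.

Lemma posP a : reflect (forall i, i \in simp -> 0 <= cf a i) (pos a).
Proof.
apply: (iffP (asboolP _)) => [[m e] i si|h].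
  rewrite (cf_uniq (m := fun i => (m i)%:Z)) // e.
  by apply: eq_bigr => j _; rewrite -scaler_nat natz.
exists (fun i => `|cf a i|%N); rewrite /root_expansion [LHS]cfE; apply: eq_bigr => i si.
by rewrite -scaler_nat natz gez0_abs ?h.
Qed.

Lemma pos_of_coef a j : j \in simp -> 0 < cf a j -> pos a.
Proof. by move=> sj aj; apply/posP; case: (cf_sign a) => // /(_ j sj); rewrite leNgt aj. Qed.

Lemma pos_simple i : i \in simp -> pos i.
Proof. by move=> si; apply: (pos_of_coef si); rewrite cf_simple // eqxx. Qed.

(** Otherwise [a] is k times the simple root [i], and k divides 2 because [pr a a] is 2; k = 2
    contradicts reducedness. *)
Lemma pos_coef_other a i : pos a -> i \in simp -> a != i ->
  exists j, [/\ j \in simp, j != i & 0 < cf a j].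
Proof.
move=> pa si nai; apply: contrapT => no.
have z j : j \in simp -> j != i -> cf a j = 0.
  move=> sj nji; apply/eqP; rewrite eq_le leNgt; apply/andP; split; last exact: (posP _ pa).
  by apply/negP => h; apply: no; exists j.
have e : rt a = cf a i *: rt i.
  by rewrite [LHS]cfE (bigD1 i) //= big1 ?addr0 // => j /andP[sj /(z j sj)->]; rewrite scale0r.
have : cf a i * pr i a = 2 by rewrite -(pairing_diag a) !prE e dpZl.
have := posP _ pa i si; case: (cf a i) e => // k e _ h.
have h2 : (k * `|pr i a|)%N = 2%N by have := congr1 absz h; rewrite abszM.
have : (k %| 2)%N by rewrite -h2 dvdn_mulr.
move/dvdn_leq => /(_ isT); case: k e {h} h2 => [|[|[|k]]] // e _ _.
  by move: e nai; rewrite scale1r => /root_inj->; rewrite eqxx.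
by apply: (@root_reduced R i a); rewrite e -scaler_nat.
Qed.

(** A simple reflection changes one coefficient only, and any other positive coefficient already
    decides the sign of the root. *)
Lemma pos_sref i a : pos a -> i \in simp -> a != i -> pos (sref i a).
Proof.
move=> pa si nai; have [j [sj nji aj]] := pos_coef_other pa si nai.
by apply: (pos_of_coef sj); rewrite cf_sref // (negbTE nji) mulr0 subr0.
Qed.

Lemma sref_neq i a : pos a -> i \in simp -> sref i a != i.
Proof.
move=> pa si; apply/eqP => e; have := posP _ pa i si.
rewrite -[a](srefK i) e cf_sref // cf_simple // eqxx pairing_diag.
by [].
Qed.

Lemma pr_simple i j : i \in simp -> j \in simp -> i != j -> pr i j <= 0.
Proof.
move=> si sj nij; have pi : pos (sref j i) by apply: pos_sref; rewrite ?pos_simple.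
have := posP _ pi j sj; rewrite cf_sref // cf_simple // eqxx mulr1.
by rewrite eq_sym (negbTE nij) sub0r oppr_ge0.
Qed.

(** Twice the usual half sum of positive roots, which avoids fractions. *)
Definition rho2 := \sum_(a | pos a) rt a.

Lemma rho2_co i : i \in simp -> dp rho2 (co i) = 2.
Proof.
move=> si; rewrite /rho2 dp_suml (bigD1 i) ?pos_simple //= -prE pairing_diag.
(* The reflection in [i] permutes the other positive roots and negates their pairings with
   [co i]. *)
set S := \sum_(_ | _) _; suff : S = - S by lia.
rewrite {1}/S (reindex_inj (inv_inj (srefK i))) /= -sumrN.
apply: eq_big => [a|a _]; last by rewrite -!prE pr_srefl pairing_diag; ring.
apply/andP/andP => -[pa na]; split.
- by rewrite -[a](srefK i); apply: pos_sref.
- by rewrite -[a](srefK i); apply: sref_neq.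
- exact: pos_sref.
- exact: sref_neq.
Qed.

Lemma Fm_simple i j : i \in simp -> j \in simp -> i != j -> Fm (co i) (co j) <= 0.
Proof.
move=> si sj nij; rewrite -(@pmulr_rle0 _ 2) // Fm_co -prE mulr_le0_ge0 ?pr_simple //.
exact/ltW/Nm_gt0.
Qed.

(** The form is only semidefinite: a vector of norm zero is merely killed by all roots. Pairing it
    with [rho2], which takes the value 2 on each simple coroot, then forces the nonnegative
    coefficients to vanish. *)
Lemma combo_null (n : I -> int) : (forall i, i \in simp -> 0 <= n i) ->
  (let v := \sum_(i in simp) n i *: co i in Fm v v <= 0) -> forall i, i \in simp -> n i = 0.
Proof.
move=> n0 /= /Fm_eq0; set v := \sum_(_ in _) _ => h.
have : dp rho2 v = 0 by rewrite dp_suml big1.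
rewrite dp_sumr (eq_bigr (fun i => n i * 2)); last by move=> i si; rewrite dpZr rho2_co.
move/eqP; rewrite psumr_eq0 => [/allP h' i si|i si]; last by rewrite mulr_ge0 ?n0.
by have /implyP/(_ si) := h' i (mem_index_enum i); rewrite mulf_eq0 orbF => /eqP.
Qed.

(** The positive and the negative part of a relation are the same vector. Their product is
    nonpositive because distinct simple coroots have nonpositive products, so [combo_null] applies
    to each part. *)
Lemma co_free (n : I -> int) : \sum_(i in simp) n i *: co i = 0 ->
  forall i, i \in simp -> n i = 0.
Proof.
have half (m : I -> int) : \sum_(i in simp) m i *: co i = 0 ->
    forall i, i \in simp -> Num.max (m i) 0 = 0.
  move=> e; apply: combo_null => [i _|/=]; first by rewrite le_max lexx orbT.
  set v := \sum_(_ in _) _.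
  have ev : v = \sum_(i in simp) Num.max (- m i) 0 *: co i.
    apply/eqP; rewrite -subr_eq0 /v -sumrB -[X in _ == X]e; apply/eqP; apply: eq_bigr => i _.
    by rewrite -scalerBl; congr (_ *: _); lia.
  rewrite {2}ev Fm_sumr; apply: sumr_le0 => j sj; rewrite FmZr FmC Fm_sumr mulr_sumr.
  apply: sumr_le0 => i si; rewrite FmZr.
  have [->|nij] := eqVneq i j.
    have [->|->] : Num.max (- m j) 0 = 0 \/ Num.max (m j) 0 = 0 by lia.
      by rewrite mul0r.
    by rewrite mul0r mulr0.
  have := Fm_simple sj si; rewrite eq_sym nij => /(_ isT) h.
  by rewrite mulr_ge0_le0 ?mulr_ge0_le0 ?le_max ?lexx ?orbT.
move=> e i si; have := half _ e i si.
have := half (fun i => - n i) _ i si.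
have -> : \sum_(i0 in simp) - n i0 *: co i0 = 0.
  by under eq_bigr do rewrite scaleNr; rewrite sumrN e oppr0.
by move=> /(_ erefl); lia.
Qed.

(* Such an n would be a null vector of a diagram of affine type. *)
Lemma affine_excluded (n : I -> int) : (forall i, i \in simp -> 0 <= n i) ->
  (forall k, k \in simp -> 0 < n k -> \sum_(j in simp) n j * pr k j <= 0) ->
  forall i, i \in simp -> n i = 0.
Proof.
move=> n0 h; apply: combo_null => //=; set v := \sum_(_ in _) _.
rewrite {2}/v Fm_sumr; apply: sumr_le0 => k sk; rewrite FmZr FmC.
have [nk|nk] := leP (n k) 0; first by rewrite (_ : n k = 0) ?mul0r //; have := n0 k sk; lia.
rewrite pmulr_rle0 // -(@pmulr_rle0 _ 2) // Fm_co pmulr_lle0 ?Nm_gt0 //.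
by rewrite dp_sumr; under eq_bigr do rewrite dpZr; apply: h.
Qed.

(** * Coroot coefficients at a minuscule node *)

Section Minuscule.
Variable delta : I.
Hypothesis hdelta : minuscule B delta.

Lemma sdelta : delta \in simp. Proof. by case: hdelta. Qed.

(** Positivity is placed under the quantifier so that the chosen coefficients are defined for every
    index. *)
Lemma cc_exists a : exists m : I -> nat, pos a -> coroot_expansion B a m /\ (m delta <= 1)%N.
Proof.
case: (boolP (pos a)) => [pa|npa]; last by exists (fun=> 0%N).
by case: hdelta => _ /(_ a pa)[m h1 h2]; exists m.
Qed.

Definition cc a i : int := (sval (cid (cc_exists a)) i)%:Z.

Lemma ccE a : pos a -> co a = \sum_(i in simp) cc a i *: co i.
Proof.
rewrite /cc; case: cid => m /= h /h[e _]; rewrite {1}e.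
by apply: eq_bigr => i _; rewrite -scaler_nat natz.
Qed.

Lemma cc_ge0 a i : 0 <= cc a i. Proof. by []. Qed.

Lemma cc_delta a : pos a -> cc a delta <= 1.
Proof. by rewrite /cc; case: cid => m /= h /h[]. Qed.

Lemma cc_uniq a (m : I -> int) : pos a -> co a = \sum_(i in simp) m i *: co i ->
  forall i, i \in simp -> cc a i = m i.
Proof.
move=> /ccE-> e i si; apply/eqP; rewrite -subr_eq0; apply/eqP.
apply: (co_free (n := fun i => cc a i - m i)) => //.
by under eq_bigr do rewrite scalerBl; rewrite sumrB e subrr.
Qed.

Lemma cc_simple i j : i \in simp -> j \in simp -> cc i j = (j == i)%:Z.
Proof.
move=> si; apply: (cc_uniq (m := fun j => (j == i)%:Z)) => /=; first exact: pos_simple.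
under eq_bigr do rewrite -[(_ == _)%:Z]add0r -[(_ == _)%:Z]mul1r.
by rewrite delta_sum // scale1r big1 ?add0r // => k _; rewrite scale0r.
Qed.

Lemma cc_sref i a j : pos a -> a != i -> i \in simp -> j \in simp ->
  cc (sref i a) j = cc a j - pr i a * (j == i)%:Z.
Proof.
move=> pa nai si; rewrite -mulNr; move: j.
apply: (cc_uniq (m := fun j => cc a j + - pr i a * (j == i)%:Z)); first exact: pos_sref.
by rewrite delta_sum // scaleNr -ccE // co_sref.
Qed.

Lemma pr_cc a b : pos a -> pr b a = \sum_(i in simp) cc a i * pr b i.
Proof. by move=> pa; rewrite prE (ccE pa) dp_sumr; apply: eq_bigr => i _; rewrite dpZr. Qed.

Lemma pr_cf a b : pr a b = \sum_(i in simp) cf a i * pr i b.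
Proof. by rewrite prE cfE dp_suml; apply: eq_bigr => i _; rewrite dpZl. Qed.

Definition ht a : int := \sum_(i in simp) cf a i.

Lemma ht_sref i a : i \in simp -> ht (sref i a) = ht a - pr a i.
Proof.
move=> si; rewrite /ht (bigD1 i) // [in RHS](bigD1 i) //= cf_sref // eqxx mulr1.
rewrite -!addrA; congr (_ + _); rewrite addrC; congr (_ - _).
by apply: eq_bigr => j /andP[sj nji]; rewrite cf_sref // (negbTE nji) mulr0 subr0.
Qed.

Lemma ht_ge0 a : pos a -> 0 <= ht a.
Proof. by move=> /posP h; apply: sumr_ge0. Qed.

Lemma pos_descent a : pos a -> exists i, [/\ i \in simp & 0 < pr a i].
Proof.
move=> pa; apply: contrapT => no; have := pairing_diag a; rewrite (pr_cc a pa) => e.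
suff : \sum_(i in simp) cc a i * pr a i <= 0 by rewrite e.
apply: sumr_le0 => i si; apply: mulr_ge0_le0; rewrite // leNgt.
by apply/negP => h; apply: no; exists i.
Qed.

(** Read downwards: reflecting at a simple root with positive pairing lowers the height, until a
    simple root is reached. *)
Lemma pos_ind (P : I -> Prop) : (forall i, i \in simp -> P i) ->
  (forall a i, pos a -> i \in simp -> a != i -> pr a i < 0 -> P a -> P (sref i a)) ->
  forall a, pos a -> P a.
Proof.
move=> h1 h2 a; have [n] := ubnP `|ht a|%N; elim: n a => // n IH a an pa.
have [i [si ai]] := pos_descent pa.
have [->|nai] := eqVneq a i; first exact: h1.
have ps := pos_sref pa si nai.
rewrite -[a](srefK i); apply: h2 => //; first exact: sref_neq.
  by rewrite pr_srefl pairing_diag; lia.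
apply: IH => //; have := ht_ge0 ps; have := ht_ge0 pa; move: an; rewrite ht_sref //; lia.
Qed.

(** Along [pos_ind] the two coefficients at [i] grow by [- pr a i] and [- pr i a], which are
    positive together. *)
Lemma cf_cc_delta a : pos a -> (cf a delta == 0) = (cc a delta == 0).
Proof.
move=> pa; suff : (0 < cf a delta) = (0 < cc a delta).
  by rewrite !lt0r (posP _ pa) ?sdelta // cc_ge0 !andbT => /negb_inj.
have sd := sdelta; elim/pos_ind: a / pa => [i si|a i pa si nai ai IH].
  by rewrite cf_simple // cc_simple.
rewrite cf_sref // cc_sref //; have [->|ne] := eqVneq delta i; last by rewrite !mulr0 !subr0.
rewrite !mulr1; have := posP _ pa i si; have := cc_ge0 a i.
by have := ai; rewrite pr_lt0 => ai'; lia.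
Qed.

Definition inM a : bool := pos a && (cf a delta != 0).

Lemma inM_cc a : inM a -> cc a delta = 1.
Proof.
case/andP => pa; rewrite cf_cc_delta // => h.
by have := cc_delta pa; have := cc_ge0 a delta; lia.
Qed.

Lemma involvesP a : pos a -> involves B delta a = inM a.
Proof.
move=> pa; rewrite /inM pa /=.
apply/asboolP/idP => [[m e md]|h].
  have -> : cf a delta = (m delta)%:Z; last by [].
  apply: (cf_uniq (m := fun i => (m i)%:Z)) sdelta; rewrite e.
  by apply: eq_bigr => i _; rewrite -scaler_nat natz.
exists (fun i => `|cf a i|%N); last by rewrite absz_eq0.
rewrite /root_expansion [LHS]cfE; apply: eq_bigr => i si.
by rewrite -scaler_nat natz gez0_abs ?(posP _ pa).
Qed.

End Minuscule.
End Base.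

(** * Paths and affine subdiagrams *)

Section Tools.
Variables (R : root_datum) (B : base R).
Local Notation I := (rd_index R).
Local Notation pr := (@rd_pairing R).
Local Notation simp := (simples B).
Local Notation pos := (is_positive B).
Implicit Types (a b i j : I).

Lemma sum_subset_le (K : finType) (s : seq K) (F : K -> int) (P : pred K) : uniq s ->
  (forall x, x \in s -> P x) -> (forall x, P x -> F x <= 0) ->
  \sum_(x | P x) F x <= \sum_(x <- s) F x.
Proof.
move=> us sP F0; rewrite (bigID (mem s)) /= [leRHS]big_uniq //=.
rewrite (eq_bigl (fun x => x \in s)) => [|x]; last by case: (boolP (x \in s)) => [/sP->|]; rewrite ?andbF.
by rewrite gerDl; apply: sumr_le0 => x /andP[/F0].
Qed.

Definition nbs i : {set I} := [set j in simp | (j != i) && (pr i j != 0)].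

Lemma nbsP i j : j \in nbs i -> [/\ j \in simp, j != i & pr i j != 0].
Proof. by rewrite inE => /and3P[]. Qed.

Lemma nbs_sym i j : i \in simp -> j \in nbs i -> i \in nbs j.
Proof. by move=> si /nbsP[sj nji pij]; rewrite inE si eq_sym nji pr_eq0. Qed.

Lemma pr_nbs i j : i \in simp -> j \in nbs i -> pr i j <= -1.
Proof.
move=> si /nbsP[sj nji pij]; have := pr_simple si sj; rewrite eq_sym => /(_ nji); lia.
Qed.

Lemma pr_out i j : j \in simp -> j != i -> j \notin nbs i -> pr i j = 0.
Proof. by move=> sj nji; rewrite inE sj nji /= negbK => /eqP. Qed.

(** A numbered form of [affine_excluded]. It suffices to list enough neighbours in [T] to reach
    twice the weight, since all other terms of the row can only lower it. *)
Lemma affine_idx (m : nat) (x : nat -> I) (w : nat -> int) : (0 < m)%N ->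
  (forall u, (u < m)%N -> x u \in simp) ->
  (forall u v, (u < m)%N -> (v < m)%N -> x u = x v -> u = v) ->
  (forall u, (u < m)%N -> 0 < w u) ->
  (forall u, (u < m)%N -> exists T : seq nat, [/\ uniq T, u \notin T,
      (forall v, v \in T -> (v < m)%N) &
      2 * w u <= \sum_(v <- T) w v * - pr (x u) (x v)]) -> False.
Proof.
move=> m0 xs xinj w0 hT.
pose s := [seq x u | u <- iota 0 m].
have us : uniq s.
  rewrite map_inj_in_uniq ?iota_uniq // => u v; rewrite !mem_iota => hu hv.
  by apply: xinj; lia.
pose n i : int := if i \in s then w (index i s) else 0.
have idx u : (u < m)%N -> index (x u) s = u.
  move=> um; have xus : x u \in s by apply: map_f; rewrite mem_iota.
  have im : (index (x u) s < m)%N by have := index_mem (x u) s; rewrite xus size_map size_iota.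
  apply: xinj => //; rewrite -[RHS](nth_index (x 0%N) xus).
  by rewrite (nth_map 0%N) ?size_iota // nth_iota.
have nx u : (u < m)%N -> n (x u) = w u.
  by move=> um; rewrite /n idx // map_f // mem_iota.
have n0 i : i \in simp -> 0 <= n i.
  move=> _; rewrite /n; case: ifP => // /mapP[u]; rewrite mem_iota => um ->.
  by rewrite idx; [apply/ltW/w0; lia|lia].
suff /(_ (x 0%N) (xs _ m0)) : forall i, i \in simp -> n i = 0.
  by rewrite nx //; have := w0 _ m0; lia.
apply: affine_excluded => // k sk; rewrite {1}/n; case: ifP => // /mapP[u].
rewrite mem_iota => um -> _; have {}um : (u < m)%N by lia.
have [T [uT nuT hTm hle]] := hT u um; have sxu := xs u um.
rewrite (bigD1 (x u)) //= nx // pairing_diag.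
have := @sum_subset_le _ [seq x v | v <- T] (fun j => n j * pr (x u) j)
   (fun j => (j \in simp) && (j != x u)) _ _ _.
rewrite big_map; rewrite (eq_big_seq (fun v => w v * pr (x u) (x v))) => [|v vT]; last first.
  by rewrite nx ?hTm.
have -> : \sum_(v <- T) w v * pr (x u) (x v) = - \sum_(v <- T) w v * - pr (x u) (x v).
  by rewrite -sumrN; apply: eq_bigr => v _; rewrite mulrN opprK.
move=> h; have {}h := h _ _ _; move: h hle; set S1 := \sum_(_ <- _) _; set S2 := \sum_(_ | _) _.
move=> h hle; suff : S2 <= - S1 by lia.
apply: h.
- rewrite map_inj_in_uniq // => v v' vT vT'; apply: xinj; exact: hTm.
- move=> j /mapP[v vT ->]; rewrite xs ?hTm //=; apply: contraNneq nuT => e.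
  by rewrite -(xinj v u) // hTm.
- move=> j /andP[sj nj]; apply: mulr_ge0_le0; first exact: n0.
  by apply: (pr_simple sxu sj); rewrite eq_sym.
Qed.

Definition path_in n (y : nat -> I) := [/\ forall u, (u <= n)%N -> y u \in simp,
  forall u, (u < n)%N -> y u.+1 \in nbs (y u) &
  forall u v, (u <= n)%N -> (v <= n)%N -> y u = y v -> u = v].

Lemma path_in_sub n y o m : path_in n y -> (o + m <= n)%N -> path_in m (fun k => y (o + k)%N).
Proof.
move=> [h1 h2 h3] h; split=> [u um|u um|u v um vm /h3 e].
- by apply: h1; lia.
- by rewrite addnS; apply: h2; lia.
- by have := e _ _; lia.
Qed.

Lemma path_in_take n y m : path_in n y -> (m <= n)%N -> path_in m y.
Proof. exact: (@path_in_sub n y 0 m). Qed.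

Lemma path_in_rev n y : path_in n y -> path_in n (fun k => y (n - k)%N).
Proof.
move=> [h1 h2 h3]; split=> [u um|u um|u v um vm /h3 e].
- by apply: h1; lia.
- apply: nbs_sym; first by apply: h1; lia.
  by rewrite (_ : n - u = (n - u.+1).+1)%N; [apply: h2; lia|lia].
- by have := e _ _; lia.
Qed.

(** Weight 1 on each node: affine type A. *)
Lemma no_cycle n y : path_in n y -> (1 < n)%N -> y n \in nbs (y 0%N) -> False.
Proof.
move=> [h1 h2 h3] n1 hn.
apply: (@affine_idx n.+1 y (fun=> 1)) => // u un.
have su : y u \in simp by apply: h1.
exists [:: if u == 0 then n else u.-1; if u == n then 0 else u.+1]%N; split.
- by rewrite /= inE andbT; case: (u =P 0%N) => ?; case: (u =P n) => ?; apply/eqP; lia.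
- by rewrite !inE; case: (u =P 0%N) => ?; case: (u =P n) => ?; apply/negP; lia.
- by move=> v; rewrite !inE; case: (u =P 0%N) => ?; case: (u =P n) => ?; lia.
- rewrite big_cons big_seq1 !mul1r.
  have a1 : pr (y u) (y (if u == 0 then n else u.-1)%N) <= -1.
    apply: pr_nbs => //; case: eqP => [-> //|u0]; apply: nbs_sym; first by apply: h1; lia.
    by rewrite -[u in y u]prednK; [apply: h2; lia|lia].
  have a2 : pr (y u) (y (if u == n then 0 else u.+1)%N) <= -1.
    apply: pr_nbs => //; case: eqP => [->|un']; first by apply: nbs_sym => //; apply: h1.
    by apply: h2; lia.
  lia.
Qed.

Lemma off_path n y p : path_in n y -> p \in nbs (y 0%N) -> ((0 < n)%N -> p != y 1%N) ->
  forall u, (u <= n)%N -> p != y u.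
Proof.
move=> py pn p1 [|[|u]] un; [by have [_] := nbsP pn|exact: p1|].
apply/eqP => e; apply: (@no_cycle u.+2 y) => //; first exact: path_in_take py un.
by rewrite -e.
Qed.

(** At a first meeting point, following one arm back to the common start and the other one out again
    closes a cycle. *)
Lemma arms_disjoint n n' x y : path_in n x -> path_in n' y -> x 0%N = y 0%N -> x 1%N != y 1%N ->
  forall u v : nat, (u <= n)%N -> (v <= n')%N -> (0 < u)%N -> x u <> y v.
Proof.
move=> px py e0 n1 u v; have [N] := ubnP (u + v); elim: N u v => // N IH i j.
move=> hN hi hj i0 e; have [x1 x2 x3] := px; have [y1 y2 y3] := py.
have j0 : (0 < j)%N by case: j e {hj hN} => // e; have := x3 i 0%N hi isT; rewrite e e0 => /(_ erefl); lia.
have ij : (2 < i + j)%N.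
  case: i j e i0 j0 {hi hj hN} => [|[|i]] [|[|j]] // e _ _; try lia.
  by move: n1; rewrite e eqxx.
pose z k := if (k <= i)%N then x (i - k)%N else y (k - i)%N.
apply: (@no_cycle (i + j).-1 z); first split.
- by move=> u hu; rewrite /z; case: leqP => ?; [apply: x1|apply: y1]; lia.
- move=> u hu; rewrite /z; case: leqP => h; case: leqP => h'; try lia.
  + have -> : u = i by lia.
    by rewrite subnn e0 subSn // subnn; apply: y2; lia.
  + by rewrite subSn; [apply: y2; lia|lia].
  + apply: nbs_sym; first by apply: x1; lia.
    by rewrite (_ : i - u = (i - u.+1).+1)%N; [apply: x2; lia|lia].
- move=> u v hu hv; rewrite /z; case: leqP => h; case: leqP => h' e'.
  + by have := x3 _ _ _ _ e'; lia.
  + have [iu|iu] : u = i \/ (u < i)%N by lia.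
      by move: e'; rewrite iu subnn e0 => e'; have := y3 _ _ _ _ e'; lia.
    by case: (IH (i - u)%N (v - i)%N) => //; lia.
  + have [iu|iu] : v = i \/ (v < i)%N by lia.
      by move: e'; rewrite iu subnn e0 => e'; have := y3 _ _ _ _ e'; lia.
    by case: (IH (i - v)%N (u - i)%N) => //; lia.
  + by have := y3 _ _ _ _ e'; lia.
- lia.
- rewrite {2}/z /= subn0 e /z; case: leqP => h.
    have j1 : j = 1%N by lia.
    rewrite j1 (_ : i - _ = 0)%N ?e0; last by lia.
    by apply: nbs_sym; [apply: y1|apply: y2]; lia.
  apply: nbs_sym; first by apply: y1; lia.
  by rewrite (_ : (i + j).-1 - i = j.-1)%N; [rewrite -[j in y j]prednK //; apply: y2|]; lia.
Qed.

(* Weights of an affine diagram of type D or a folding of it on one end of a path whose nodes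
   all have weight 2. *)
Definition gadget y0 (g : I -> int) := [/\ forall k, 0 <= g k,
  forall k, 0 < g k -> k \in nbs y0, forall k, k \in nbs y0 -> g k <= - pr k y0 &
  2 <= \sum_(k in simp) g k * - pr y0 k].

Lemma gadget_branch y0 p q : y0 \in simp -> p \in nbs y0 -> q \in nbs y0 -> p != q ->
  gadget y0 (fun k => (k == p)%:Z + (k == q)%:Z).
Proof.
move=> sy hp hq npq; split=> [k|k|k hk|].
- by rewrite addr_ge0.
- by case: eqVneq => [->//|_]; case: eqVneq => [->//|_].
- have [sk _ _] := nbsP hk; have := pr_nbs sk (nbs_sym sy hk).
  by case: (eqVneq k p) => [->|_]; [rewrite (negbTE npq)|case: (eqVneq k q) => _]; lia.
- have [sp _ _] := nbsP hp; have [sq _ _] := nbsP hq.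
  rewrite (bigD1 p) //= (bigD1 q) /=; last by rewrite sq eq_sym.
  rewrite !eqxx (negbTE npq) eq_sym (negbTE npq) big1 => [|k /andP[/andP[_ /negbTE->] /negbTE->]]; last by rewrite mul0r.
  by have := pr_nbs sy hp; have := pr_nbs sy hq; lia.
Qed.

Lemma gadget_double y0 h : y0 \in simp -> h \in nbs y0 -> (pr h y0 <= -2) || (pr y0 h <= -2) ->
  gadget y0 (fun k => - pr h y0 * (k == h)%:Z).
Proof.
move=> sy hh dbl; have [sh _ _] := nbsP hh.
have h1 := pr_nbs sy hh; have h2 := pr_nbs sh (nbs_sym sy hh).
split=> [k|k|k hk|].
- by case: eqVneq; lia.
- by case: eqVneq => [->//|_]; lia.
- have [sk _ _] := nbsP hk; have := pr_nbs sk (nbs_sym sy hk).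
  by case: eqVneq => [->|_]; lia.
- rewrite (bigD1 h) //= eqxx mulr1 big1 ?addr0 => [|k /andP[_ /negbTE->]]; last by rewrite mulr0 mul0r.
  case/orP: dbl; nia.
Qed.

(** At an end of the path the gadget makes up for the missing path neighbour; off the path, the
    bound [g k <= - pr k y0] offsets the weight of a gadget node. For [n = 0] both gadgets sit on
    one node, whence the condition on supports. *)
Lemma two_gadgets n y g g' : path_in n y -> gadget (y 0%N) g -> gadget (y n) g' ->
  ((0 < n)%N -> g (y 1%N) = 0) -> ((0 < n)%N -> g' (y n.-1) = 0) ->
  (n = 0%N -> forall k, g k = 0 \/ g' k = 0) -> False.
Proof.
move=> py [g0 gn gu gs] [g0' gn' gu' gs'] g1 g1' gg.
have [y1 y2 y3] := py.
have off k u : 0 < g k -> (u <= n)%N -> k != y u.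
  by move=> gk; apply: off_path => //; [exact: gn|move=> /g1 e; apply: contraTneq gk => ->; rewrite e].
have off' k u : 0 < g' k -> (u <= n)%N -> k != y u.
  move=> gk un; have := @off_path n (fun v => y (n - v)%N) k (path_in_rev py).
  rewrite subn0 subn1 => /(_ (gn' k gk)) /(_ _ (n - u)%N); rewrite subKn //; apply; last by lia.
  by move=> /g1' e; apply: contraTneq gk => ->; rewrite e.
pose N k : int := 2 * \sum_(u < n.+1) (k == y u)%:Z + g k + g' k.
have s0 : y 0%N \in simp by apply: y1.
have N0 k : 0 <= \sum_(u < n.+1) (k == y u)%:Z by apply: sumr_ge0.
suff /(_ _ s0) : forall i, i \in simp -> N i = 0.
  rewrite /N big_ord_recl eqxx /=; set S := \sum_(_ < n) _.
  have : 0 <= S by apply: sumr_ge0.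
  by have := g0 (y 0%N); have := g0' (y 0%N); lia.
apply: affine_excluded => [k _|k sk Nk]; first by rewrite /N; have := g0 k; have := g0' k; have := N0 k; lia.
have -> : \sum_(j in simp) N j * pr k j = 2 * \sum_(u < n.+1) pr k (y u) +
    \sum_(j in simp) g j * pr k j + \sum_(j in simp) g' j * pr k j.
  rewrite (eq_bigr (fun j => 2 * \sum_(u < n.+1) (j == y u)%:Z * pr k j + g j * pr k j + g' j * pr k j)).
    rewrite !big_split -mulr_sumr exchange_big /=; congr (_ * _ + _ + _).
    apply: eq_bigr => u _; rewrite (bigD1 (y u)) /= ?y1 -1?ltnS // eqxx mul1r big1 ?addr0 // => j /andP[_ /negbTE->].
    by rewrite mul0r.
  by move=> j _; rewrite /N !mulrDl -mulrA mulr_suml.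
have gle h j : (forall k, 0 <= h k) -> j \in simp -> j != k -> h j * pr k j <= 0.
  by move=> h0 sj nj; apply: mulr_ge0_le0 => //; apply: (@pr_simple _ B); rewrite // eq_sym.
have gsum (h : I -> int) : (forall k, 0 <= h k) -> \sum_(j in simp) h j * pr k j <= 2 * h k.
  move=> h0; rewrite (bigD1 k) //= pairing_diag mulrC gerDl.
  by apply: sumr_le0 => j /andP[sj nj]; apply: gle.
have G := gsum g g0; have G' := gsum g' g0'.
have [/existsP[v /eqP ev]|/existsPn nk] := boolP [exists v : 'I_n.+1, k == y v].
  have vn : (v <= n)%N by rewrite -ltnS.
  have gk : g k = 0.
    by apply/eqP; rewrite eq_le g0 andbT leNgt; apply/negP => h; have := off k v h vn; rewrite ev eqxx.
  have gk' : g' k = 0.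
    by apply/eqP; rewrite eq_le g0' andbT leNgt; apply/negP => h; have := off' k v h vn; rewrite ev eqxx.
  rewrite gk gk' in G G'.
  have Bd : \sum_(u < n.+1) pr k (y u) <= 2 - (0 < v)%:Z - (v < n)%:Z.
    rewrite (bigD1 v) //= ev pairing_diag -[leRHS]addrA lerD2l.
    pose s := (if (0 < v)%N then [:: inord v.-1 : 'I_n.+1] else [::]) ++
              (if (v < n)%N then [:: inord v.+1] else [::]).
    have S u : u \in s -> ((u : nat) = v.-1 /\ (0 < v)%N) \/ ((u : nat) = v.+1 /\ (v < n)%N).
      rewrite /s mem_cat; case: ltnP => _; case: ltnP => ? /=; rewrite ?inE // ?orbF.
      - by case/orP => /eqP->; rewrite inordK; [left|lia|right|lia].
      - by move=> /eqP->; rewrite inordK; [left|lia].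
      - by move=> /eqP->; rewrite inordK; [right|lia].
    have : \sum_(i < n.+1 | i != v) pr (y v) (y i) <= \sum_(i <- s) pr (y v) (y i).
      apply: sum_subset_le.
      - rewrite /s; case: ltnP => ?; case: ltnP => ? //=; rewrite inE andbT.
        by apply/eqP => /(congr1 (@nat_of_ord _)); rewrite !inordK; lia.
      - by move=> u /S h; apply/eqP => e; rewrite e in h; lia.
      - move=> u nuv; apply: (@pr_simple _ B); rewrite ?y1 // -1?ltnS //.
        by apply: contraNneq nuv => /y3 e; apply/eqP/val_inj; rewrite /= e // -ltnS.
    move/le_trans; apply; rewrite /s big_cat /=.
    apply: lerD; case: ltnP => h; rewrite ?big_nil // big_seq1 inordK; try lia.
      apply: (pr_nbs (y1 _ vn)); apply: nbs_sym; first by apply: y1; lia.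
      by rewrite -[v in y v]prednK //; apply: y2; lia.
    by apply: (pr_nbs (y1 _ vn)); apply: y2.
  have e1 : v = 0%N :> nat -> \sum_(j in simp) g j * pr k j <= -2.
    move=> v0; rewrite ev v0; suff -> : \sum_(j in simp) g j * pr (y 0%N) j = - \sum_(j in simp) g j * - pr (y 0%N) j by lia.
    by rewrite -sumrN; apply: eq_bigr => j _; rewrite mulrN opprK.
  have e2 : v = n :> nat -> \sum_(j in simp) g' j * pr k j <= -2.
    move=> v0; rewrite ev v0; suff -> : \sum_(j in simp) g' j * pr (y n) j = - \sum_(j in simp) g' j * - pr (y n) j by lia.
    by rewrite -sumrN; apply: eq_bigr => j _; rewrite mulrN opprK.
  move: Bd e1 e2 G G' vn; case: (posnP v) => [->|v0]; case: (ltngtP v n); lia.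
have npr u : (u <= n)%N -> pr k (y u) <= 0.
  move=> un; apply: (@pr_simple _ B); rewrite ?y1 //.
  by have := nk (Ordinal (un : (u < n.+1)%N)).
have S0 : \sum_(u < n.+1) pr k (y u) <= pr k (y 0%N) + (if (0 < n)%N then pr k (y n) else 0).
  have := @sum_subset_le _ (ord0 :: if (0 < n)%N then [:: ord_max] else [::]) (fun u : 'I_n.+1 => pr k (y u)) xpredT.
  move=> Sle; apply: le_trans (Sle _ _ _) _ => // [|u _|].
  - by rewrite /=; case: posnP => n0 //=; rewrite inE andbT; apply/eqP => /(congr1 (@nat_of_ord _)) /=; lia.
  - by rewrite npr // -ltnS.
  - by rewrite big_cons; case: posnP => n0; rewrite ?big_nil ?big_seq1.
have gk : g k <= - pr k (y 0%N).
  have [hk|hk] := boolP (k \in nbs (y 0%N)); first exact: gu.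
  by apply: le_trans (_ : 0 <= _); [rewrite leNgt; apply: contra hk => /gn|have := npr 0%N isT; lia].
have gk' : g' k <= - pr k (y n).
  have [hk|hk] := boolP (k \in nbs (y n)); first exact: gu'.
  by apply: le_trans (_ : 0 <= _); [rewrite leNgt; apply: contra hk => /gn'|have := npr n (leqnn _); lia].
have := npr 0%N isT; have := npr n (leqnn _); have := g0 k; have := g0' k.
case: (posnP n) gg gk' S0 => [n0 /(_ n0 k) gg|_ _]; last by lia.
by rewrite n0; lia.
Qed.


(** Affine type D, with four neighbours of a single node when [n = 0]. *)
Lemma two_branches n y p q p' q' : path_in n y -> p \in nbs (y 0%N) -> q \in nbs (y 0%N) ->
  p' \in nbs (y n) -> q' \in nbs (y n) -> p != q -> p' != q' ->
  ((0 < n)%N -> (p != y 1%N) && (q != y 1%N)) ->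
  ((0 < n)%N -> (p' != y n.-1) && (q' != y n.-1)) ->
  (n = 0%N -> [&& p != p', p != q', q != p' & q != q']) -> False.
Proof.
move=> py hp hq hp' hq' npq npq' h1 h2 h3; have [y1 _ _] := py.
apply: (two_gadgets py (gadget_branch _ hp hq npq) (gadget_branch _ hp' hq' npq')); rewrite ?y1 //.
- by move=> /h1/andP[]; rewrite ![_ == y _]eq_sym => /negbTE-> /negbTE->.
- by move=> /h2/andP[]; rewrite ![_ == y _]eq_sym => /negbTE-> /negbTE->.
- move=> /h3/and4P[/negbTE e1 /negbTE e2 /negbTE e3 /negbTE e4] k.
  case: (eqVneq k p) => [->|_]; first by rewrite e1 e2; right.
  by case: (eqVneq k q) => [->|_]; [rewrite e3 e4; right|left].
Qed.

Lemma double_branch n y h p q : path_in n y -> h \in nbs (y 0%N) ->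
  (pr h (y 0%N) <= -2) || (pr (y 0%N) h <= -2) ->
  p \in nbs (y n) -> q \in nbs (y n) -> p != q -> ((0 < n)%N -> h != y 1%N) ->
  ((0 < n)%N -> (p != y n.-1) && (q != y n.-1)) ->
  (n = 0%N -> (p != h) && (q != h)) -> False.
Proof.
move=> py hh dbl hp hq npq h1 h2 h3; have [y1 _ _] := py.
apply: (two_gadgets py (gadget_double _ hh dbl) (gadget_branch _ hp hq npq)); rewrite ?y1 //.
- by move=> /h1; rewrite eq_sym => /negbTE->; rewrite mulr0.
- by move=> /h2/andP[]; rewrite ![_ == y _]eq_sym => /negbTE-> /negbTE->.
- move=> /h3/andP[]; rewrite ![_ == h]eq_sym => /negbTE e1 /negbTE e2 k.
  by case: (eqVneq k h) => [->|_]; [rewrite e1 e2; right|rewrite mulr0; left].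
Qed.

Lemma two_doubles n y h h' : path_in n y -> h \in nbs (y 0%N) -> h' \in nbs (y n) ->
  (pr h (y 0%N) <= -2) || (pr (y 0%N) h <= -2) ->
  (pr h' (y n) <= -2) || (pr (y n) h' <= -2) ->
  ((0 < n)%N -> h != y 1%N) -> ((0 < n)%N -> h' != y n.-1) -> (n = 0%N -> h != h') -> False.
Proof.
move=> py hh hh' d d' h1 h2 h3; have [y1 _ _] := py.
apply: (two_gadgets py (gadget_double _ hh d) (gadget_double _ hh' d')); rewrite ?y1 //.
- by move=> /h1; rewrite eq_sym => /negbTE->; rewrite mulr0.
- by move=> /h2; rewrite eq_sym => /negbTE->; rewrite mulr0.
- move=> /h3/negbTE e k; case: (eqVneq k h) => [->|_]; last by rewrite mulr0; left.
  by rewrite e mulr0; right.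
Qed.

(* With A + B' + C = L these are the affine diagrams of type E, weighted by their null vectors. *)
Lemma tee_affine (a b c : nat) (x y z : nat -> I) (A B' C L : int) : path_in a x -> path_in b y -> path_in c z ->
  x 0%N = y 0%N -> x 0%N = z 0%N -> x 1%N != y 1%N -> x 1%N != z 1%N -> y 1%N != z 1%N ->
  (0 < a)%N -> (0 < b)%N -> (0 < c)%N -> 0 < A -> 0 < B' -> 0 < C ->
  a.+1%:Z * A = L -> b.+1%:Z * B' = L -> c.+1%:Z * C = L -> A + B' + C <= L -> False.
Proof.
move=> px py pz exy exz nxy nxz nyz a0 b0 c0 A0 B0 C0 hA hB hC hL.
have Dxy := arms_disjoint px py exy nxy; have Dxz := arms_disjoint px pz exz nxz.
have Dyz := arms_disjoint py pz (etrans (esym exy) exz) nyz.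
have [x1 x2 x3] := px; have [y1 y2 y3] := py; have [z1 z2 z3] := pz.
pose X k := if (k <= a)%N then x k else if (k <= a + b)%N then y (k - a)%N else z (k - (a + b))%N.
(* The weights fall linearly from [L] at the branch node to zero just beyond the end of each arm; at
   the branch node the requirement becomes [A + B' + C <= L]. *)
pose w k : int := if (k <= a)%N then (a.+1%:Z - k%:Z) * A
  else if (k <= a + b)%N then (b.+1%:Z - (k%:Z - a%:Z)) * B' else (c.+1%:Z - (k%:Z - (a + b)%:Z)) * C.
(* The arms are numbered consecutively, so the first nodes of the second and third arm have 0 as
   predecessor. *)
pose T k : seq nat := if (k == 0)%N then [:: 1; a.+1; (a + b).+1]%N else
  (if ((k == a.+1) || (k == (a + b).+1))%N then 0%N else k.-1) ::
  (if (k == a) || (k == a + b)%N || (k == a + b + c)%N then [::] else [:: k.+1]).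
apply: (@affine_idx (a + b + c).+1 X w) => //.
- by move=> u un; rewrite /X; case: leqP => ?; [|case: leqP => ?]; [apply: x1|apply: y1|apply: z1]; lia.
- move=> u v un vn; rewrite /X.
  have [ua|ua] := leqP u a; have [va|va] := leqP v a; [by move=> /x3; lia| | |].
  + have [vb|vb] := leqP v (a + b) => e.
      have [u0|u0] := posnP u; last by case: (Dxy u (v - a)%N _ _ _ e); lia.
      by rewrite u0 exy in e; have := y3 0%N _ _ _ e; lia.
    have [u0|u0] := posnP u; last by case: (Dxz u (v - (a + b))%N _ _ _ e); lia.
    by rewrite u0 exz in e; have := z3 0%N _ _ _ e; lia.
  + have [vb|vb] := leqP u (a + b) => e.
      have [u0|u0] := posnP v; last by case: (Dxy v (u - a)%N _ _ _ (esym e)); lia.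
      by rewrite u0 exy in e; have := y3 _ 0%N _ _ e; lia.
    have [u0|u0] := posnP v; last by case: (Dxz v (u - (a + b))%N _ _ _ (esym e)); lia.
    by rewrite u0 exz in e; have := z3 _ 0%N _ _ e; lia.
  + have [ub|ub] := leqP u (a + b); have [vb|vb] := leqP v (a + b) => e.
    * by have := y3 _ _ _ _ e; lia.
    * by case: (Dyz (u - a)%N (v - (a + b))%N _ _ _ e); lia.
    * by case: (Dyz (v - a)%N (u - (a + b))%N _ _ _ (esym e)); lia.
    * by have := z3 _ _ _ _ e; lia.
- by move=> u un; rewrite /w; case: leqP => ?; [|case: leqP => ?]; apply: mulr_gt0; lia.
- have adj u v : (u <= a + b + c)%N -> v \in T u -> (v <= a + b + c)%N && (X v \in nbs (X u)).
    rewrite /T; have [->|u0] := eqVneq u 0%N.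
      rewrite !in_cons in_nil orbF /X => _ /or3P[] /eqP->.
      - by rewrite a0 /= x2 // andbT; lia.
      - by rewrite ltnn subSnn ifT ?exy ?y2 ?andbT //; lia.
      - by rewrite ifF ?ifF ?subSnn ?exz ?z2 ?andbT //; lia.
    move=> un; rewrite in_cons => /orP[/eqP->|].
      case: ifP => [/orP[]/eqP->|h]; rewrite /X.
      - by rewrite leq0n ltnn subSnn ifT ?exy; [apply: nbs_sym; [apply: y1|apply: y2]|]; lia.
      - by rewrite leq0n ifF ?ifF ?subSnn ?exz; [apply: nbs_sym; [apply: z1|apply: z2]| |]; lia.
      - have [ua|ua] := leqP u a.
          rewrite ifT; last by lia.
          by apply/andP; split; [lia|apply: nbs_sym; [apply: x1|rewrite -[u in x u]prednK; [apply: x2|]]; lia].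
        rewrite ifF; last by lia.
        have [ub|ub] := leqP u (a + b).
          rewrite ifT; last by lia.
          apply/andP; split; [lia|apply: nbs_sym; first by apply: y1; lia].
          by rewrite (_ : u - a = (u.-1 - a).+1)%N; [apply: y2; lia|lia].
        rewrite ifF; last by lia.
        apply/andP; split; [lia|apply: nbs_sym; first by apply: z1; lia].
        by rewrite (_ : u - (a + b) = (u.-1 - (a + b)).+1)%N; [apply: z2; lia|lia].
    case: ifP => // h; rewrite mem_seq1 => /eqP->; apply/andP; split; first by lia.
    rewrite /X; have [ua|ua] := leqP u a; first by rewrite ifT; [apply: x2|]; lia.
    rewrite ifF; last by lia.
    have [ub|ub] := leqP u (a + b); first by rewrite ifT ?subSn; [apply: y2| |]; lia.
    by rewrite ifF ?subSn; [apply: z2| |]; lia.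
  move=> u un; exists (T u); split.
  + rewrite /T; case: eqP => u0; first by rewrite /= !inE; lia.
    by case: ifP => ?; case: ifP => ?; rewrite //= inE andbT; lia.
  + rewrite /T; case: eqP => [->|u0]; first by rewrite !inE; lia.
    by case: ifP => ?; case: ifP => ?; rewrite ?inE; lia.
  + by move=> v /(adj u v un)/andP[].
  have pX v : v \in T u -> pr (X u) (X v) <= -1.
    move=> /(adj u v un)/andP[_]; apply: pr_nbs; rewrite /X.
    by case: leqP => ?; [|case: leqP => ?]; [apply: x1|apply: y1|apply: z1]; lia.
  have w0 v : (v <= a + b + c)%N -> 0 < w v.
    by move=> vn; rewrite /w; case: leqP => ?; [|case: leqP => ?]; apply: mulr_gt0; lia.
  apply: le_trans (_ : \sum_(v <- T u) w v <= _); last first.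
    rewrite big_seq [leRHS]big_seq; apply: ler_sum => v vT.
    have /andP[/w0 wv _] := adj u v un vT; have := pX v vT; nia.
  rewrite /T; case: eqP => [->|u0].
    rewrite !big_cons big_nil /w leq0n a0 ltnn ifT; last by lia.
    rewrite ifF; last by lia.
    rewrite ifF; last by lia.
    lia.
  rewrite big_cons; set f := (if _ then _ else _); set g := (if _ then _ else _).
  (* Along an arm the weights are in arithmetic progression; beyond its end the progression reaches
     zero, which matches the empty sum. *)
  suff [q [D [e1 e2 e3]]] : exists q D : int, [/\ w u = q * D, w f = (q + 1) * D &
      \sum_(v <- g) w v = (q - 1) * D].
    by rewrite e1 e2 e3 (_ : (q + 1) * D + (q - 1) * D = 2 * (q * D)) //; ring.
  have [ua|ua] := leqP u a.
    exists (a.+1%:Z - u%:Z), A; split; first by rewrite /w ua.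
      rewrite /f ifF; last by lia.
      by rewrite /w ifT; [congr (_ * _)|]; lia.
    rewrite /g; case: ifP => h.
      by rewrite big_nil (_ : a.+1%:Z - u%:Z - 1 = 0) ?mul0r //; lia.
    by rewrite big_seq1 /w ifT; [congr (_ * _)|]; lia.
  have [ub|ub] := leqP u (a + b).
    exists (b.+1%:Z - (u%:Z - a%:Z)), B'; split.
    - by rewrite /w ub ifF //; lia.
    - rewrite /f; case: ifP => h.
        by rewrite /w leq0n subr0 hA -hB; congr (_ * _); lia.
      rewrite /w ifF; last by lia.
      by rewrite ifT; [congr (_ * _)|]; lia.
    - rewrite /g; case: ifP => h.
        by rewrite big_nil (_ : b.+1%:Z - (u%:Z - a%:Z) - 1 = 0) ?mul0r //; lia.
      rewrite big_seq1 /w ifF; last by lia.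
      by rewrite ifT; [congr (_ * _)|]; lia.
  exists (c.+1%:Z - (u%:Z - (a + b)%:Z)), C; split.
  - rewrite /w ifF; last by lia.
    by rewrite ifF //; lia.
  - rewrite /f; case: ifP => h.
      by rewrite /w leq0n subr0 hA -hC; congr (_ * _); lia.
    rewrite /w ifF; last by lia.
    by rewrite ifF; [congr (_ * _)|]; lia.
  - rewrite /g; case: ifP => h.
      by rewrite big_nil (_ : c.+1%:Z - (u%:Z - (a + b)%:Z) - 1 = 0) ?mul0r //; lia.
    rewrite big_seq1 /w ifF; last by lia.
    by rewrite ifF; [congr (_ * _)|]; lia.
Qed.

(** * Walks through nodes of degree two *)

Definition wstep (e : I * I) := (e.2, odflt e.2 [pick j in nbs e.2 | j != e.1]).
Definition walk (x0 x1 : I) n := (iter n wstep (x0, x1)).1.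

Lemma walkSS x0 x1 n :
  walk x0 x1 n.+2 = odflt (walk x0 x1 n.+1) [pick j in nbs (walk x0 x1 n.+1) | j != walk x0 x1 n].
Proof. by []. Qed.

(** A repeated node would close a cycle or give a node of degree two a third neighbour. *)
Lemma walk_path x0 x1 n : x0 \in simp -> x1 \in nbs x0 ->
  (forall u, (u < n)%N -> #|nbs (walk x0 x1 u.+1)| = 2%N) ->
  path_in n.+1 (walk x0 x1) /\
  forall u, (u < n)%N -> nbs (walk x0 x1 u.+1) = [set walk x0 x1 u; walk x0 x1 u.+2].
Proof.
move=> s0 hx1 deg; set w := walk x0 x1.
have A u : (u <= n)%N -> [/\ w u \in simp, w u.+1 \in nbs (w u) &
    (0 < u)%N -> w u.+1 != w u.-1].
  elim: u => [|u IH] un; first by split.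
  have [su hu _] := IH (ltnW un); have [s1 _ _] := nbsP hu.
  have sy := nbs_sym su hu.
  rewrite /= /w walkSS -/w; case: pickP => [j /andP[hj nj]|no] /=; first by split.
  have := deg u un; rewrite (cardsD1 (w u)) sy => -[] /eqP/cards1P[j e].
  by have := no j; have := set11 j; rewrite -e !inE andbC => ->.
have N u : (u < n)%N -> nbs (w u.+1) = [set w u; w u.+2].
  move=> un; have [su hu _] := A u (ltnW un); have [s1 h1 n1] := A u.+1 un.
  apply/esym/eqP; rewrite eqEcard deg // cards2 eq_sym n1 // andbT.
  by apply/subsetP => j; rewrite in_set2 => /orP[] /eqP-> //; apply: nbs_sym.
split=> //; elim: n deg A N => [|n IH] deg A N.
  split=> [u|u|u v].
  - by case: u => [|[|]] // _; have [] := nbsP hx1.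
  - by case: u.
  - have [_ nx _] := nbsP hx1; case: u => [|[|]] //; case: v => [|[|]] // _ _ e; move: nx.
      by rewrite -[x1]/(w 1%N) -e eqxx.
    by rewrite -[x1]/(w 1%N) e eqxx.
have [p1 p2 p3] : path_in n.+1 w.
  apply: IH => u un; [apply: deg|apply: A|apply: N]; lia.
have [sn hn nn] := A n.+1 (leqnn _); have [sn2 nn2 _] := nbsP hn.
have new u : (u <= n.+1)%N -> w u <> w n.+2.
  move=> un e; have [u0|u0] := posnP u.
    have n0 : (0 < n)%N by case: (posnP n) => // n0; move: (nn isT); rewrite /= -e u0 n0 eqxx.
    apply: (@no_cycle n.+1 w) => //.
    by rewrite -u0 e; apply: nbs_sym.
  have : w n.+1 \in nbs (w u) by rewrite e; apply: nbs_sym.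
  have [un1|un1] : u = n.+1 \/ (u.-1 < n)%N by lia.
    by rewrite un1; case/nbsP; rewrite eqxx.
  rewrite -[u]prednK // N ?prednK // in_set2 => /orP[]/eqP/p3 e'; have := e' _ _; try lia.
  move=> h; have {}h : n = u by lia.
  by have := nn isT; rewrite /= -e h eqxx.
split=> [u un|u un|u v un vn e].
- have [->|lu] : u = n.+2 \/ (u <= n.+1)%N by lia.
    exact: sn2.
  exact: p1.
- by have [] := A u; lia.
- have [eu|lu] : u = n.+2 \/ (u <= n.+1)%N by lia.
    have [->//|lv] : v = n.+2 \/ (v <= n.+1)%N by lia.
    by case: (new v lv); rewrite -e eu.
  have [ev|lv] : v = n.+2 \/ (v <= n.+1)%N by lia.
    by case: (new u lu); rewrite e ev.
  exact: p3.
Qed.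

Lemma walk_exists x0 x1 : x0 \in simp -> x1 \in nbs x0 -> exists n w, [/\ path_in n.+1 w,
  w 0%N = x0 /\ w 1%N = x1, forall u, (u < n)%N -> nbs (w u.+1) = [set w u; w u.+2] &
  #|nbs (w n.+1)| != 2%N].
Proof.
move=> s0 h1; pose P n := #|nbs (walk x0 x1 n.+1)| != 2%N.
have ex : exists n, P n.
  apply: contrapT => no; have deg u : #|nbs (walk x0 x1 u.+1)| = 2%N.
    by apply/eqP; apply: contrapT => h; apply: no; exists u; apply/negP.
  have [[_ _ inj] _] := @walk_path x0 x1 #|I| s0 h1 (fun u _ => deg u).
  suff : (#|'I_(#|I|.+1)| <= #|I|)%N by rewrite card_ord ltnn.
  apply: (@leq_card _ _ (fun u : 'I_(#|I|.+1) => walk x0 x1 u)) => u v e.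
  by apply: val_inj; apply: inj e; apply: ltnW.
case: (ex_minnP ex) => n Pn mn; have [|h2 h3] := @walk_path x0 x1 n s0 h1.
  by move=> u un; apply/eqP; apply: contraT => /mn; rewrite leqNgt un.
by exists n, (walk x0 x1); split.
Qed.

(** * Dominant coroots and minuscule nodes along a path *)

Section Minuscule.
Variable delta : I.
Hypothesis hdelta : minuscule B delta.
Local Notation cc := (cc hdelta).

Lemma cc_other_sref i a j : pos a -> a != i -> i \in simp -> j \in simp -> j != i ->
  cc (sref i a) j = cc a j.
Proof. by move=> pa nai si sj nji; rewrite cc_sref // (negbTE nji) mulr0 subr0. Qed.

Lemma pr_ub a k (T : seq I) : pos a -> k \in simp -> uniq T -> k \notin T ->
  (forall j, j \in T -> j \in simp) ->
  pr k a <= 2 * cc a k - \sum_(j <- T) cc a j * - pr k j.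
Proof.
move=> pa sk uT kT sT; rewrite (pr_cc hdelta k pa) (bigD1 k) //= pairing_diag mulrC lerD2l.
have -> : - (\sum_(j <- T) cc a j * - pr k j) = \sum_(j <- T) cc a j * pr k j.
  by rewrite -sumrN; apply: eq_bigr => j _; rewrite mulrN opprK.
apply: sum_subset_le => // [j jT|j /andP[sj nj]].
  by rewrite sT //; apply: contraNneq kT => <-.
by apply: mulr_ge0_le0; rewrite ?cc_ge0 // (@pr_simple _ B) // eq_sym.
Qed.

(** Maximize the sum of coroot coefficients among the positive roots above [a0]; a negative pairing
    would allow a reflection that increases it. *)
Lemma dominant_above a0 : pos a0 -> exists a, [/\ pos a,
  forall j, j \in simp -> cc a0 j <= cc a j & forall i, i \in simp -> 0 <= pr i a].
Proof.
move=> pa0; pose P a := pos a && [forall j in simp, cc a0 j <= cc a j].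
have P0 : P a0 by rewrite /P pa0; apply/forall_inP.
pose M a := (\sum_(j in simp) `|cc a j|)%N.
case: (@arg_maxnP _ a0 P M P0) => a /andP[pa /forall_inP ha] mx.
exists a; split => // i si; rewrite leNgt; apply/negP => ia.
have nai : a != i by apply: contraTneq ia => ->; rewrite pairing_diag.
have ps := pos_sref pa si nai.
have : P (sref i a).
  rewrite /P ps; apply/forall_inP => j sj; rewrite cc_sref //.
  by apply: le_trans (ha j sj) _; case: eqVneq => _; lia.
move=> /mx; apply/negP; rewrite -ltnNge /M (bigD1 i) // [ltnRHS](bigD1 i) //.
rewrite [in ltnRHS](eq_bigr (fun j => `|cc a j|%N)); last first.
  by move=> j /andP[sj nj]; rewrite cc_other_sref.
by rewrite ltn_add2r cc_sref // eqxx; have := cc_ge0 hdelta a i; lia.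
Qed.

Lemma nbs_cc_le a i (T : seq I) : pos a -> 0 <= pr i a -> i \in simp -> uniq T ->
  (forall j, j \in T -> j \in nbs i) -> \sum_(j <- T) cc a j <= 2 * cc a i.
Proof.
move=> pa ia si uT hT.
have : pr i a <= 2 * cc a i - \sum_(j <- T) cc a j * - pr i j.
  apply: pr_ub => // [|j /hT/nbsP[]//].
  by apply/negP => /hT/nbsP[_]; rewrite eqxx.
suff : \sum_(j <- T) cc a j <= \sum_(j <- T) cc a j * - pr i j by lia.
rewrite big_seq [leRHS]big_seq; apply: ler_sum => j /hT/(pr_nbs si); have := cc_ge0 hdelta a j; nia.
Qed.

(* Nodes reached by a path c from delta are minuscule in what remains after removing the
   earlier nodes of the path. *)
Lemma path_minuscule (c : nat -> I) n a : c 0%N = delta -> path_in n c ->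
  pos a -> (forall u, (u < n)%N -> cc a (c u) = 0) -> cc a (c n) <= 1.
Proof.
move=> c0; elim: n a => [|n IH] a pc pa a0; first by rewrite c0; apply: cc_delta.
have [cs cn cinj] := pc; rewrite leNgt; apply/negP => h.
have sn : c n \in simp by apply: cs.
have nan : a != c n.
  by apply/eqP => e; have := a0 n (leqnn _); rewrite e cc_simple // eqxx.
have nn : c n.+1 \in nbs (c n) by apply: cn.
have : pr (c n) a <= 2 * cc a (c n) - \sum_(j <- [:: c n.+1]) cc a j * - pr (c n) j.
  have [s1 ne _] := nbsP nn.
  by apply: pr_ub => // [|j]; rewrite inE; [rewrite eq_sym|move=> /eqP->].
rewrite big_seq1 a0 // => h2; have h3 := pr_nbs sn nn.
(* The coefficient at [c n] is zero, so a coefficient of at least 2 at its successor would be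
   carried over by this reflection. *)
have : cc (sref (c n) a) (c n) <= 1.
  apply: IH; [exact: path_in_take pc (leqnSn _)|exact: pos_sref|move=> u un].
  rewrite cc_other_sref ?a0 ?cs //; try lia.
  by apply/eqP => /cinj e; have := e _ _; lia.
rewrite cc_sref // eqxx a0 //; nia.
Qed.

End Minuscule.
End Tools.

(** * The diagram of a minuscule node *)

Definition pathC (u v : nat) : int :=
  if u == v then 2 else if (u == v.+1) || (v == u.+1) then -1 else 0.
(** Node 0 is delta throughout [dynkin_case]. In [typeB] it is the short end, in [typeC] the long
    root is at the far end [n], and in [teeC] the node [n + 1] hangs off node [b] of a path. *)
Definition typeB (u v : nat) : int := if (u == 1%N) && (v == 0%N) then -2 else pathC u v.
Definition typeC n (u v : nat) : int := if (u == n) && (v.+1 == n) then -2 else pathC u v.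
Definition teeC b n (u v : nat) : int :=
  if u == n.+1 then (if v == n.+1 then 2 else if v == b then -1 else 0)
  else if v == n.+1 then (if u == b then -1 else 0) else pathC u v.

(* The preprocessing of lia inspects every hypothesis, which is slow in the contexts below. *)
Ltac clear_non_nat := repeat match goal with H : ?T |- _ =>
  lazymatch type of T with
  | Prop => lazymatch T with
    | is_true (leq _ _) => fail
    | is_true (andb _ _) => fail
    | is_true (orb _ _) => fail
    | is_true (negb (orb _ _)) => fail
    | or _ _ => fail
    | @eq nat _ _ => fail
    | @eq bool _ _ => fail
    | @eq _ ?x _ => lazymatch type of x with nat => fail | _ => clear H end
    | is_true (@eq_op _ ?x _) => lazymatch type of x with nat => fail | _ => clear H end
    | is_true (negb (@eq_op _ ?x _)) => lazymatch type of x with nat => fail | _ => clear H end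
    | _ => clear H
    end
  | _ => fail
  end end.
Ltac nlia := first [solve [clear_non_nat; lia] | lia].
Ltac ifs := repeat (case: ifP => ?); nlia.
Ltac cartan := rewrite /typeB /typeC /teeC /pathC; ifs.

Section Dynkin.
Variables (R : root_datum) (B : base R).
Local Notation I := (rd_index R).
Local Notation pr := (@rd_pairing R).
Local Notation co := (@rd_coroot R).
Local Notation simp := (simples B).
Local Notation pos := (is_positive B).
Local Notation nbs := (nbs B).
Local Notation path_in := (path_in B).
Implicit Types (a i j : I).

(** By the last clause no edge leaves the image of [Y], so a root is supported either inside or
    outside it; see [component]. *)
Definition diagram m (Y : nat -> I) (C : nat -> nat -> int) := [/\
  forall u, (u < m)%N -> Y u \in simp,
  forall u v, (u < m)%N -> (v < m)%N -> Y u = Y v -> u = v,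
  forall u v, (u < m)%N -> (v < m)%N -> pr (Y u) (Y v) = C u v &
  forall u j, (u < m)%N -> j \in nbs (Y u) -> exists2 v, (v < m)%N & j = Y v].

Lemma diagramI m Y C (E : rel nat) : (forall u, (u < m)%N -> Y u \in simp) ->
  (forall u v, (u < m)%N -> (v < m)%N -> Y u = Y v -> u = v) ->
  (forall u j, (u < m)%N -> j \in nbs (Y u) -> exists v, [/\ (v < m)%N, E u v & j = Y v]) ->
  (forall u v, (u < m)%N -> (v < m)%N -> E u v -> pr (Y u) (Y v) = C u v) ->
  (forall u, (u < m)%N -> C u u = 2) ->
  (forall u v, (u < m)%N -> (v < m)%N -> u != v -> ~~ E u v -> C u v = 0) -> diagram m Y C.
Proof.
move=> hs inj hn hE h2 h0; split=> // [u v um vm|u j um /hn[]// v []]; last by exists v.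
have [->|nuv] := eqVneq u v; first by rewrite pairing_diag h2.
have [e|ne] := boolP (E u v); first exact: hE.
rewrite h0 // (@pr_out _ B) ?hs //.
  by apply: contraNneq nuv => /inj->.
by apply/negP => /hn[]// w [wm Ew /inj e]; move: ne; rewrite e ?Ew.
Qed.

Lemma path_far n w u v : path_in n w -> (u.+1 < v)%N -> (v <= n)%N -> pr (w u) (w v) = 0.
Proof.
move=> pw uv vn; have [w1 w2 w3] := pw; rewrite (@pr_out _ B) ?w1 //.
  by apply/eqP => /w3 e; have := e _ _; nlia.
apply/negP => h; apply: (@no_cycle _ B (v - u)%N (fun k => w (u + k)%N)); try nlia.
  by apply: path_in_sub pw _; nlia.
by rewrite addn0 subnKC //; nlia.
Qed.

Lemma path_far' n w u v : path_in n w -> (u.+1 < v)%N -> (v <= n)%N -> pr (w v) (w u) = 0.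
Proof. by move=> pw uv vn; apply/eqP; rewrite pr_eq0 (path_far pw). Qed.

Lemma card_gt3 (A : {set I}) : (3 < #|A|)%N -> exists p q r s,
  [/\ uniq [:: p; q; r; s], p \in A, q \in A, r \in A & s \in A].
Proof.
move=> /card_geqP[T [us sz h]]; case: T us sz h => [|p [|q [|r [|s []]]]] // us _ h; exists p, q, r, s.
by split=> //; apply: h; rewrite !inE eqxx ?orbT.
Qed.

(** Four neighbours would form affine D4. *)
Lemma deg_le3 i : i \in simp -> (#|nbs i| <= 3)%N.
Proof.
move=> si; rewrite leqNgt; apply/negP => /card_gt3[p [q [r [s [us hp hq hr hs]]]]].
apply: (@two_branches _ B 0 (fun=> i) p q r s) => //; move: us; rewrite /= !inE !negb_or.
- by split=> // -[|?] [|?].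
- by case/and4P => /and3P[].
- by case/and4P => _ _ ->.
- by case/and4P => /and3P[_ -> ->] /andP[-> ->].
Qed.

Lemma end_cases n w : path_in n.+1 w -> #|nbs (w n.+1)| != 2%N ->
  nbs (w n.+1) = [set w n] \/ exists p q,
    [/\ p \in nbs (w n.+1), q \in nbs (w n.+1), p != q, p != w n & q != w n].
Proof.
move=> [w1 w2 _] d2; have hn : w n \in nbs (w n.+1) by apply: nbs_sym; [apply: w1|apply: w2].
have := cardsD1 (w n) (nbs (w n.+1)); rewrite hn; case E: #|_ :\ _| => [|[|k]] e.
- by left; have /eqP/cards1P[x ex] := e; move: hn; rewrite ex inE => /eqP->.
- by rewrite e in d2.
have : (1 < #|nbs (w n.+1) :\ w n|)%N by rewrite E.
case/card_gt1P => p [q []]; rewrite !in_setD1 => /andP[np hp] /andP[nq hq] npq.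
by right; exists p, q.
Qed.

Section Minuscule.
Variable delta : I.
Hypothesis hdelta : minuscule B delta.
Local Notation cc := (cc hdelta).

(** The inequalities kept from a dominant coroot, with every edge multiplicity replaced by its lower
    bound 1. *)
Definition dominant (m : I -> int) := [/\ forall i, 0 <= m i, m delta <= 1 &
  forall i (T : seq I), i \in simp -> uniq T -> (forall j, j \in T -> j \in nbs i) ->
    \sum_(j <- T) m j <= 2 * m i].

Lemma dominant_exists a : pos a -> exists2 m, dominant m & forall j, j \in simp -> cc a j <= m j.
Proof.
move=> pa; have [b [pb ab db]] := dominant_above hdelta pa; exists (cc b) => //.
split=> [i||i T si uT hT]; [exact: cc_ge0|exact: cc_delta|].
by apply: nbs_cc_le => //; apply: db.
Qed.

Lemma dominant1 m i j : dominant m -> i \in simp -> j \in nbs i -> m j <= 2 * m i.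
Proof.
move=> [_ _ h] si hj; have := h i [:: j] si isT; rewrite big_seq1; apply.
by move=> k; rewrite inE => /eqP->.
Qed.

Lemma dominant2 m i j k : dominant m -> i \in simp -> j \in nbs i -> k \in nbs i -> j != k ->
  m j + m k <= 2 * m i.
Proof.
move=> [_ _ h] si hj hk njk; have := h i [:: j; k] si; rewrite !big_cons big_nil addr0; apply.
  by rewrite /= inE njk.
by move=> l; rewrite !in_cons in_nil orbF => /orP[] /eqP->.
Qed.

Lemma dominant3 m i j k l : dominant m -> i \in simp -> j \in nbs i -> k \in nbs i -> l \in nbs i ->
  j != k -> j != l -> k != l -> m j + m k + m l <= 2 * m i.
Proof.
move=> [_ _ h] si hj hk hl njk njl nkl; have := h i [:: j; k; l] si.
rewrite !big_cons big_nil addr0 addrA; apply; first by rewrite /= !inE negb_or njk njl nkl.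
by move=> x; rewrite !in_cons in_nil orbF => /or3P[] /eqP->.
Qed.

Lemma dominant_delta : exists2 m, dominant m & m delta = 1.
Proof.
have sd := sdelta hdelta; have [m dm /(_ delta sd)] := dominant_exists (pos_simple sd).
by rewrite cc_simple // eqxx => h; exists m => //; have [_ h1 _] := dm; apply/eqP; rewrite eq_le h1.
Qed.

Lemma dominant_prev m n w k : dominant m -> path_in n w -> (k < n)%N -> 0 < m (w k.+1) -> 0 < m (w k).
Proof.
move=> dm [w1 w2 _] kn h; have := dominant1 dm (w1 k (ltnW kn)) (w2 k kn); nlia.
Qed.

Lemma dominant_next m n w k : dominant m -> path_in n w -> (k < n)%N -> 0 < m (w k) -> 0 < m (w k.+1).
Proof.
move=> dm [w1 w2 _] kn h.
have := dominant1 dm (w1 k.+1 kn) (nbs_sym (w1 k (ltnW kn)) (w2 k kn)); nlia.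
Qed.

Lemma dominant_connected m n w : dominant m -> path_in n w -> w 0%N = delta ->
  forall k, (k <= n)%N -> 0 < m (w k) -> m delta = 1.
Proof.
move=> dm pw w0 k; elim: k => [|k IH] kn h.
  by have [_ h1 _] := dm; rewrite w0 in h; nlia.
by apply: IH (dominant_prev dm pw kn h); apply: ltnW.
Qed.

Lemma dominant_convex m n w k : dominant m -> path_in n w -> (0 < k < n)%N ->
  m (w k.-1) + m (w k.+1) <= 2 * m (w k).
Proof.
move=> dm [w1 w2 w3] /andP[k0 kn]; apply: (dominant2 dm); first by apply: w1; nlia.
- by apply: nbs_sym; [apply: w1|rewrite -[k in w k]prednK //; apply: w2]; nlia.
- exact: w2.
- by apply/eqP => /w3 e; have := e _ _; nlia.
Qed.

Lemma cc_edge i j : i \in simp -> j \in simp -> i != j -> pos (sref i j) /\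
  forall k, k \in simp -> cc (sref i j) k = (k == j)%:Z - pr i j * (k == i)%:Z.
Proof.
move=> si sj nij; have pj := pos_simple sj; split; first by apply: pos_sref; rewrite // eq_sym.
by move=> k sk; rewrite cc_sref // ?cc_simple // eq_sym.
Qed.

(** [path_minuscule] bounds two coefficients at [w u]: reflecting [w u.+1] at [w u] gives
    [- pr (w u) (w u.+1)], and reflecting [w u] at [w u.+1] and then at [w u] gives
    [- 1 - pr (w u.+1) (w u)]. Triple edges are thus excluded. *)
Lemma path_edges n w u : path_in n w -> w 0%N = delta -> (u < n)%N ->
  pr (w u) (w u.+1) = -1 /\ (pr (w u.+1) (w u) = -1 \/ pr (w u.+1) (w u) = -2).
Proof.
move=> pw w0 un; have [w1 w2 w3] := pw; have hn := w2 u un.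
have su := w1 u (ltnW un); have s1 := w1 u.+1 un; have [_ ne _] := nbsP hn.
have h1 := pr_nbs su hn; have h2 := pr_nbs s1 (nbs_sym su hn).
have far v : (v < u)%N -> (w v == w u) = false /\ (w v == w u.+1) = false.
  by move=> vu; split; apply/eqP => /w3 e; have := e _ _; nlia.
have pu := path_in_take pw (ltnW un).
have [pa ca] := cc_edge su s1 (introN eqP (fun e => elimN eqP ne (esym e))).
have := path_minuscule (hdelta := hdelta) w0 pu pa.
rewrite ca // eqxx eq_sym (negbTE ne) => h; have e1 : pr (w u) (w u.+1) = -1.
  suff : 0 - pr (w u) (w u.+1) * 1 <= 1 by nlia.
  apply: h => v vu; rewrite ca; last by apply: w1; nlia.
  by have [-> ->] := far v vu; rewrite mulr0.
split=> //; have [pb cb] := cc_edge s1 su ne.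
have nb : sref (w u.+1) (w u) != w u.
  apply/eqP => e; have := cb _ s1; rewrite e cc_simple // eqxx (negbTE ne); nlia.
have := path_minuscule (hdelta := hdelta) w0 pu (pos_sref pb su nb).
rewrite cc_sref // cb // !eqxx [w u == _]eq_sym (negbTE ne).
have -> : pr (w u) (sref (w u.+1) (w u)) = 2 + pr (w u.+1) (w u).
  rewrite prE co_sref dpDr dpNr dpZr -!prE pairing_diag e1; nlia.
move=> h'; suff : 1 - pr (w u.+1) (w u) * 0 - (2 + pr (w u.+1) (w u)) * 1 <= 1 by nlia.
have sv v : (v < u)%N -> w v \in simp by move=> vu; apply: w1; nlia.
apply: h' => v vu; rewrite cc_sref // ?cb ?sv //.
by have [-> ->] := far v vu; rewrite !mulr0.
Qed.

(* The reflections lead from the second simple coroot of F4 to the highest coroot. *)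
Lemma f4_excluded n w u : path_in n w -> w 0%N = delta -> (u.+2 < n)%N ->
  pr (w u.+2) (w u.+1) = -2 -> pr (w u.+1) (w u) = -1 -> pr (w u.+3) (w u.+2) = -1 -> False.
Proof.
move=> pw w0 un d e1 e2; have [w1 w2 w3] := pw.
pose x := w u; pose y := w u.+1; pose z := w u.+2; pose t := w u.+3.
have sx : x \in simp by apply: w1; nlia.
have sy : y \in simp by apply: w1; nlia.
have sz : z \in simp by apply: w1; nlia.
have st : t \in simp by apply: w1; nlia.
have [xy _] := path_edges pw w0 (ltac:(nlia) : (u < n)%N).
have [yz _] := path_edges pw w0 (ltac:(nlia) : (u.+1 < n)%N).
have [zt _] := path_edges pw w0 (ltac:(nlia) : (u.+2 < n)%N).
have xz : pr x z = 0 by apply: (path_far pw); nlia.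
have xt : pr x t = 0 by apply: (path_far pw); nlia.
have yt : pr y t = 0 by apply: (path_far pw); nlia.
have zx : pr z x = 0 by apply: (path_far' pw); nlia.
have tx : pr t x = 0 by apply: (path_far' pw); nlia.
have ty : pr t y = 0 by apply: (path_far' pw); nlia.
pose V a (g1 g2 g3 g4 : int) := pos a /\ co a = g1 *: co x + g2 *: co y + g3 *: co z + g4 *: co t.
have P a i g1 g2 g3 g4 : V a g1 g2 g3 g4 -> pr i a = g1 * pr i x + g2 * pr i y + g3 * pr i z + g4 * pr i t.
  by case=> _ e; rewrite prE e !dpDr !dpZr.
have S a i c g1 g2 g3 g4 : V a g1 g2 g3 g4 -> i \in simp -> pr i a = c -> c < 0 ->
    pos (sref i a) /\ co (sref i a) = g1 *: co x + g2 *: co y + g3 *: co z + g4 *: co t - c *: co i.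
  move=> [pa ea] si <- h; split; last by rewrite co_sref ea.
  by apply: pos_sref => //; apply: contraTneq h => ->; rewrite pairing_diag.
have sX a g1 g2 g3 g4 (h : V a g1 g2 g3 g4) c : c = 2 * g1 - g2 -> c < 0 -> V (sref x a) (g1 - c) g2 g3 g4.
  move=> hc c0; have [|//|pa ea] := S a x c _ _ _ _ h sx.
    by rewrite (P _ _ _ _ _ _ h) pairing_diag xy xz xt hc; ring.
  split; rewrite // ea scalerBl; do 2!(rewrite [LHS]addrAC; congr (_ + _)); exact: addrAC.
have sY a g1 g2 g3 g4 (h : V a g1 g2 g3 g4) c : c = 2 * g2 - g1 - g3 -> c < 0 -> V (sref y a) g1 (g2 - c) g3 g4.
  move=> hc c0; have [|//|pa ea] := S a y c _ _ _ _ h sy.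
    by rewrite (P _ _ _ _ _ _ h) pairing_diag e1 yz yt hc; ring.
  split; rewrite // ea scalerBl addrA; rewrite [LHS]addrAC; congr (_ + _); exact: addrAC.
have sZ a g1 g2 g3 g4 (h : V a g1 g2 g3 g4) c : c = 2 * g3 - 2 * g2 - g4 -> c < 0 -> V (sref z a) g1 g2 (g3 - c) g4.
  move=> hc c0; have [|//|pa ea] := S a z c _ _ _ _ h sz.
    by rewrite (P _ _ _ _ _ _ h) pairing_diag d zt zx hc; ring.
  split; rewrite // ea scalerBl addrA; exact: addrAC.
have sT a g1 g2 g3 g4 (h : V a g1 g2 g3 g4) c : c = 2 * g4 - g3 -> c < 0 -> V (sref t a) g1 g2 g3 (g4 - c).
  move=> hc c0; have [|//|pa ea] := S a t c _ _ _ _ h st.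
    by rewrite (P _ _ _ _ _ _ h) pairing_diag e2 tx ty hc; ring.
  by split; rewrite // ea scalerBl addrA.
have V0 : V y 0 1 0 0.
  by split; [exact: pos_simple|rewrite !scale0r scale1r add0r !addr0].
have V1 : V _ 0 1 2 0 := sZ _ _ _ _ _ V0 (-2) erefl isT.
have V2 : V _ 0 1 2 2 := sT _ _ _ _ _ V1 (-2) erefl isT.
have V3 : V _ 1 1 2 2 := sX _ _ _ _ _ V2 (-1) erefl isT.
have V4 : V _ 1 2 2 2 := sY _ _ _ _ _ V3 (-1) erefl isT.
have V5 : V _ 1 2 4 2 := sZ _ _ _ _ _ V4 (-2) erefl isT.
have V6 : V _ 1 3 4 2 := sY _ _ _ _ _ V5 (-1) erefl isT.
have [pa ea] : V _ 2 3 4 2 := sX _ _ _ _ _ V6 (-1) erefl isT.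
move: (sref x _) pa ea => a pa ea.
have ca : forall k, k \in simp -> cc a k = 0 + 2 * (k == x)%:Z + 3 * (k == y)%:Z + 4 * (k == z)%:Z + 2 * (k == t)%:Z.
  apply: (cc_uniq hdelta (m := fun k => 0 + 2 * (k == x)%:Z + 3 * (k == y)%:Z + 4 * (k == z)%:Z + 2 * (k == t)%:Z) pa).
  by rewrite !delta_sum // big1 ?add0r // => k _; rewrite scale0r.
have ne v v' : (v <= n)%N -> (v' <= n)%N -> v != v' -> (w v == w v') = false.
  by move=> h h' nv; apply/eqP => /w3 e; move: nv; rewrite e ?eqxx.
have un' : (u <= n)%N by nlia.
have := path_minuscule (hdelta := hdelta) w0 (path_in_take pw un') pa.
rewrite ca // eqxx !ne ?addr0; try nlia.
move=> h; suff : 0 + 2 * true%:Z + 3 * false%:Z + 4 * false%:Z + 2 * false%:Z <= 1 :> int by [].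
by apply: h => v vu; rewrite ca ?w1 ?ne; nlia.
Qed.

(** The other two neighbours of [z] already form one end of an affine diagram, which a second branch
    or a multiple edge along the arm would complete. *)
Lemma arm_exists z p o1 o2 : z \in simp -> p \in nbs z -> o1 \in nbs z -> o2 \in nbs z ->
  p != o1 -> p != o2 -> o1 != o2 -> exists n w, [/\ path_in n.+1 w, w 0%N = z /\ w 1%N = p,
    forall k, (k < n)%N -> nbs (w k.+1) = [set w k; w k.+2], nbs (w n.+1) = [set w n] &
    forall k, (k <= n)%N -> pr (w k) (w k.+1) = -1 /\ pr (w k.+1) (w k) = -1].
Proof.
move=> sz hp h1 h2 n1 n2 n12; have [n [w [pw [w0 w1p] hw d2]]] := walk_exists sz hp.
have [w1 w2 w3] := pw; exists n, w; split=> //.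
- case: (end_cases pw d2) => // -[p' [q' [hp' hq' npq np' nq']]]; exfalso.
  apply: (two_branches pw _ _ hp' hq' n12 npq); rewrite ?w0 //= ?w1p.
  + by rewrite ![_ == p]eq_sym n1 n2.
  + by rewrite np' nq'.
- move=> k kn; have sk := w1 k (leqW kn); have hk := w2 k kn.
  have [s1 _ _] := nbsP hk.
  have := pr_nbs sk hk; have := pr_nbs s1 (nbs_sym sk hk).
  have [dbl|] := boolP ((pr (w k.+1) (w k) <= -2) || (pr (w k) (w k.+1) <= -2)); last by nlia.
  exfalso; have pr' := path_in_rev (path_in_take pw (leqW kn)).
  apply: (double_branch pr' (h := w k.+1) _ _ _ _ n12); rewrite ?subn0 ?subnn ?w0 //.
  + by move=> k0; apply/eqP => /w3 e; have := e _ _; nlia.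
  + by move=> k0; rewrite (_ : k - k.-1 = 1)%N ?w1p ?[_ == p]eq_sym ?n1 ?n2 //; nlia.
  + by move=> ->; rewrite w1p ![_ == p]eq_sym n1 n2.
Qed.

Lemma path_diagram n Y (C : nat -> nat -> int) : path_in n Y ->
  (forall u j, (u <= n)%N -> j \in nbs (Y u) -> exists v,
    [/\ (v <= n)%N, (u == v.+1) || (v == u.+1) & j = Y v]) ->
  (forall u, (u < n)%N -> pr (Y u) (Y u.+1) = C u u.+1 /\ pr (Y u.+1) (Y u) = C u.+1 u) ->
  (forall u, (u <= n)%N -> C u u = 2) ->
  (forall u v, (u <= n)%N -> (v <= n)%N -> u != v -> ~~ ((u == v.+1) || (v == u.+1)) -> C u v = 0) ->
  diagram n.+1 Y C.
Proof.
move=> [y1 y2 y3] hn he h2 h0; apply: (@diagramI _ _ _ (fun u v => (u == v.+1) || (v == u.+1))) => //.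
move=> u v un vn /orP[] /eqP e.
  by rewrite e; have [] := he v; [nlia|].
by rewrite e; have [] := he u; [nlia|].
Qed.

Lemma path_nbs n w : path_in n.+1 w -> nbs (w 0%N) = [set w 1%N] ->
  (forall k, (k < n)%N -> nbs (w k.+1) = [set w k; w k.+2]) -> nbs (w n.+1) = [set w n] ->
  forall u j, (u <= n.+1)%N -> j \in nbs (w u) -> exists v,
    [/\ (v <= n.+1)%N, (u == v.+1) || (v == u.+1) & j = w v].
Proof.
move=> _ h0 hm hN [|u] j un.
  by rewrite h0 inE => /eqP->; exists 1%N.
have [->|lu] : u = n \/ (u < n)%N by nlia.
  by rewrite hN inE => /eqP->; exists n; rewrite eqxx.
rewrite hm // in_set2 => /orP[] /eqP->; [exists u|exists u.+2]; split; rewrite ?eqxx ?orbT //; nlia.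
Qed.

Definition dynkin_case := exists n Y, Y 0%N = delta /\
  [\/ (0 < n)%N /\ diagram n.+1 Y typeB, (0 < n)%N /\ diagram n.+1 Y (typeC n) |
   exists b, diagram n.+2 Y (teeC b n) /\
    [\/ b = 1%N /\ (1 < n)%N, (0 < b)%N /\ n = b.+1, b = 2%N /\ n = 4%N | b = 3%N /\ n = 5%N]].

Definition line_case := exists n p Y, [/\ (p <= n)%N, diagram n.+1 Y pathC & Y p = delta].

(** Two double edges would span an affine diagram. A single one gives type B at the end of delta,
    type C at the far end, and falls to [f4_excluded] strictly inside. *)
Lemma dynkin_path n w : path_in n.+1 w -> w 0%N = delta -> nbs delta = [set w 1%N] ->
  (forall k, (k < n)%N -> nbs (w k.+1) = [set w k; w k.+2]) -> nbs (w n.+1) = [set w n] ->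
  dynkin_case \/ line_case.
Proof.
move=> pw w0 h0 hm hN; rewrite -w0 in h0; have cl := path_nbs pw h0 hm hN.
have ed u : (u < n.+1)%N -> pr (w u) (w u.+1) = -1 /\ (pr (w u.+1) (w u) = -1 \/ pr (w u.+1) (w u) = -2).
  exact: path_edges.
have [w1 w2 w3] := pw.
have [/existsP[u /eqP du]|/existsPn nd] := boolP [exists u : 'I_n.+1, pr (w u.+1) (w u) == -2].
  have un := ltn_ord u.
  have uniq_dbl (v v' : nat) : (v < v')%N -> (v' < n.+1)%N -> pr (w v.+1) (w v) = -2 -> pr (w v'.+1) (w v') = -2 -> False.
    move=> vv vn d1 d2; have pv : path_in (v' - v.+1) (fun k => w (v.+1 + k)%N).
      by apply: path_in_sub pw _; nlia.
    apply: (two_doubles pv (h := w v) (h' := w v'.+1)); rewrite ?addn0 ?subnKC ?d1 ?d2 //.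
    - by apply: nbs_sym; [apply: w1|apply: w2]; nlia.
    - by apply: w2.
    - by rewrite orbT.
    - by move=> _; apply/eqP => /w3 e; have := e _ _; nlia.
    - by move=> _; apply/eqP => /w3 e; have := e _ _; nlia.
    - by move=> _; apply/eqP => /w3 e; have := e _ _; nlia.
  have sd v : (v < n.+1)%N -> v != u :> nat -> pr (w v.+1) (w v) = -1.
    move=> vn nv; have [_ []] := ed v vn => // dv; exfalso.
    have [vu|vu] : (v < u)%N \/ (u < v)%N by nlia.
      exact: (uniq_dbl v u).
    exact: (uniq_dbl u v).
  have [u0|u0] := posnP u.
    left; exists n.+1, w; split=> //; apply: Or31; split=> //.
    apply: path_diagram => // [v vn|v vn|v v' vn vn' nv nE].
    - have [e _] := ed v vn; rewrite e; split; first by cartan.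
      case: (eqVneq v 0%N) => [v0|v0]; first by rewrite v0; move: du; rewrite u0 => ->.
      by rewrite sd ?u0 //; cartan.
    - by cartan.
    - by cartan.
  have [e|lu] : (u : nat) = n \/ (u < n)%N by nlia.
    left; exists n.+1, w; split=> //; apply: Or32; split=> //.
    apply: path_diagram => // [v vn|v vn|v v' vn vn' nv nE].
    - have [e1 _] := ed v vn; rewrite e1; split; first by cartan.
      case: (eqVneq v n) => [v0|v0]; first by rewrite v0 -e du e; cartan.
      by rewrite sd ?e //; cartan.
    - by cartan.
    - by cartan.
  exfalso; have eu : (u.-1.+1 = u)%N by nlia.
  have d1 := sd u.-1 (ltac:(nlia)) (ltac:(nlia)); rewrite eu in d1.
  have d2 := sd u.+1 (ltac:(nlia)) (ltac:(nlia)).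
  by apply: (@f4_excluded n.+1 w u.-1) => //; rewrite eu.
right; exists n.+1, 0%N, w; split=> //; apply: path_diagram => // [v vn|v vn|v v' vn vn' nv nE].
- have [e1 e2] := ed v vn; have := nd (Ordinal vn); rewrite /= => d.
  have -> : pr (w v.+1) (w v) = -1 by case: e2 => // e2; rewrite e2 in d.
  by rewrite e1; split; cartan.
- by cartan.
- by cartan.
Qed.

Lemma line_of_arms r s (u v : nat -> I) : path_in r u -> path_in s v -> u 0%N = delta -> v 0%N = delta ->
  u 1%N != v 1%N -> (0 < r)%N -> (0 < s)%N ->
  (forall j, j \in nbs delta -> j = u 1%N \/ j = v 1%N) ->
  (forall k, (0 < k < r)%N -> nbs (u k) = [set u k.-1; u k.+1]) -> nbs (u r) = [set u r.-1] ->
  (forall k, (0 < k < s)%N -> nbs (v k) = [set v k.-1; v k.+1]) -> nbs (v s) = [set v s.-1] ->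
  (forall k, (k < r)%N -> pr (u k) (u k.+1) = -1 /\ pr (u k.+1) (u k) = -1) ->
  (forall k, (k < s)%N -> pr (v k) (v k.+1) = -1 /\ pr (v k.+1) (v k) = -1) -> line_case.
Proof.
move=> pu pv u0 v0 n1 r0 s0 hd hu hr hv hs eu ev.
have D := arms_disjoint pu pv (etrans u0 (esym v0)) n1.
have [u1 u2 u3] := pu; have [v1 v2 v3] := pv.
pose Y k := if (k <= r)%N then u (r - k)%N else v (k - r)%N.
have pY : path_in (r + s) Y.
  split=> [k kn|k kn|k l kn ln]; rewrite /Y.
  - by case: leqP => ?; [apply: u1|apply: v1]; nlia.
  - have [kr|[kr|kr]] : (k < r)%N \/ k = r \/ (r < k)%N by nlia.
    + rewrite kr ltnW //; apply: nbs_sym; first by apply: u1; nlia.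
      by rewrite (_ : r - k = (r - k.+1).+1)%N; [apply: u2|]; nlia.
    + by rewrite kr leqnn ltnn subnn subSnn u0 -v0; apply: v2.
    + by rewrite ifF ?ifF ?subSn; [apply: v2|..]; nlia.
  - case: leqP => h; case: leqP => h' e.
    + by have := u3 _ _ _ _ e; nlia.
    + have [rk|rk] := posnP (r - k); last by case: (D _ _ _ _ _ e); nlia.
      by rewrite rk u0 -v0 in e; have := v3 _ _ _ _ e; nlia.
    + have [rk|rk] := posnP (r - l); last by case: (D _ _ _ _ _ (esym e)); nlia.
      by rewrite rk u0 -v0 in e; have := v3 _ _ _ _ e; nlia.
    + by have := v3 _ _ _ _ e; nlia.
exists (r + s)%N, r, Y; split; first by nlia.
  apply: path_diagram => // [k j kn|k kn|k kn|k l kn ln nkl nE].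
  - have Yu l : (l <= r)%N -> u l = Y (r - l)%N by move=> lr; rewrite /Y ifT ?subKn //; nlia.
    have Yv l : v l = Y (r + l)%N.
      rewrite /Y; case: (posnP l) => [->|l0]; first by rewrite addn0 leqnn subnn v0 u0.
      by rewrite ifF ?addKn //; nlia.
    have [kr|[kr|kr]] : (k < r)%N \/ k = r \/ (r < k)%N by nlia.
    + rewrite {1}/Y ltnW //; have [k0|k0] := posnP k.
        rewrite k0 subn0 hr inE => /eqP->; rewrite Yu; last by nlia.
        by exists (r - r.-1)%N; split=> //; nlia.
      rewrite hu; last by nlia.
      rewrite in_set2 => /orP[] /eqP->; rewrite Yu; try nlia.
        by exists (r - (r - k).-1)%N; split=> //; nlia.
      by exists (r - (r - k).+1)%N; split=> //; nlia.
    + rewrite kr {1}/Y leqnn subnn u0 => /hd[] ->; [rewrite Yu //|rewrite Yv].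
        by exists (r - 1)%N; split=> //; nlia.
      by exists (r + 1)%N; split=> //; nlia.
    + rewrite {1}/Y ifF; last by nlia.
      have [ks|ks] : (k - r = s)%N \/ (k - r < s)%N by nlia.
        rewrite ks hs inE => /eqP->; rewrite Yv.
        by exists (r + s.-1)%N; split=> //; nlia.
      rewrite hv; last by nlia.
      rewrite in_set2 => /orP[] /eqP->; rewrite Yv.
        by exists (r + (k - r).-1)%N; split=> //; nlia.
      by exists (r + (k - r).+1)%N; split=> //; nlia.
  - have -> : pathC k k.+1 = -1 by cartan.
    have -> : pathC k.+1 k = -1 by cartan.
    rewrite /Y; have [kr|[kr|kr]] : (k < r)%N \/ k = r \/ (r < k)%N by nlia.
    + rewrite kr ltnW //; have [e1 e2] := eu (r - k.+1)%N (ltac:(nlia)).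
      by rewrite (_ : r - k = (r - k.+1).+1)%N //; nlia.
    + by rewrite kr leqnn ltnn subnn subSnn u0 -v0; apply: ev.
    + by rewrite ifF ?ifF ?subSn; [apply: ev|..]; nlia.
  - by cartan.
  - by cartan.
by rewrite /Y leqnn subnn.
Qed.

(** The coefficients are concave along the path: once they fail to increase they never do, and
    positivity keeps them at 1. *)
Lemma dominant_ones m n w : dominant m -> path_in n w -> w 0%N = delta -> m delta = 1 ->
  m (w 1%N) <= 1 -> forall k, (k <= n)%N -> m (w k) = 1.
Proof.
move=> dm pw w0 m0 m1 k; have P l : (l <= n)%N -> 0 < m (w l).
  elim: l => [|l IH] ln; first by rewrite w0 m0.
  exact: dominant_next dm pw ln (IH (ltnW ln)).
have [K] := ubnP k; elim: K k => // K IH [|[|k]] kK kn; first by rewrite w0.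
  by have := P 1%N kn; nlia.
have := dominant_convex dm pw (kn : (0 < k.+1 < n)%N).
rewrite /= (IH k) ?(IH k.+1); try nlia.
by have := P _ kn; nlia.
Qed.

(** A dominant coroot with coefficient 1 at delta has coefficient 1 on both neighbours, hence on
    both arms. A branch would then have three positive neighbours summing to at most 2, and a
    multiple edge would give a coefficient of at least 2. *)
Lemma dynkin_middle x1 x2 : nbs delta = [set x1; x2] -> x1 != x2 -> line_case.
Proof.
move=> hd n12; have sd := sdelta hdelta.
have h1 : x1 \in nbs delta by rewrite hd set21.
have h2 : x2 \in nbs delta by rewrite hd set22.
have [r [u [pu [u0 ux] hu du]]] := walk_exists sd h1.
have [s [v [pv [v0 vx] hv dv]]] := walk_exists sd h2.
have ones m : dominant m -> m delta = 1 ->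
    (forall k, (k <= r.+1)%N -> m (u k) = 1) /\ (forall k, (k <= s.+1)%N -> m (v k) = 1).
  move=> dm m1; have := dominant2 dm sd h1 h2 n12; rewrite m1.
  have [s1 _ _] := nbsP h1; have [s2 _ _] := nbsP h2.
  have := dominant1 dm s1 (nbs_sym sd h1).
  have := dominant1 dm s2 (nbs_sym sd h2).
  rewrite m1 => a1 a2 a3.
  by split; apply: dominant_ones; rewrite ?ux ?vx //; nlia.
have arm t w : path_in t.+1 w -> w 0%N = delta -> #|nbs (w t.+1)| != 2%N ->
    (forall m, dominant m -> m delta = 1 -> forall k, (k <= t.+1)%N -> m (w k) = 1) ->
    nbs (w t.+1) = [set w t] /\
    forall k, (k < t.+1)%N -> pr (w k) (w k.+1) = -1 /\ pr (w k.+1) (w k) = -1.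
  move=> pw w0 dw hm; have [w1 w2 w3] := pw; split.
    case: (end_cases pw dw) => // -[p [q [hp hq npq np nq]]]; exfalso.
    have [m dm m1] := dominant_delta; have mt := hm m dm m1.
    have st := w1 _ (leqnn t.+1).
    have hn : w t \in nbs (w t.+1) by apply: nbs_sym; [apply: w1|apply: w2].
    have := dominant3 dm st hn hp hq; rewrite ![w t == _]eq_sym np nq npq => /(_ isT isT isT).
    have [sp _ _] := nbsP hp; have [sq _ _] := nbsP hq.
    have := dominant1 dm sp (nbs_sym st hp); have := dominant1 dm sq (nbs_sym st hq).
    have mt1 := mt _ (leqnn t.+1); have mt0 := mt t (leqnSn t); rewrite mt1 mt0; clear; nlia.
  have dom2 i j (k : nat) : i \in simp -> j \in simp -> i != j -> (k <= t.+1)%N -> w k = i -> - pr i j <= 1.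
    move=> si sj nij kt ei; have [pa ca] := cc_edge si sj nij.
    have [m dm /(_ i si)] := dominant_exists pa.
    rewrite ca // eqxx (negbTE nij) => h; have [pij|pij] := lerP 0 (pr i j); first by nlia.
    have mi : 0 < m (w k) by rewrite ei; nlia.
    have m1 := dominant_connected dm pw w0 kt mi.
    by have := hm m dm m1 k kt; rewrite ei; nlia.
  move=> k kt; have hk := w2 k kt; have [s1 nk _] := nbsP hk; have s0 := w1 k (ltnW kt).
  have := pr_nbs s0 hk; have := pr_nbs s1 (nbs_sym s0 hk).
  have := dom2 _ _ k s0 s1 _ (ltnW kt) erefl; have := dom2 _ _ k.+1 s1 s0 nk kt erefl.
  by rewrite eq_sym => a1 /(_ nk); nlia.
have [uN ue] := arm r u pu u0 du (fun m dm m1 => proj1 (ones m dm m1)).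
have [vN ve] := arm s v pv v0 dv (fun m dm m1 => proj2 (ones m dm m1)).
apply: (line_of_arms pu pv) => //; rewrite ?ux ?vx //.
- by move=> j; rewrite hd in_set2 => /orP[] /eqP; [left|right].
- by case=> // k kr; apply: hu; nlia.
- by case=> // k kr; apply: hv; nlia.
Qed.

(** [b] is the length of the arm ending at delta. Long arms contain an affine diagram of type E; the
    remaining cases contradict the inequalities for a dominant coroot with coefficient 1 at
    delta. *)
Lemma tee_shape b r s (x u v : nat -> I) : path_in b x -> path_in r u -> path_in s v ->
  x 0%N = u 0%N -> x 0%N = v 0%N -> x 1%N != u 1%N -> x 1%N != v 1%N -> u 1%N != v 1%N ->
  (0 < b)%N -> (0 < r <= s)%N -> x b = delta ->
  [\/ r = 1%N /\ s = 1%N, b = 1%N /\ r = 1%N, [/\ r = 1%N, s = 2%N & b = 2%N] |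
      [/\ r = 1%N, s = 2%N & b = 3%N]].
Proof.
move=> px pu pv exu exv nxu nxv nuv b0 /andP[r0 rs] xb.
have [m dm m1] := dominant_delta; rewrite -xb in m1.
have [x1 x2 x3] := px; have [u1 u2 _] := pu; have [v1 v2 _] := pv.
have m0 i : 0 <= m i by case: dm.
have C : m (x 1%N) + m (u 1%N) + m (v 1%N) <= 2 * m (x 0%N).
  apply: (dominant3 dm) => //; [exact: x1|exact: x2|rewrite exu|rewrite exv]; [apply: u2|apply: v2]; nlia.
have F n w k : path_in n w -> (k < n)%N -> m (w k) <= 2 * m (w k.+1).
  by move=> [w1 w2 _] kn; apply: (dominant1 dm); [apply: w1|apply: nbs_sym; [apply: w1; nlia|apply: w2]].
have G n w k : path_in n w -> (k.+1 < n)%N -> m (w k) + m (w k.+2) <= 2 * m (w k.+1).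
  by move=> pw kn; have := dominant_convex dm pw (kn : (0 < k.+1 < n)%N).
have H n w k : path_in n w -> (k < n)%N -> m (w k.+1) <= 2 * m (w k).
  by move=> [w1 w2 _] kn; apply: (dominant1 dm); [apply: w1; nlia|apply: w2].
have [r1|r2] : r = 1%N \/ (1 < r)%N by nlia.
  have [b1|b1] : b = 1%N \/ (1 < b)%N by nlia.
    by apply: Or42.
  have [s1|[s2|s3]] : s = 1%N \/ s = 2%N \/ (2 < s)%N by nlia.
  - by apply: Or41.
  - have [b2|[b3|[b4|b5]]] : b = 2%N \/ b = 3%N \/ b = 4%N \/ (4 < b)%N by nlia.
    + by apply: Or43.
    + by apply: Or44.
    (* The diagram E8 with delta at the end of its longest arm. *)
    + exfalso; subst b s r.
      have := H _ _ 3%N px isT; have := F _ _ 3%N px isT; have := G _ _ 2%N px isT.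
      have := G _ _ 1%N px isT; have := G _ _ 0%N px isT.
      have := F _ _ 0%N pu isT; have := G _ _ 0%N pv isT; have := F _ _ 1%N pv isT.
      rewrite -exu -exv m1; nlia.
    (* Affine E8; the decrements 1, 3, 2 are 6 divided by the arm lengths plus one. *)
    + exfalso; apply: (@tee_affine _ B 5 1 2 x u v 1 3 2 6) => //; last by rewrite -s2.
        exact: path_in_take px _.
      by rewrite -r1.
  - have [b2|b3] : b = 2%N \/ (2 < b)%N by nlia.
      exfalso; subst b r.
      have := H _ _ 1%N px isT; have := F _ _ 1%N px isT; have := G _ _ 0%N px isT.
      have := F _ _ 0%N pu isT; have := G _ _ 0%N pv (ltnW s3); have := G _ _ 1%N pv s3.
      have := F _ _ 2%N pv s3; rewrite -exu -exv m1; nlia.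
    (* Affine E7. *)
    exfalso; apply: (@tee_affine _ B 3 1 3 x u v 1 2 1 4) => //; [|by rewrite -r1|].
      exact: path_in_take px _.
    exact: path_in_take pv _.
have s2 : (1 < s)%N by nlia.
have [b1|b2] : b = 1%N \/ (1 < b)%N by nlia.
  exfalso; subst b.
  have := H _ _ 0%N px isT; have := F _ _ 0%N px isT.
  have := F _ _ 1%N pu r2; have := G _ _ 0%N pu r2.
  have := F _ _ 1%N pv s2; have := G _ _ 0%N pv s2; rewrite -exu -exv m1; nlia.
(* Affine E6. *)
exfalso; apply: (@tee_affine _ B 2 2 2 x u v 1 1 1 3) => //.
- exact: path_in_take px _.
- exact: path_in_take pu _.
- exact: path_in_take pv _.
Qed.

Lemma tee_diagram b s (x v : nat -> I) e : path_in b x -> path_in s v -> x 0%N = v 0%N -> x 1%N != v 1%N ->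
  e \in nbs (x 0%N) -> (forall j, j \in nbs (x 0%N) -> [\/ j = x 1%N, j = v 1%N | j = e]) ->
  (forall k, (k <= b)%N -> e != x k) -> (forall k, (k <= s)%N -> e != v k) -> (0 < b)%N -> (0 < s)%N ->
  (forall k, (0 < k < b)%N -> nbs (x k) = [set x k.-1; x k.+1]) -> nbs (x b) = [set x b.-1] ->
  (forall k, (0 < k < s)%N -> nbs (v k) = [set v k.-1; v k.+1]) -> nbs (v s) = [set v s.-1] ->
  nbs e = [set x 0%N] ->
  (forall k, (k < b)%N -> pr (x k) (x k.+1) = -1 /\ pr (x k.+1) (x k) = -1) ->
  (forall k, (k < s)%N -> pr (v k) (v k.+1) = -1 /\ pr (v k.+1) (v k) = -1) ->
  pr (x 0%N) e = -1 -> pr e (x 0%N) = -1 ->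
  exists Y, Y 0%N = x b /\ diagram (b + s).+2 Y (teeC b (b + s)).
Proof.
move=> px pv e0 n1 he hz ex ev b0 s0 hx hb hv hs hne ox ov oe1 oe2.
have D := arms_disjoint px pv e0 n1.
have [x1 x2 x3] := px; have [v1 v2 v3] := pv.
pose Y k := if (k <= b)%N then x (b - k)%N else if (k <= b + s)%N then v (k - b)%N else e.
have Yx l : (l <= b)%N -> x l = Y (b - l)%N by move=> lb; rewrite /Y ifT ?subKn //; nlia.
have Yv l : (l <= s)%N -> v l = Y (b + l)%N.
  move=> ls; rewrite /Y; case: (posnP l) => [->|l0]; first by rewrite addn0 leqnn subnn.
  by rewrite ifF ?ifT ?addKn //; nlia.
have Ye : Y (b + s).+1 = e by rewrite /Y ifF ?ifF //; nlia.
pose E k l := if k == (b + s).+1 then l == b else if l == (b + s).+1 then k == b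
  else (k == l.+1) || (l == k.+1).
exists Y; split; first by rewrite /Y leq0n subn0.
apply: (@diagramI _ _ _ E) => [k kn|k l kn ln|k j kn|k l kn ln|k kn|k l kn ln nkl].
- rewrite /Y; case: leqP => ?; [apply: x1; nlia|case: leqP => ?; [apply: v1; nlia|]].
  by have [] := nbsP he.
- rewrite /Y; have [kb|kb] := leqP k b; have [lb|lb] := leqP l b.
  + by move=> /x3; nlia.
  + have [ls|ls] := leqP l (b + s) => h; last by have := ex (b - k)%N; rewrite h eqxx; nlia.
    have [k0|k0] := posnP (b - k); last by case: (D _ _ _ _ _ h); nlia.
    by rewrite k0 e0 in h; have := v3 _ _ _ _ h; nlia.
  + have [ls|ls] := leqP k (b + s) => h; last by have := ex (b - l)%N; rewrite -h eqxx; nlia.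
    have [k0|k0] := posnP (b - l); last by case: (D _ _ _ _ _ (esym h)); nlia.
    by rewrite k0 e0 in h; have := v3 _ _ _ _ h; nlia.
  + have [ks|ks] := leqP k (b + s); have [ls|ls] := leqP l (b + s) => h; try nlia.
    * by have := v3 _ _ _ _ h; nlia.
    * by have := ev (k - b)%N; rewrite h eqxx; nlia.
    * by have := ev (l - b)%N; rewrite -h eqxx; nlia.
- have [->|ke] := eqVneq k (b + s).+1.
    by rewrite Ye hne inE => /eqP->; rewrite Yx // subn0; exists b; split=> //; rewrite /E; ifs.
  have [kb|[kb|kb]] : (k < b)%N \/ k = b \/ (b < k)%N by nlia.
  + rewrite {1}/Y ltnW //; have [k0|k0] := posnP k.
      rewrite k0 subn0 hb inE => /eqP->; rewrite Yx; last by nlia.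
      by exists (b - b.-1)%N; split=> //; rewrite /E; ifs.
    rewrite hx; last by nlia.
    rewrite in_set2 => /orP[] /eqP->; rewrite Yx; try nlia.
      by exists (b - (b - k).-1)%N; split=> //; rewrite /E; ifs.
    by exists (b - (b - k).+1)%N; split=> //; rewrite /E; ifs.
  + rewrite kb {1}/Y leqnn subnn => /hz[] ->; [rewrite Yx //|rewrite Yv //|rewrite -Ye].
    * by exists (b - 1)%N; split=> //; rewrite /E; ifs.
    * by exists (b + 1)%N; split=> //; rewrite /E; ifs.
    * by exists (b + s).+1; split=> //; rewrite /E; ifs.
  + have kl : (k <= b + s)%N by nlia.
    rewrite {1}/Y ifF ?kl; last by nlia.
    have [ks|ks] : (k - b = s)%N \/ (k - b < s)%N by nlia.
      rewrite ks hs inE => /eqP->; rewrite Yv; last by nlia.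
      by exists (b + s.-1)%N; split=> //; rewrite /E; ifs.
    rewrite hv; last by nlia.
    rewrite in_set2 => /orP[] /eqP->; rewrite Yv; try nlia.
      by exists (b + (k - b).-1)%N; split=> //; rewrite /E; ifs.
    by exists (b + (k - b).+1)%N; split=> //; rewrite /E; ifs.
- have step m : (m < b + s)%N -> pr (Y m) (Y m.+1) = -1 /\ pr (Y m.+1) (Y m) = -1.
    move=> ms; rewrite /Y; have [kr|[kr|kr]] : (m < b)%N \/ m = b \/ (b < m)%N by nlia.
    + rewrite kr ltnW //; have [e1 e2] := ox (b - m.+1)%N (ltac:(nlia)).
      by rewrite (_ : b - m = (b - m.+1).+1)%N //; nlia.
    + rewrite kr leqnn ltnn subnn subSnn e0 ifT; last by nlia.
      exact: ov.
    + rewrite ifF; last by nlia.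
      rewrite ifT; last by nlia.
      rewrite ifF; last by nlia.
      by rewrite ifT ?subSn; [apply: ov|..]; nlia.
  have Yb : Y b = x 0%N by rewrite /Y leqnn subnn.
  rewrite /E; case: (eqVneq k (b + s).+1) => [->|kn'].
    by move=> /eqP->; rewrite Ye Yb oe2; cartan.
  case: (eqVneq l (b + s).+1) => [->|ln'].
    by move=> /eqP->; rewrite Ye Yb oe1; cartan.
  move=> /orP[] /eqP e1; rewrite e1.
    by have [_ ->] := step l (ltac:(nlia)); cartan.
  by have [-> _] := step k (ltac:(nlia)); cartan.
- by cartan.
- by rewrite /E; cartan.
Qed.

Lemma dynkin_tee n w : path_in n.+1 w -> w 0%N = delta -> nbs delta = [set w 1%N] ->
  (forall k, (k < n)%N -> nbs (w k.+1) = [set w k; w k.+2]) -> forall p q,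
  nbs (w n.+1) = [set w n; p; q] -> p != q -> p != w n -> q != w n -> dynkin_case.
Proof.
move=> pw w0 h0 hm p q hz npq np nq; have [w1 w2 w3] := pw.
have sz : w n.+1 \in simp by apply: w1.
have hp : p \in nbs (w n.+1) by rewrite hz !in_setU !in_set1 eqxx orbT.
have hq : q \in nbs (w n.+1) by rewrite hz !in_setU !in_set1 eqxx !orbT.
have hn : w n \in nbs (w n.+1) by rewrite hz !in_setU !in_set1 eqxx.
have ew k : (k < n.+1)%N -> pr (w k) (w k.+1) = -1 /\ pr (w k.+1) (w k) = -1.
  move=> kn; have [e1 [e2 //|e2]] := path_edges pw w0 kn; exfalso.
  have pk : path_in (n.+1 - k.+1) (fun l => w (k.+1 + l)%N) by apply: path_in_sub pw _; nlia.
  apply: (double_branch pk (h := w k) (p := p) (q := q)); rewrite ?addn0 ?e2 ?subnKC //.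
  - by apply: nbs_sym; [apply: w1|apply: w2]; nlia.
  - by rewrite orbT.
  - by move=> k0; apply/eqP => /w3 e; have := e _ _; nlia.
  - by move=> k0; rewrite (_ : k.+1 + _ = n)%N ?np ?nq //; nlia.
  - by move=> k0; rewrite (_ : k = n) ?np ?nq //; nlia.
have nnp : w n != p by rewrite eq_sym.
have nnq : w n != q by rewrite eq_sym.
have [r [u [pu [u0 up] hu ur eu]]] := arm_exists sz hp hn hq np npq nnq.
have nqp : q != p by rewrite eq_sym.
have [s [v [pv [v0 vq] hv vs ev]]] := arm_exists sz hq hn hp nq nqp nnp.
pose x k := w (n.+1 - k)%N; have px : path_in n.+1 x := path_in_rev pw.
have x1 : x 1%N = w n by rewrite /x subSS subn0.
have x0 : x 0%N = w n.+1 by rewrite /x subn0.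
have hx k : (0 < k < n.+1)%N -> nbs (x k) = [set x k.-1; x k.+1].
  move=> /andP[k0 kn]; rewrite /x (_ : n.+1 - k = (n - k).+1)%N; last by nlia.
  rewrite hm; last by nlia.
  have -> : (n.+1 - k.-1 = (n - k).+2)%N by nlia.
  have -> : (n.+1 - k.+1 = n - k)%N by nlia.
  exact: setUC.
have xb : nbs (x n.+1) = [set x n] by rewrite /x subnn w0 h0 subSnn.
have ox k : (k < n.+1)%N -> pr (x k) (x k.+1) = -1 /\ pr (x k.+1) (x k) = -1.
  move=> kn; rewrite /x; have [e1 e2] := ew (n.+1 - k.+1)%N (ltac:(nlia)).
  by rewrite (_ : n.+1 - k = (n.+1 - k.+1).+1)%N //; nlia.
wlog rs : r s p q u v pu u0 up hu ur eu pv v0 vq hv vs ev hp hq hz npq np nq nnp nnq nqp / (r <= s)%N.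
  move=> W; have [rs|/ltnW rs] := leqP r s; first exact: (W r s p q u v).
  by apply: (W s r q p v u) => //; rewrite hz -setUA (setUC [set p]) setUA.
have T := @tee_shape n.+1 r.+1 s.+1 x u v px pu pv.
rewrite x0 x1 u0 v0 up vq /x subnn w0 in T.
have {}T := T erefl erefl nnp nnq npq isT rs erefl.
(* In every case the shorter arm is a single node, which becomes the hanging node of [teeC]. *)
have r0 : r = 0%N by case: T => [[]|[]|[]|[]]; nlia.
subst r; rewrite u0 up in ur.
have [Y [Y0 dY]] : exists Y, Y 0%N = x n.+1 /\ diagram (n.+1 + s.+1).+2 Y (teeC n.+1 (n.+1 + s.+1)).
  apply: (tee_diagram px pv (e := p)); rewrite ?x0 ?x1 ?v0 ?vq //.
  - by move=> j; rewrite hz !in_setU !in_set1 => /orP[/orP[]|] /eqP; [exact: Or31|exact: Or33|exact: Or32].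
  - by apply: (off_path px); rewrite ?x0 ?x1.
  - by apply: (off_path pv); rewrite ?v0 ?vq.
  - by case=> // k kn; apply: hv; nlia.
  - by have [] := eu 0%N isT; rewrite u0 up.
  - by have [] := eu 0%N isT; rewrite u0 up.
exists (n.+1 + s.+1)%N, Y; split; first by rewrite Y0 /x subnn.
apply: Or33; exists n.+1; split=> //.
case: T => [[_ s1]|[b1 _]|[_ s2 b2]|[_ s2 b3]].
- by apply: Or42; nlia.
- by apply: Or41; nlia.
- by apply: Or43; nlia.
- by apply: Or44; nlia.
Qed.

Lemma dynkin_leaf : #|nbs delta| = 1%N -> dynkin_case \/ line_case.
Proof.
move=> E; have sd := sdelta hdelta.
have /cards1P[x1 hd] : #|nbs delta| == 1%N by rewrite E.
have h1 : x1 \in nbs delta by rewrite hd inE.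
have [n [w [pw [w0 wx] hw dw]]] := walk_exists sd h1; have [w1 w2 w3] := pw.
rewrite -wx in hd.
case: (end_cases pw dw) => [hN|[p [q [hp hq npq np nq]]]].
  exact: dynkin_path pw w0 hd hw hN.
left; apply: (dynkin_tee pw w0 hd hw (p := p) (q := q)) => //.
have sz := w1 _ (leqnn n.+1).
have hn : w n \in nbs (w n.+1) by apply: nbs_sym; [apply: w1|apply: w2].
apply/esym/eqP; rewrite eqEcard; apply/andP; split.
  by apply/subsetP => j; rewrite !in_setU !in_set1 => /orP[/orP[]|] /eqP->.
apply: leq_trans (deg_le3 sz) _; rewrite -setUA cardsU1 cards2 npq in_set2.
by rewrite ![w n == _]eq_sym (negbTE np) (negbTE nq).
Qed.

Theorem dynkin : dynkin_case \/ line_case.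
Proof.
have sd := sdelta hdelta; have d3 := deg_le3 sd.
case E: #|nbs delta| => [|[|[|[|k]]]]; last by rewrite E in d3.
- right; exists 0%N, 0%N, (fun=> delta); split=> //.
  apply: path_diagram => //.
  - by split=> // -[|?] [|?].
  - by move=> u j _; rewrite (cards0_eq E) inE.
  - by move=> u _; cartan.
  - by case=> [|?] [|?].
- exact: dynkin_leaf.
- right; have c2 : #|nbs delta| == 2%N by rewrite E.
  have [x1 [x2 [n12 hd]]] := elimT (cards2P _) c2.
  exact: dynkin_middle hd n12.
(* Three neighbours of delta would each have a positive coefficient, but they sum to at most 2. *)
- exfalso; have /card_gt2P[x [y [z [[hx hy hz] [nxy nyz nzx]]]]] : (2 < #|nbs delta|)%N by rewrite E.
  have [m dm m1] := dominant_delta; have := dominant3 dm sd hx hy hz.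
  rewrite nxy nyz eq_sym nzx m1 => /(_ isT isT isT).
  have L j : j \in nbs delta -> 0 < m j.
    by move=> hj; have [sj _ _] := nbsP hj; have := dominant1 dm sj (nbs_sym sd hj); nlia.
  by have := L _ hx; have := L _ hy; have := L _ hz; nlia.
Qed.

End Minuscule.
End Dynkin.

(** * Minuscule posets from coefficient vectors *)

Lemma sum_indicator (N k : nat) (c : int) : \sum_(u < N) c * (u == k :> nat)%:Z = if (k < N)%N then c else 0.
Proof.
case: ltnP => h; last first.
  rewrite big1 // => u _; have := ltn_ord u; case: eqP; rewrite ?mulr0 //; lia.
rewrite (bigD1 (Ordinal h)) //= eqxx mulr1 big1 ?addr0 // => u nu.
by rewrite (_ : (u == k :> nat) = false) ?mulr0 //; apply: contraNF nu => /eqP e; apply/eqP/val_inj.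
Qed.

Lemma tri_sum (n v : nat) (F : nat -> int) : (v <= n)%N ->
  (forall u, (u <= n)%N -> u != v -> u.+1 != v -> u != v.+1 -> F u = 0) ->
  \sum_(u < n.+1) F u = F v + (if (0 < v)%N then F v.-1 else 0) + (if (v < n)%N then F v.+1 else 0).
Proof.
move=> vn F0; pose a := if (0 < v)%N then F v.-1 else 0.
rewrite (eq_bigr (fun u : 'I_n.+1 => F v * (u == v :> nat)%:Z + a * (u == v.-1 :> nat)%:Z *
    (0 < v)%N%:Z + F v.+1 * (u == v.+1 :> nat)%:Z)); last first.
  move=> [u un] _ /=; rewrite /a; case: (eqVneq u v) => [->|nuv].
    by case: (posnP v) => v0; case: eqP; case: eqP; rewrite ?(mulr0, mulr1, addr0, mul0r) //; lia.
  case: (eqVneq u v.-1) => [eu|nu1].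
    case: (posnP v) => v0; first by move: nuv; rewrite eu v0.
    by rewrite eu; case: eqP; rewrite ?(mulr0, mulr1, addr0, add0r) //; lia.
  case: (eqVneq u v.+1) => [->|nu2]; first by rewrite !(mulr0, mul0r, mulr1, add0r).
  by rewrite F0 ?(mulr0, mul0r, addr0) //; apply/eqP; lia.
rewrite !big_split /= -mulr_suml !sum_indicator ltnS vn ltnS; congr (_ + _ + _).
by rewrite /a; case: (posnP v) => v0; rewrite ?mulr0 // mulr1 ifT //; lia.
Qed.

Section Model.
Variables (R : root_datum) (B : base R).
Local Notation I := (rd_index R).
Local Notation rt := (@rd_root R).
Local Notation co := (@rd_coroot R).
Local Notation pr := (@rd_pairing R).
Local Notation simp := (simples B).
Local Notation pos := (is_positive B).
Local Notation cf := (cf B).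
Variable delta : I.
Hypothesis hdelta : minuscule B delta.
Local Notation cc := (cc hdelta).
Local Notation inM := (inM B delta).

Lemma Nm_sref (i a : I) : Nm (sref i a) = Nm a.
Proof.
rewrite /Nm (_ : co (sref i a) = cos i (co a)) ?Fm_cos //.
by rewrite co_sref /cos prE.
Qed.

Lemma root_eq_cf a b : (forall i, i \in simp -> cf a i = cf b i) -> a = b.
Proof. by move=> h; apply: root_inj; rewrite (cfE B a) (cfE B b); apply: eq_bigr => i si; rewrite h. Qed.

Lemma root_eq_cc a b : pos a -> pos b -> (forall i, i \in simp -> cc a i = cc b i) -> a = b.
Proof.
move=> pa pb h; apply: coroot_inj; rewrite (ccE hdelta pa) (ccE hdelta pb).
by apply: eq_bigr => i si; rewrite h.
Qed.

(* The elements of the minuscule poset that are lowest in their orbit under the simple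
   reflections other than delta: besides delta they are the long roots at 45 degrees of it. *)
Lemma antidominant a : inM a -> (forall i, i \in simp -> i != delta -> pr a i <= 0) ->
  a = delta \/ (2 <= pr a delta /\ pr delta a = 1).
Proof.
move=> Ma h; have /andP[pa _] := Ma; have sd := sdelta hdelta.
have ca := inM_cc hdelta Ma.
have h2 : 2 <= pr a delta.
  rewrite -(pairing_diag a) {2}/rd_pairing -/(dp _ _) -prE (pr_cc hdelta a pa) (bigD1 delta) //= ca mul1r gerDl.
  by apply: sumr_le0 => i /andP[si nd]; apply: mulr_ge0_le0; rewrite ?cc_ge0 // h.
have [le1|gt1] := lerP (pr delta a) 1.
  by right; split=> //; have := pr_gt0 a delta; lia.
(* Both pairings are now at least 2, so the difference of the two coroots, a nonnegative
   combination, has norm at most zero. *)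
left; apply: (root_eq_cc pa (pos_simple sd)) => i si; apply/eqP; rewrite -subr_eq0; apply/eqP; move: i si.
apply: (@combo_null _ B (fun i => cc a i - cc delta i)) => [i si|].
  by rewrite (cc_simple hdelta sd si); case: (eqVneq i delta) => [->|_]; rewrite ?ca ?subrr // subr0 cc_ge0.
have -> : \sum_(i in simp) (cc a i - cc delta i) *: co i = co a - co delta.
  under eq_bigr do rewrite scalerBl; rewrite sumrB -(ccE hdelta pa) -(ccE hdelta (pos_simple sd)) //.
rewrite /= FmDr FmNr ![Fm (_ - _) _]FmC !FmDr !FmNr -!/(Nm _) [Fm (co delta) (co a)]FmC.
have e1 := Fm_co a (co delta); have e2 := Fm_co delta (co a); rewrite FmC in e2.
have := Nm_gt0 a; have := Nm_gt0 delta; rewrite -!prE in e1 e2; nia.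
Qed.

Section Diagram.
Variables (m d : nat) (Y : nat -> I) (C : nat -> nat -> int).
Hypotheses (dia : diagram B m Y C) (dm : (d < m)%N) (Yd : Y d = delta).

Definition inK (i : I) := exists2 u, (u < m)%N & i = Y u.

Lemma inK_nbs i j : inK i -> j \in nbs B i -> inK j.
Proof. by case: dia => _ _ _ h [u um ->] /(h u j um). Qed.

Lemma pr_outK i j : inK i -> j \in simp -> ~ inK j -> pr i j = 0 /\ pr j i = 0.
Proof.
move=> Ki sj Kj; suff e : pr i j = 0 by split=> //; apply/eqP; rewrite pr_eq0 e.
by apply: (@pr_out _ B) => //; [apply: contra_not_neq Kj => ->|apply/negP => /(inK_nbs Ki)].
Qed.

Lemma sum_diagram (F : I -> int) : (forall i, i \in simp -> ~ inK i -> F i = 0) ->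
  \sum_(i in simp) F i = \sum_(u < m) F (Y u).
Proof.
move=> F0; have [hs inj _ _] := dia.
pose K := [set Y u | u : 'I_m].
have -> : \sum_(i in simp) F i = \sum_(i in K) F i.
  rewrite (bigID (mem K)) /= [X in _ + X]big1 ?addr0 => [|i /andP[si /negP Ki]]; last first.
    by apply: F0 => // -[u um e]; apply: Ki; apply/imsetP; exists (Ordinal um).
  apply: eq_bigl => i; case: (boolP (i \in K)) => [/imsetP[u _ ->]|_]; last by rewrite andbF.
  by rewrite hs.
by rewrite big_imset //= => u v _ _ /inj e; apply/val_inj/e.
Qed.

(** A simple reflection with nonzero pairing cannot leave the component of the support, and it
    preserves the norm. *)
Lemma component a : pos a -> (forall u, (u < m)%N -> cf a (Y u) = 0) \/
  [/\ forall i, i \in simp -> ~ inK i -> cf a i = 0, forall i, i \in simp -> ~ inK i -> cc a i = 0 &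
      exists2 u, (u < m)%N & Nm a = Nm (Y u)].
Proof.
have [hs inj _ _] := dia.
elim/(pos_ind hdelta) => [i si|{}a i pa si nai ai IH].
  have [Ki|Ki] := pselect (inK i); [right|left].
    case: Ki => u um ->; split=> [j sj Kj|j sj Kj|]; last by exists u.
      by rewrite cf_simple ?hs // (_ : (j == Y u) = false) //; apply/eqP => e; apply: Kj; exists u.
    by rewrite cc_simple ?hs // (_ : (j == Y u) = false) //; apply/eqP => e; apply: Kj; exists u.
  move=> u um; rewrite cf_simple ?hs // (_ : (_ == _) = false) //.
  by apply/eqP => e; apply: Ki; exists u.
have ne : (forall j, j \in simp -> cf a j * pr j i = 0) -> False.
  by move=> h; move: ai; rewrite (pr_cf B a i) big1 // => k sk; rewrite h.
case: IH => [z|[z1 z2 z3]].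
  have Ki : ~ inK i.
    move=> Ki; apply: ne => j sj; have [[u um ->]|Kj] := pselect (inK j); first by rewrite z ?mul0r.
    by have [_ ->] := pr_outK Ki sj Kj; rewrite mulr0.
  left=> u um; rewrite cf_sref ?hs // z // (_ : (_ == _) = false) ?mulr0 //.
  by apply/eqP => e; apply: Ki; exists u.
have Ki : inK i.
  apply: contrapT => Ki; apply: ne => j sj; have [Kj|Kj] := pselect (inK j); last by rewrite z1 ?mul0r.
  by have [-> _] := pr_outK Kj si Ki; rewrite mulr0.
have ni j : ~ inK j -> (j == i) = false by move=> Kj; apply/eqP => e; apply: Kj; rewrite e.
right; split; last by rewrite Nm_sref.
  by move=> j sj Kj; rewrite cf_sref // z1 // ni // mulr0.
by move=> j sj Kj; rewrite cc_sref // z2 // ni // mulr0.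
Qed.

Lemma M_component a : inM a -> [/\ forall i, i \in simp -> ~ inK i -> cf a i = 0,
  forall i, i \in simp -> ~ inK i -> cc a i = 0 & exists2 u, (u < m)%N & Nm a = Nm (Y u)].
Proof.
move=> Ma; have /andP[pa na] := Ma; case: (component pa) => // /(_ d dm).
by rewrite Yd => e; rewrite e in na.
Qed.

Definition pairv (g : nat -> int) v : int := \sum_(u < m) g u * C u v.

Lemma pairvE a v : (forall i, i \in simp -> ~ inK i -> cf a i = 0) -> (v < m)%N ->
  pr a (Y v) = pairv (fun u => cf a (Y u)) v.
Proof.
move=> h vm; have [hs _ hC _] := dia; rewrite (pr_cf B) sum_diagram => [|i si Ki]; last by rewrite h ?mul0r.
by apply: eq_bigr => u _; rewrite hC.
Qed.

Lemma pairv_out a i : (forall i, i \in simp -> ~ inK i -> cf a i = 0) -> i \in simp -> ~ inK i ->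
  pr a i = 0.
Proof.
move=> h si Ki; rewrite (pr_cf B) big1 // => j sj.
have [Kj|Kj] := pselect (inK j); last by rewrite h ?mul0r.
by have [-> _] := pr_outK Kj si Ki; rewrite mulr0.
Qed.

Lemma cc_row a v : inM a -> (v < m)%N -> pr (Y v) a = \sum_(u < m) cc a (Y u) * C v u.
Proof.
move=> Ma vm; have [hs _ hC _] := dia; have /andP[pa _] := Ma; have [_ z _] := M_component Ma.
rewrite (pr_cc hdelta _ pa) sum_diagram => [|i si Ki]; last by rewrite z ?mul0r.
by apply: eq_bigr => u _; rewrite hC.
Qed.

Definition isroot (g : nat -> int) := exists a, [/\ pos a,
  forall i, i \in simp -> ~ inK i -> cf a i = 0 & forall u, (u < m)%N -> cf a (Y u) = g u].

Lemma isroot_ext g g' : isroot g -> (forall u, (u < m)%N -> g u = g' u) -> isroot g'.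
Proof. by move=> [a [pa z h]] e; exists a; split=> // u um; rewrite h ?e. Qed.

Lemma isroot_unit v : (v < m)%N -> isroot (fun u => (u == v)%:Z).
Proof.
move=> vm; have [hs inj _ _] := dia; exists (Y v); split; first exact/pos_simple/hs.
  move=> j sj Kj; rewrite cf_simple ?hs // (_ : (j == Y v) = false) //.
  by apply/eqP => e; apply: Kj; exists v.
move=> u um; rewrite cf_simple ?hs //; congr (nat_of_bool _)%:Z.
by apply/eqP/eqP => [/inj->|->].
Qed.

Lemma isroot_refl g v : isroot g -> (v < m)%N -> pairv g v < 0 ->
  isroot (fun u => g u - pairv g v * (u == v)%:Z).
Proof.
move=> [a [pa z h]] vm hp; have [hs inj _ _] := dia.
have e : pr a (Y v) = pairv g v.
  by rewrite (pairvE z vm); apply: eq_bigr => u _; rewrite h.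
exists (sref (Y v) a); split.
- apply: pos_sref; rewrite ?hs //; apply: contraTneq hp => ea.
  by rewrite -e ea pairing_diag.
- move=> i si Ki; rewrite cf_sref ?hs // z // (_ : (i == Y v) = false) ?mulr0 //.
  by apply/eqP => e'; apply: Ki; exists v.
- move=> u um; rewrite cf_sref ?hs // h // e; congr (_ - _ * (nat_of_bool _)%:Z).
  by apply/eqP/eqP => [/inj->|->].
Qed.

(** Equal norms make the pairing symmetric, which rules out the values 2 and 1 of the second
    alternative. *)
Lemma antidominant_simply_laced a : (forall u, (u < m)%N -> Nm (Y u) = Nm delta) ->
  inM a -> (forall i, i \in simp -> i != delta -> pr a i <= 0) -> a = delta.
Proof.
move=> hN Ma h; case: (antidominant Ma h) => // -[h2 h1]; exfalso.
have [_ _ [u um e]] := M_component Ma; rewrite hN // in e.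
have := pr_sym a delta; rewrite e h1; have := Nm_gt0 delta; nia.
Qed.

Lemma Nm_edge u v : (u < m)%N -> (v < m)%N -> C u v = -1 -> C v u = -1 -> Nm (Y u) = Nm (Y v).
Proof.
move=> um vm h1 h2; have [_ _ hC _] := dia; have := pr_sym (Y u) (Y v).
by rewrite !hC // h1 h2 !mulrN1 => /oppr_inj->.
Qed.

(** * The root order on a coefficient model *)

Section Poset.
Variables (T : eqType) (S : pred T) (nb : rel T) (rk : T -> nat) (RR : nat) (f : T -> nat -> int).
(** [f x] is the coefficient vector of the root at [x]. [f_up] closes the model under raising
    reflections away from delta and [f_low] covers the roots where such descents end; together they
    give surjectivity. [f_le] says that coefficientwise comparison is generated by covers. *)
Hypothesis f_root : forall x, S x -> isroot (f x) /\ f x d != 0.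
Hypothesis f_up : forall x v, S x -> (v < m)%N -> v != d -> pairv (f x) v < 0 ->
  pairv (f x) v = -1 /\ exists2 y, S y & forall u, (u < m)%N -> f y u = f x u + (u == v)%:Z.
Hypothesis f_low : forall a, inM a -> (forall i, i \in simp -> i != delta -> pr a i <= 0) ->
  exists2 x, S x & forall u, (u < m)%N -> cf a (Y u) = f x u.
Hypothesis f_step : forall x y, S x -> S y -> nb x y ->
  exists2 v, (v < m)%N & forall u, (u < m)%N -> f y u = f x u + (u == v)%:Z.
Hypothesis f_le : forall x y, S x -> S y -> (forall u, (u < m)%N -> f x u <= f y u) -> x != y ->
  (exists z, [/\ S z, nb z y & forall u, (u < m)%N -> f x u <= f z u]) /\
  (exists z, [/\ S z, nb x z & forall u, (u < m)%N -> f z u <= f y u]).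
Hypotheses (nb_rk : forall x y, nb x y -> rk y = (rk x).+1)
  (rk_le : forall x, S x -> (rk x <= RR)%N)
  (rk_low : forall x, S x -> (0 < rk x)%N -> exists2 w, S w & nb w x)
  (rk_top : exists2 x, S x & rk x = RR).

Lemma f_surj a : inM a -> exists2 x, S x & forall u, (u < m)%N -> cf a (Y u) = f x u.
Proof.
have [hs inj _ _] := dia.
have [n] := ubnP `|ht B a|%N; elim: n a => // n IH a an Ma.
have /andP[pa na] := Ma.
have [[i [si nd ai]]|no] := pselect (exists i, [/\ i \in simp, i != delta & 0 < pr a i]); last first.
  by apply: f_low => // i si nd; rewrite leNgt; apply/negP => h; apply: no; exists i.
have nai : a != i.
  apply/eqP => e; move: na; rewrite e cf_simple ?(sdelta hdelta) // [delta == i]eq_sym (negbTE nd) //.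
have pb := pos_sref pa si nai.
have [z _ _] := M_component Ma.
have [v vm ei] : inK i by apply: contrapT => Ki; move: ai; rewrite (pairv_out z).
have nvd : v != d by apply: contraNneq nd => e; rewrite ei e Yd.
have Mb : inM (sref i a).
  rewrite /inM pb cf_sref ?(sdelta hdelta) // [delta == i]eq_sym (negbTE nd) mulr0 subr0; exact: na.
have [|x Sx hx] := IH _ _ Mb.
  by have := ht_ge0 pb; have := ht_ge0 pa; move: an; rewrite ht_sref //; lia.
have [zb _ _] := M_component Mb.
have eb : pairv (f x) v = - pr a i.
  have -> : pairv (f x) v = pr (sref i a) (Y v).
    by rewrite (pairvE zb vm); apply: eq_bigr => u _; rewrite hx.
  by rewrite -ei pr_srefl pairing_diag; lia.
have [|e1 [y Sy hy]] := f_up Sx vm nvd; first by rewrite eb oppr_lt0.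
exists y => // u um; rewrite hy // -hx // cf_sref ?hs // ei.
rewrite (_ : (Y u == Y v) = (u == v)); last by apply/eqP/eqP => [/inj->|->].
by rewrite -ei (_ : pr a i = 1) ?mul1r ?subrK //; lia.
Qed.

Local Notation P := (minuscule_poset B delta).
Local Notation idx := (fun p : P => val (val p)).

Lemma inM_idx (p : P) : inM (idx p).
Proof. by rewrite -involvesP ?(valP (val p)) // (valP p). Qed.

Lemma inM_poset a : inM a -> exists p : P, idx p = a.
Proof.
move=> Ma; have /andP[pa _] := Ma; pose q : pos_root B := exist _ a pa.
have iq : involves B delta (val q) by rewrite involvesP.
by exists (exist _ q iq : P).
Qed.

Lemma pos_root_le_cf (a b : pos_root B) : pos_root_le a b ->
  forall i, i \in simp -> cf (val a) i <= cf (val b) i.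
Proof.
case/connectP => s; elim: s a => [|c s IH] a /=; first by move=> _ -> i _.
case/andP => /existsP[g /eqP eg] /IH{}IH /IH h i si; apply: le_trans (h i si).
have -> : cf (val c) i = cf (val a) i + cf (val g) i.
  move: i si {h}; apply: (cf_uniq (m := fun i => cf (val a) i + cf (val g) i)).
  under eq_bigr do rewrite scalerDl.
  by rewrite big_split /= -!cfE -eg addrC subrK.
by rewrite lerDl; apply: (posP _ _ (valP g)).
Qed.

Definition loc (p : P) : T := s2val (cid2 (f_surj (inM_idx p))).
Lemma locS p : S (loc p). Proof. exact: (s2valP (cid2 (f_surj (inM_idx p)))). Qed.
Lemma locE p u : (u < m)%N -> cf (idx p) (Y u) = f (loc p) u.
Proof. exact: (s2valP' (cid2 (f_surj (inM_idx p)))). Qed.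

Lemma f_inj x y : S x -> S y -> (forall u, (u < m)%N -> f x u = f y u) -> x = y.
Proof.
move=> Sx Sy e; apply/eqP; apply: contraT => nxy.
have [|_ [z [Sz xz zy]]] := f_le Sx Sy _ nxy; first by move=> u um; rewrite e.
have [v vm ev] := f_step Sx Sz xz; have := zy v vm; rewrite ev // eqxx e //; lia.
Qed.

Lemma loc_surj x : S x -> exists p, loc p = x.
Proof.
move=> Sx; have [[a [pa z ea]] fd] := f_root Sx.
have Ma : inM a by rewrite /inM pa -Yd ea.
have [p ep] := inM_poset Ma; exists p; apply: f_inj => //; first exact: locS.
by move=> u um; rewrite -locE // ep ea.
Qed.

Lemma cf_eq_idx (p q : P) : (forall u, (u < m)%N -> f (loc p) u = f (loc q) u) -> p = q.
Proof.
move=> e; apply/val_inj/val_inj; apply: root_eq_cf => i si.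
have [z _ _] := M_component (inM_idx p); have [z' _ _] := M_component (inM_idx q).
by have [[u um ->]|Ki] := pselect (inK i); [rewrite !locE ?e|rewrite z ?z'].
Qed.

Lemma loc_inj : injective loc. Proof. by move=> p q e; apply: cf_eq_idx => u; rewrite e. Qed.

Lemma le_loc (p q : P) : (p <= q)%O -> forall u, (u < m)%N -> f (loc p) u <= f (loc q) u.
Proof.
move=> pq u um; rewrite -!locE //; have [hs _ _ _] := dia.
exact: (pos_root_le_cf (pq : pos_root_le (val p) (val q)) (hs u um)).
Qed.

Lemma loc_lt (p q : P) : nb (loc p) (loc q) -> (p < q)%O.
Proof.
move=> pq; have [v vm ev] := f_step (locS p) (locS q) pq; have [hs inj _ _] := dia.
rewrite lt_neqAle; apply/andP; split.
  by apply/eqP => e; have := nb_rk pq; rewrite e; lia.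
have pv : pos (Y v) by apply/pos_simple/hs.
suff h : pos_root_step (val p) (val q) by exact: (connect1 h : pos_root_le (val p) (val q)).
apply/existsP; exists (exist _ (Y v) pv); apply/eqP => /=.
have [z _ _] := M_component (inM_idx p); have [z' _ _] := M_component (inM_idx q).
rewrite (cfE B (idx q)) (cfE B (idx p)) (eq_bigr (fun j => (cf (idx p) j + 1 * (j == Y v)%:Z) *: rt j)).
  by rewrite delta_sum ?hs // scale1r addrAC subrr add0r.
move=> j sj; congr (_ *: _); rewrite mul1r.
have [[u um ->]|Kj] := pselect (inK j).
  by rewrite !locE // ev //; congr (_ + (nat_of_bool _)%:Z); apply/eqP/eqP => [->|/inj->].
rewrite z' // z // (_ : (j == Y v) = false) //.
by apply/eqP => e; apply: Kj; exists v.
Qed.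

(** Climb from [p] one cover of the model at a time, each cover adding a simple root. With [le_loc],
    the root order on the poset is the coefficientwise one. *)
Lemma loc_le (p q : P) : (forall u, (u < m)%N -> f (loc p) u <= f (loc q) u) -> (p <= q)%O.
Proof.
have [n] := ubnP (RR - rk (loc p))%N; elim: n p => // n IH p hn h.
have [->//|npq] := eqVneq p q.
have nl : loc p != loc q by apply: contraNneq npq => /loc_inj->.
have [_ [z [Sz pz zq]]] := f_le (locS p) (locS q) h nl.
have [r er] := loc_surj Sz; rewrite -er in pz zq; apply: le_trans (ltW (loc_lt pz)) _.
by apply: IH zq; have := nb_rk pz; have := rk_le (locS r); lia.
Qed.

Lemma model_NRP : field_NRP S nb RR -> NRP_rowmotion P.
Proof.
apply: (NRP_transfer (phi := loc) (rk := rk)) => //.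
- exact: locS.
- exact: loc_inj.
- exact: loc_surj.
- exact: loc_lt.
- move=> p q pq; have nl : loc p != loc q by apply: contraTneq pq => /loc_inj->; rewrite ltxx.
  have [[z [Sz zq pz]] _] := f_le (locS p) (locS q) (le_loc (ltW pq)) nl.
  by have [r er] := loc_surj Sz; exists r; [rewrite er|apply: loc_le; rewrite er].
- move=> p q pq; have nl : loc p != loc q by apply: contraTneq pq => /loc_inj->; rewrite ltxx.
  have [_ [z [Sz pz zq]]] := f_le (locS p) (locS q) (le_loc (ltW pq)) nl.
  by have [r er] := loc_surj Sz; exists r; [rewrite er|apply: loc_le; rewrite er].
Qed.

End Poset.
End Diagram.
End Model.

(** * Types A, B and C *)

Definition when (b : bool) (x : int) : int := if b then x else 0.

Lemma band_sum n (C : nat -> nat -> int) (g : nat -> int) v : (v <= n)%N ->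
  (forall u, (u <= n)%N -> u != v -> u.+1 != v -> u != v.+1 -> C u v = 0) ->
  \sum_(u < n.+1) g u * C u v =
  g v * C v v + when (0 < v)%N (g v.-1 * C v.-1 v) + when (v < n)%N (g v.+1 * C v.+1 v).
Proof.
by move=> vn h; rewrite (tri_sum (v := v) (F := fun u => g u * C u v)) // => u *; rewrite h ?mulr0.
Qed.

Lemma pairA n g v : (v <= n)%N ->
  pairv n.+1 pathC g v = 2 * g v - when (0 < v)%N (g v.-1) - when (v < n)%N (g v.+1).
Proof.
move=> vn; rewrite /pairv band_sum //; last by move=> *; cartan.
have -> : pathC v v = 2 by cartan.
have -> : pathC v.+1 v = -1 by cartan.
have e : (0 < v)%N -> pathC v.-1 v = -1 by move=> ?; cartan.
by rewrite /when; case: posnP => [_|/e->]; case: ltnP => _; ring.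
Qed.

Lemma pairB n g v : (v <= n)%N ->
  pairv n.+1 typeB g v = 2 * g v - when (0 < v)%N (g v.-1) -
    when (v < n)%N ((if v == 0%N then 2 else 1) * g v.+1).
Proof.
move=> vn; rewrite /pairv band_sum //; last by move=> *; cartan.
have -> : typeB v v = 2 by cartan.
have -> : typeB v.+1 v = - (if v == 0%N then 2 else 1) by cartan.
have e : (0 < v)%N -> typeB v.-1 v = -1 by move=> ?; cartan.
by rewrite /when; repeat (case: ifP => ?); rewrite ?e //; ring.
Qed.

Lemma pairC n g v : (v <= n)%N ->
  pairv n.+1 (typeC n) g v = 2 * g v - when (0 < v)%N (g v.-1) -
    when (v < n)%N ((if v.+1 == n then 2 else 1) * g v.+1).
Proof.
move=> vn; rewrite /pairv band_sum //; last by move=> *; cartan.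
have -> : typeC n v v = 2 by cartan.
have -> : typeC n v.+1 v = - (if v.+1 == n then 2 else 1) by cartan.
have e : (0 < v)%N -> typeC n v.-1 v = -1 by move=> ?; cartan.
by rewrite /when; repeat (case: ifP => ?); rewrite ?e //; ring.
Qed.

Lemma rowB n (c : nat -> int) v : (v <= n)%N ->
  \sum_(u < n.+1) c u * typeB v u = 2 * c v - when (0 < v)%N ((if v == 1%N then 2 else 1) * c v.-1) -
    when (v < n)%N (c v.+1).
Proof.
move=> vn; rewrite (band_sum (C := fun u v => typeB v u)) //; last by move=> *; cartan.
have -> : typeB v v = 2 by cartan.
have -> : typeB v v.+1 = -1 by cartan.
have e : (0 < v)%N -> typeB v v.-1 = - (if v == 1%N then 2 else 1) by move=> ?; cartan.
by rewrite /when; case: (posnP v) => v0; rewrite ?e //; repeat (case: ifP => ?); ring.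
Qed.

Lemma rowC n (c : nat -> int) v : (v <= n)%N ->
  \sum_(u < n.+1) c u * typeC n v u = 2 * c v - when (0 < v)%N ((if v == n then 2 else 1) * c v.-1) -
    when (v < n)%N (c v.+1).
Proof.
move=> vn; rewrite (band_sum (C := fun u v => typeC n v u)) //; last by move=> *; cartan.
have -> : typeC n v v = 2 by cartan.
have e' : (v < n)%N -> typeC n v v.+1 = -1 by move=> ?; cartan.
have e : (0 < v)%N -> typeC n v v.-1 = - (if v == n then 2 else 1) by move=> ?; cartan.
rewrite /when; case: (posnP v) => v0; rewrite ?e //; case: (ltnP v n) => vn'; rewrite ?e' //;
  repeat (case: ifP => ?); ring.
Qed.

(** * Posets modelled on cells of the plane *)

Section Grid.
Variables (R : root_datum) (B : base R).
Local Notation I := (rd_index R).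
Local Notation pr := (@rd_pairing R).
Local Notation simp := (simples B).
Local Notation cf := (cf B).
Variable delta : I.
Hypothesis hdelta : minuscule B delta.
Local Notation inM := (inM B delta).
Local Notation cc := (cc hdelta).

Section Diagram.
Variables (m d : nat) (Y : nat -> I) (C : nat -> nat -> int).
Hypotheses (dia : diagram B m Y C) (dm : (d < m)%N) (Yd : Y d = delta).
Local Notation isroot := (isroot B m Y).
Local Notation pairv := (pairv m C).

Lemma isroot_up g g' v : isroot g -> (v < m)%N -> pairv g v = -1 ->
  (forall u, (u < m)%N -> g' u = g u + (u == v)%:Z) -> isroot g'.
Proof.
move=> hg vm e h; apply: (isroot_ext (isroot_refl dia hg vm _)); first by rewrite e.
by move=> u um; rewrite h // e; ring.
Qed.

Lemma low_delta (S : pred cell) (f : cell -> nat -> int) x0 : S x0 ->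
  (forall u v, (u < m)%N -> (v < m)%N -> Nm (Y u) = Nm (Y v)) ->
  (forall u, (u < m)%N -> f x0 u = (u == d)%:Z) ->
  forall a, inM a -> (forall i, i \in simp -> i != delta -> pr a i <= 0) ->
  exists2 x, S x & forall u, (u < m)%N -> cf a (Y u) = f x u.
Proof.
move=> S0 hN h a Ma ha; have [hs inj _ _] := dia.
rewrite (antidominant_simply_laced hdelta dia dm Yd _ Ma ha); last by move=> u um; rewrite -Yd; apply: hN.
exists x0 => // u um; rewrite h // -Yd cf_simple ?hs //; congr (nat_of_bool _)%:Z.
by apply/eqP/eqP => [/inj->|->].
Qed.

(* In types B and C there is one antidominant root besides delta; sol are its coroot coefficients. *)
Lemma low_two (S : pred cell) (f : cell -> nat -> int) x0 x1 (sol : nat -> int) : S x0 -> S x1 ->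
  (forall u, (u < m)%N -> f x0 u = (u == d)%:Z) -> isroot (f x1) -> 1 < f x1 d ->
  (forall v, (v < m)%N -> v != d -> pairv (f x1) v <= 0) ->
  (forall c : nat -> int, c d = 1 -> (forall u, 0 <= c u) ->
     (forall v, (v < m)%N -> v != d -> \sum_(u < m) c u * C v u <= 0) ->
     \sum_(u < m) c u * C d u = 1 -> forall u, (u < m)%N -> c u = sol u) ->
  forall a, inM a -> (forall i, i \in simp -> i != delta -> pr a i <= 0) ->
  exists2 x, S x & forall u, (u < m)%N -> cf a (Y u) = f x u.
Proof.
move=> S0 S1 h0 [t [pt zt ht]] t1 hp hsol a Ma ha; have [hs inj _ _] := dia.
have sd := sdelta hdelta.
have ex0 : forall u, (u < m)%N -> cf delta (Y u) = f x0 u.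
  move=> u um; rewrite h0 // -Yd cf_simple ?hs //; congr (nat_of_bool _)%:Z.
  by apply/eqP/eqP => [/inj->|->].
have sol_of b : inM b -> (forall i, i \in simp -> i != delta -> pr b i <= 0) -> b <> delta ->
    forall u, (u < m)%N -> cc b (Y u) = sol u.
  move=> Mb hb nb; apply: hsol => [|u|v vm nv|].
  - by rewrite Yd; apply: inM_cc.
  - exact: cc_ge0.
  - rewrite -(cc_row hdelta dia dm Yd Mb vm) leNgt pr_gt0 -leNgt; apply: hb; first exact: hs.
    by apply: contraNneq nv => e; apply/eqP/inj; rewrite ?e.
  - by rewrite -(cc_row hdelta dia dm Yd Mb dm) Yd; case: (antidominant hdelta Mb hb) => [/nb|[]].
have [ad|/eqP nad] := eqVneq a delta; first by exists x0; rewrite // ad.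
have Mt : inM t by rewrite /inM pt -Yd ht //; apply/eqP; lia.
have At i : i \in simp -> i != delta -> pr t i <= 0.
  move=> si nd; have [[v vm ei]|Ki] := pselect (inK m Y i); last by rewrite (pairv_out dia zt).
  rewrite ei (pairvE dia zt vm).
  have -> : pairv (fun u => cf t (Y u)) v = pairv (f x1) v.
    by apply: eq_bigr => u _; rewrite ht.
  by apply: hp => //; apply: contraNneq nd => e; rewrite ei e Yd.
have nt : t <> delta.
  by move=> e; have := ht d dm; rewrite e Yd cf_simple // eqxx => h; rewrite -h in t1.
have /andP[pa _] := Ma.
suff -> : a = t by exists x1.
apply: (root_eq_cc (hdelta := hdelta) pa pt) => i si.
have [_ za _] := M_component hdelta dia dm Yd Ma; have [_ zt' _] := M_component hdelta dia dm Yd Mt.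
have [[u um ->]|Ki] := pselect (inK m Y i); last by rewrite za ?zt'.
by rewrite (sol_of a) ?(sol_of t).
Qed.

Variables (S : pred cell) (RR : nat) (f : cell -> nat -> int).

Definition region := [/\
  forall x y, S x -> S y -> le2 x y -> x != y ->
    (exists z, [/\ S z, gridnb z y & le2 x z]) /\ (exists z, [/\ S z, gridnb x z & le2 z y]),
  forall x, S x -> (gridrk x <= RR)%N,
  forall x, S x -> (0 < gridrk x)%N -> exists2 w, S w & gridnb w x &
  exists2 x, S x & gridrk x = RR].

Lemma grid_model : region ->
  (forall x, S x -> isroot (f x) /\ f x d != 0) ->
  (forall x v, S x -> (v < m)%N -> v != d -> pairv (f x) v < 0 ->
    pairv (f x) v = -1 /\ exists2 y, S y & forall u, (u < m)%N -> f y u = f x u + (u == v)%:Z) ->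
  (forall a, inM a -> (forall i, i \in simp -> i != delta -> pr a i <= 0) ->
    exists2 x, S x & forall u, (u < m)%N -> cf a (Y u) = f x u) ->
  (forall x y, S x -> S y -> gridnb x y ->
    exists2 v, (v < m)%N & forall u, (u < m)%N -> f y u = f x u + (u == v)%:Z) ->
  (forall x y, S x -> S y -> le2 x y -> forall u, (u < m)%N -> f x u <= f y u) ->
  (forall x y, S x -> S y -> (forall u, (u < m)%N -> f x u <= f y u) -> le2 x y) ->
  field_NRP S gridnb RR -> NRP_rowmotion (minuscule_poset B delta).
Proof.
move=> [r1 r2 r3 r4] h1 h2 h3 h4 h5 h6; apply: (model_NRP hdelta dia dm Yd h1 h2 h3 h4 _ gridnb_rk r2 r3 r4).
move=> x y Sx Sy xy nxy; have [[z [Sz zy xz]] [z' [Sz' xz' zy']]] := r1 x y Sx Sy (h6 x y Sx Sy xy) nxy.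
by split; [exists z|exists z']; split=> //; apply: h5.
Qed.

End Diagram.

Lemma rect_region p q : region (rect p q) (p + q).
Proof.
split=> [[r s] [r' s']|[r s]|[r s]|]; rewrite /rect /le2 /gridrk /=.
- rewrite xpair_eqE => Sx Sy xy nxy; have [h|h] := ltnP r r'; split.
  + by exists (r'.-1, s'); rewrite gridnbE /=; split; lia.
  + by exists (r.+1, s); rewrite gridnbE /=; split; lia.
  + by exists (r', s'.-1); rewrite gridnbE /=; split; lia.
  + by exists (r, s.+1); rewrite gridnbE /=; split; lia.
- lia.
- case: r => [|r] Sx h; first by exists (0, s.-1)%N; rewrite ?gridnbE /=; lia.
  by exists (r, s); rewrite ?gridnbE /=; lia.
- by exists (p, q); rewrite /= ?leqnn.
Qed.

Lemma stair_region n : region (stair n) (n + n).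
Proof.
split=> [[r s] [r' s']|[r s]|[r s]|]; rewrite /stair /le2 /gridrk /=.
- rewrite xpair_eqE => Sx Sy xy nxy; split.
  + have [h|h] := ltnP r r'; first by exists (r'.-1, s'); rewrite gridnbE /=; split; lia.
    by exists (r', s'.-1); rewrite gridnbE /=; split; lia.
  + have [h|h] := ltnP s s'; first by exists (r, s.+1); rewrite gridnbE /=; split; lia.
    by exists (r.+1, s); rewrite gridnbE /=; split; lia.
- lia.
- move=> Sx h; have [e|e] := eqVneq r s; first by exists (r.-1, s); rewrite ?gridnbE /=; lia.
  by exists (r, s.-1); rewrite ?gridnbE /=; lia.
- by exists (n, n); rewrite /= ?leqnn.
Qed.

Lemma propeller_region k : region (propeller k) k.*2.+2.
Proof.
have sg := propeller_sg k; split; [|exact: sg_le sg|exact: sg_low sg|].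
  move=> [r s] [r' s']; rewrite /propeller /le2 /= xpair_eqE => Sx Sy xy nxy; split.
    have [h|h] := ltnP r r'; last by exists (r', s'.-1); rewrite gridnbE /=; split; lia.
    have [h'|h'] := leqP s' k.+1; first by exists (0, s')%N; rewrite gridnbE /=; split; lia.
    by exists (r', s'.-1); rewrite gridnbE /=; split; lia.
  have [h|h] := ltnP r r'; last by exists (r, s.+1); rewrite gridnbE /=; split; lia.
  have [h'|h'] := leqP k s; first by exists (1, s)%N; rewrite gridnbE /=; split; lia.
  by exists (r, s.+1); rewrite gridnbE /=; split; lia.
by exists (1, k.*2.+1)%N; rewrite /propeller /gridrk /=; lia.
Qed.

Lemma Nm_path n Y C : diagram B n.+1 Y C \/ diagram B n.+2 Y C ->
  (forall u, (u < n)%N -> C u u.+1 = -1 /\ C u.+1 u = -1) ->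
  forall u v, (u <= n)%N -> (v <= n)%N -> Nm (Y u) = Nm (Y v).
Proof.
move=> dia h; have h0 u : (u <= n)%N -> Nm (Y u) = Nm (Y 0%N).
  elim: u => // u IH un; rewrite -IH; last exact: ltnW.
  have [e1 e2] := h u un; case: dia => dia; apply: (Nm_edge dia _ _ e2 e1); lia.
by move=> u v un vn; rewrite !h0.
Qed.

Theorem line_NRP : line_case B delta -> NRP_rowmotion (minuscule_poset B delta).
Proof.
move=> [n [p [Y [pn dia Yp]]]].
(* Indicator vectors of the intervals from [p - r] to [p + s]. *)
pose f (x : cell) (u : nat) : int := ((p <= u + x.1) && (u <= p + x.2))%N%:Z.
have pm : (p < n.+1)%N by [].
have S00 : rect p (n - p) (0, 0)%N by rewrite /rect.
have R0 s : (s <= n - p)%N -> isroot B n.+1 Y (f (0, s)%N).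
  elim: s => [|s IH] sn.
    by apply: (isroot_ext (isroot_unit dia pm)) => u um; rewrite /f /=; lia.
  apply: (isroot_up dia (IH (ltnW sn)) (v := (p + s).+1)); first by lia.
    by rewrite pairA; [rewrite /f /when /=; ifs|lia].
  by move=> u um; rewrite /f /=; lia.
apply: (grid_model dia pm Yp (rect_region p (n - p)) (f := f)); last exact: rect_NRP.
- move=> [r s]; rewrite /rect /= => Sx; split; last by rewrite /f /=; lia.
  elim: r Sx => [|r IH] Sx; first by apply: R0; lia.
  apply: (isroot_up dia (IH _) (v := (p - r.+1)%N)); [lia|lia| |].
    by rewrite pairA; [rewrite /f /when /=; ifs|lia].
  by move=> u um; rewrite /f /=; lia.
- move=> [r s] v; rewrite /rect /= => Sx vm nv; rewrite pairA; last by lia.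
  rewrite /f /when /= => neg.
  have [e|e] : v = (p + s).+1 \/ (v + r.+1 = p)%N by move: neg; ifs.
    split; first by ifs.
    by exists (r, s.+1); rewrite /=; [lia|move=> u um; lia].
  split; first by ifs.
  by exists (r.+1, s); rewrite /=; [lia|move=> u um; lia].
- apply: (low_delta dia pm Yp S00) => [u v um vm|u um]; last by rewrite /f /=; lia.
  by apply: (Nm_path (n := n) (or_introl dia)); [move=> w wn; split; cartan|lia|lia].
- move=> [r s] [r' s']; rewrite /rect gridnbE /= => Sx Sy /orP[] /andP[/eqP er /eqP es]; subst r' s'.
    by exists (p - r.+1)%N; [lia|move=> u um; rewrite /f /=; lia].
  by exists (p + s).+1; [lia|move=> u um; rewrite /f /=; lia].
- move=> [r s] [r' s']; rewrite /rect /le2 /= => Sx Sy xy u um; rewrite /f /=; lia.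
- move=> [r s] [r' s']; rewrite /rect /le2 /= => Sx Sy h.
  have := h (p - r)%N (ltac:(lia)); have := h (p + s)%N (ltac:(lia)); rewrite /f /=; lia.
Qed.

(** The sequence stays convex when 0 is appended after [n], so an ascent, or even a flat step, at a
    positive value could never return to 0. *)
Lemma convex_end (n k : nat) (c : nat -> int) : (k < n)%N -> (forall u, 0 <= c u) ->
  (forall v, (k < v < n)%N -> 2 * c v <= c v.-1 + c v.+1) -> 2 * c n <= c n.-1 ->
  c k <= c k.+1 -> c k.+1 = 0.
Proof.
move=> kn c0 hc hn h.
have P j : (k + j < n)%N -> c (k + j)%N <= c (k + j).+1 /\ c k.+1 <= c (k + j).+1.
  elim: j => [|j IH] hj; first by rewrite addn0.
  rewrite addnS; have := hc (k + j).+1 (ltac:(lia)); have [] := IH (ltac:(lia)); rewrite /=; lia.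
have := P (n.-1 - k)%N (ltac:(lia)); rewrite (_ : (k + (n.-1 - k)).+1 = n)%N; last by lia.
rewrite (_ : k + (n.-1 - k) = n.-1)%N; last by lia.
by have := c0 k.+1; lia.
Qed.

Lemma typeB_NRP n Y : (0 < n)%N -> Y 0%N = delta -> diagram B n.+1 Y typeB ->
  NRP_rowmotion (minuscule_poset B delta).
Proof.
move=> n0 Y0 dia.
(* With e_s the sum of the simple roots 0 to s, the cell [(0, s)] is e_s and [(r, s)] with r > 0 is
   e_(r-1) + e_s. *)
pose f (x : cell) (u : nat) : int := if u == 0%N then 1 + (0 < x.1)%N%:Z else (u <= x.2)%N%:Z + (u < x.1)%N%:Z.
have dm : (0 < n.+1)%N by [].
have R0 s : (s <= n)%N -> isroot B n.+1 Y (f (0, s)%N).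
  elim: s => [|s IH] sn.
    by apply: (isroot_ext (isroot_unit dia dm)) => u um; rewrite /f /=; ifs.
  apply: (isroot_up dia (IH (ltnW sn)) (v := s.+1)); first by lia.
    by rewrite pairB; [rewrite /f /when /=; ifs|lia].
  by move=> u um; rewrite /f /=; ifs.
pose h s (u : nat) : int := (0 < u <= s)%N%:Z.
have Rh s : (s < n)%N -> isroot B n.+1 Y (h s.+1).
  elim: s => [|s IH] sn.
    by apply: (isroot_ext (isroot_unit dia (v := 1%N) n0)) => u um; rewrite /h; lia.
  apply: (isroot_up dia (IH (ltnW sn)) (v := s.+2)); first by lia.
    by rewrite pairB; [rewrite /h /when /=; ifs|lia].
  by move=> u um; rewrite /h; lia.
(* Passing from [(0, s + 1)] to [(1, s + 1)] adds delta at pairing 0, which is no reflection. The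
   root is obtained instead from one without delta, by the reflection at delta with pairing -2. *)
have R1 s : (s < n)%N -> isroot B n.+1 Y (f (1, s.+1)%N).
  move=> sn; have e : pairv n.+1 typeB (h s.+1) 0 = -2 by rewrite pairB // /h /when /= n0; ifs.
  apply: (isroot_ext (isroot_refl dia (Rh s sn) dm _)); first by rewrite e.
  by move=> u um; rewrite e /h /f /=; ifs.
have RS x : stair n x -> isroot B n.+1 Y (f x).
  case: x => r s; rewrite /stair /= => Sx; case: r Sx => [|r]; first by move=> ?; apply: R0; lia.
  elim: r => [|r IH] Sx; first by case: s Sx => // s Sx; apply: R1; lia.
  apply: (isroot_up dia (IH _) (v := r.+1)); [lia|lia| |].
    by rewrite pairB; [rewrite /f /when /=; ifs|lia].
  by move=> u um; rewrite /f /=; ifs.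
apply: (grid_model dia dm Y0 (stair_region n) (f := f)); last exact: stair_NRP.
- by move=> x Sx; split; [exact: RS|rewrite /f /=; lia].
- move=> [r s] v; rewrite /stair /= => Sx vm nv; rewrite pairB; last by lia.
  rewrite /f /when /= => neg.
  have [e|e] : v = s.+1 \/ (v = r /\ r < s)%N by move: neg; ifs.
    split; first by ifs.
    by exists (r, s.+1); rewrite /=; [lia|move=> u um; ifs].
  split; first by ifs.
  by exists (r.+1, s); rewrite /=; [lia|move=> u um; ifs].
- have S0 : stair n (0, 0)%N by [].
  have S1 : stair n (1, 1)%N by rewrite /stair /=; lia.
  (* The other antidominant root is [(1, 1)]; its coroot is the sum of the simple coroots 0 and
     1. *)
  apply: (low_two dia dm Y0 (sol := fun u => (u <= 1)%N%:Z) S0 S1) => //.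
  + by move=> u um; rewrite /f /=; ifs.
  + exact: RS.
  + by move=> v vm nv; rewrite pairB; [rewrite /f /when /=; ifs|lia].
  + move=> c c0 cp hc h0.
    have hc' v : (0 < v <= n)%N -> 2 * c v - when (0 < v)%N ((if v == 1%N then 2 else 1) * c v.-1) -
        when (v < n)%N (c v.+1) <= 0.
      by move=> vn; rewrite -rowB; [apply: hc|]; lia.
    have c1 : c 1%N = 1 by move: h0; rewrite rowB // /when /= n0; lia.
    case=> [|[|u]] um //.
    have Z v : (v.+2 <= n)%N -> c v.+2 = 0.
      have nz k : (0 < k < n)%N -> c k.+1 = 0 \/ c k.+1 < c k.
        move=> kn; have [le|] := lerP (c k) (c k.+1); last by right.
        left; apply: (@convex_end n k) => // [|w wn|]; first by lia.
          by have := hc' w (ltac:(lia)); rewrite /when; ifs.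
        by have := hc' n (ltac:(lia)); rewrite /when; ifs.
      elim: v => [|v IH] vn.
        by have := nz 1%N (ltac:(lia)); have := cp 2%N; lia.
      by have := nz v.+2 (ltac:(lia)); have := IH (ltnW vn); have := cp v.+3; lia.
    by rewrite Z.
- move=> [r s] [r' s']; rewrite /stair gridnbE /= => Sx Sy /orP[] /andP[/eqP er /eqP es]; subst r' s'.
    by exists r; [lia|move=> u um; rewrite /f /=; ifs].
  by exists s.+1; [lia|move=> u um; rewrite /f /=; ifs].
- by move=> [r s] [r' s']; rewrite /stair /le2 /= => Sx Sy xy u um; rewrite /f /=; ifs.
- move=> [r s] [r' s']; rewrite /stair /le2 /= => Sx Sy h'.
  have := h' s (ltac:(lia)); have := h' r.-1 (ltac:(lia)); have := h' 0%N (ltac:(lia)); rewrite /f /=; ifs.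
Qed.

Lemma typeC_NRP n Y : (0 < n)%N -> Y 0%N = delta -> diagram B n.+1 Y (typeC n) ->
  NRP_rowmotion (minuscule_poset B delta).
Proof.
move=> n0 Y0 dia.
(* In standard coordinates the chain runs through e_0 - e_j for increasing j, then e_0 + e_j for
   decreasing j, and ends with the long root 2 e_0. *)
pose f (x : cell) (u : nat) : int := (u <= x.2)%N%:Z + ((n.*2 <= u + x.2) && (u < n))%N%:Z.
have dm : (0 < n.+1)%N by [].
have R0 s : (s < n.*2)%N -> isroot B n.+1 Y (f (0, s)%N).
  elim: s => [|s IH] sn.
    by apply: (isroot_ext (isroot_unit dia dm)) => u um; rewrite /f /=; lia.
  have [sn'|sn'] := ltnP s n.
    apply: (isroot_up dia (IH (ltnW sn)) (v := s.+1)); first by lia.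
      by rewrite pairC; [rewrite /f /when /=; ifs|lia].
    by move=> u um; rewrite /f /=; lia.
  apply: (isroot_up dia (IH (ltnW sn)) (v := (n.*2 - s.+1)%N)); first by lia.
    by rewrite pairC; [rewrite /f /when /=; ifs|lia].
  by move=> u um; rewrite /f /=; lia.
(* The long root 2 e_0 comes from the long simple root at [n] by reflections with pairing -2. *)
have Rt : isroot B n.+1 Y (f (0, n.*2)%N).
  pose h k (u : nat) : int := (u == n)%:Z + 2 * (n <= u + k < n + k)%N%:Z.
  have Rh k : (k <= n)%N -> isroot B n.+1 Y (h k).
    elim: k => [|k IH] kn.
      by apply: (isroot_ext (isroot_unit dia (v := n) (leqnn _))) => u um; rewrite /h; lia.
    have e : pairv n.+1 (typeC n) (h k) (n - k.+1) = -2.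
      by rewrite pairC; [rewrite /h /when /=; ifs|lia].
    apply: (isroot_ext (isroot_refl dia (IH (ltnW kn)) (v := (n - k.+1)%N) _ _)); first by lia.
      by rewrite e.
    by move=> u um; rewrite e /h; lia.
  by apply: (isroot_ext (Rh n (leqnn n))) => u um; rewrite /h /f /=; lia.
have RS x : rect 0 n.*2 x -> isroot B n.+1 Y (f x).
  case: x => -[|r] s; rewrite /rect /= => Sx; last by [].
  have [->|h] : s = n.*2 \/ (s < n.*2)%N by lia.
    exact: Rt.
  exact: R0.
apply: (grid_model dia dm Y0 (rect_region 0 n.*2) (f := f)); last exact: rect_NRP.
- by move=> x Sx; split; [exact: RS|rewrite /f /=; lia].
- move=> [r s] v; rewrite /rect /= => Sx vm nv; rewrite pairC; last by lia.
  rewrite /f /when /= => neg.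
  have [e|e] : (v = s.+1 /\ s < n)%N \/ (v + s.+1 = n.*2 /\ n <= s)%N by move: neg; ifs.
    split; first by ifs.
    by exists (r, s.+1); rewrite /=; [lia|move=> u um; lia].
  split; first by ifs.
  by exists (r, s.+1); rewrite /=; [lia|move=> u um; lia].
- have S0 : rect 0 n.*2 (0, 0)%N by [].
  have S1 : rect 0 n.*2 (0, n.*2)%N by rewrite /rect /=.
  (* The coroot of 2 e_0 is the sum of all simple coroots. *)
  apply: (low_two dia dm Y0 (sol := fun=> 1) S0 S1) => //.
  + by move=> u um; rewrite /f /=; lia.
  + by rewrite /f /=; lia.
  + by move=> v vm nv; rewrite pairC; [rewrite /f /when /=; ifs|lia].
  + move=> c c0 cp hc h0.
    have hc' v : (0 < v < n)%N -> 2 * c v <= c v.-1 + c v.+1.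
      by move=> vn; have := hc v (ltac:(lia)) (ltac:(lia)); rewrite rowC /when; [ifs|lia].
    have hn : c n <= c n.-1.
      by have := hc n (ltac:(lia)) (ltac:(lia)); rewrite rowC // /when; ifs.
    have c1 : c 1%N = 1.
      by move: h0; rewrite rowC // /when /= n0; lia.
    (* The sequence is convex, flat at its start and nonincreasing at its end, hence constant. *)
    have up v : (v < n)%N -> 1 <= c v /\ c v <= c v.+1.
      elim: v => [|v IH] vn; first by rewrite c0 c1.
      by have := IH (ltnW vn); have := hc' v.+1 (ltac:(lia)); rewrite /=; lia.
    have dn k : (k < n)%N -> c (n - k)%N <= c (n - k).-1.
      elim: k => [|k IH] kn; first by rewrite subn0.
      have := IH (ltnW kn); have := hc' (n - k.+1)%N (ltac:(lia)).
      have -> : (n - k.+1).+1 = (n - k)%N by lia.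
      have -> : (n - k).-1 = (n - k.+1)%N by lia.
      by move: (c _) (c _) (c _) => x1 x2 x3; clear; lia.
    have le1 v : (v <= n)%N -> c v <= 1.
      elim: v => [|v IH] vn; first by rewrite c0.
      have := dn (n - v.+1)%N (ltac:(lia)); rewrite subKn //=; have := IH (ltnW vn); lia.
    move=> u um; have [e|e] : u = n \/ (u < n)%N by lia.
      by have := up n.-1 (ltac:(lia)); rewrite prednK // e; have := le1 n (leqnn n); lia.
    by have := up u e; have := le1 u (ltnW e); lia.
- move=> [r s] [r' s']; rewrite /rect gridnbE /= => Sx Sy /orP[] /andP[/eqP er /eqP es]; subst r' s'; first by lia.
  exists (if (s < n)%N then s.+1 else (n.*2 - s.+1)%N); first by case: ifP; lia.
  by move=> u um; rewrite /f /=; case: ifP; lia.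
- by move=> [r s] [r' s']; rewrite /rect /le2 /= => Sx Sy xy u um; rewrite /f /=; lia.
- move=> [r s] [r' s']; rewrite /rect /le2 /= => Sx Sy h'.
  have [e|e] := leqP s n; first by have := h' s (ltac:(lia)); rewrite /f /=; lia.
  by have := h' (n.*2 - s)%N (ltac:(lia)); rewrite /f /=; lia.
Qed.

End Grid.

(** * Types D and E *)

Lemma pairT b n g v : (v <= n)%N ->
  pairv n.+2 (teeC b n) g v = 2 * g v - when (0 < v)%N (g v.-1) - when (v < n)%N (g v.+1) -
    when (v == b) (g n.+1).
Proof.
move=> vn; rewrite /pairv big_ord_recr /= -pairA // /pairv; congr (_ + _).
  by apply: eq_bigr => u _; congr (_ * _); have := ltn_ord u; cartan.
have -> : teeC b n n.+1 v = - (v == b)%:Z by cartan.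
by rewrite /when; case: (v == b); rewrite /= ?oppr0 ?mulr0 ?mulrN1.
Qed.

Lemma pairT_extra b n g : (b <= n)%N -> pairv n.+2 (teeC b n) g n.+1 = 2 * g n.+1 - g b.
Proof.
move=> bn; rewrite /pairv big_ord_recr /=.
have -> : teeC b n n.+1 n.+1 = 2 by cartan.
rewrite (eq_bigr (fun u : 'I_n.+1 => - g b * (u == b :> nat)%:Z)) => [|u _].
  by rewrite sum_indicator ltnS bn mulrC addrC.
have -> : teeC b n u n.+1 = - (u == b :> nat)%:Z by have := ltn_ord u; cartan.
by case: (eqVneq (u : nat) b) => [->|_]; rewrite /= ?oppr0 ?mulr0 ?mulrN1 ?mulr1.
Qed.

(* The elements of the table w are coefficient vectors; up lists the covering relation. *)
Section Table.
Variables (m : nat) (C : nat -> nat -> int) (w : seq (seq nat)) (up : seq (seq nat)).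
Let vec x := nth [::] w x.
Let pc (g : seq nat) v : int := foldr (fun u s => (nth 0%N g u)%:Z * C u v + s) 0 (iota 0 m).
Let vle g g' := all (fun u => nth 0%N g u <= nth 0%N g' u)%N (iota 0 m).
Let succ g g' v := all (fun u => nth 0%N g' u == nth 0%N g u + (u == v))%N (iota 0 m).
Let N := size w.
Let nb x y := y \in nth [::] up x.

Definition table_check : bool := [&&
  all (fun x => (x == 0%N) || has (fun y => has (fun v => (pc (vec y) v == -1) && succ (vec y) (vec x) v)
         (iota 0 m)) (iota 0 x)) (iota 0 N),
  all (fun x => all (fun v => [|| v == 0%N, 0 <= pc (vec x) v |
         (pc (vec x) v == -1) && has (fun y => succ (vec x) (vec y) v) (iota 0 N)]) (iota 0 m)) (iota 0 N),
  all (fun x => all (fun y => nb x y ==> has (fun v => succ (vec x) (vec y) v) (iota 0 m)) (iota 0 N)) (iota 0 N),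
  all (fun x => all (fun y => (vle (vec x) (vec y) && (x != y)) ==>
         (has (fun z => nb z y && vle (vec x) (vec z)) (iota 0 N) &&
          has (fun z => nb x z && vle (vec z) (vec y)) (iota 0 N))) (iota 0 N)) (iota 0 N),
  all (fun x => nth 0%N (vec x) 0 == 1%N) (iota 0 N),
  all (fun u => nth 0%N (vec 0%N) u == (u == 0%N)) (iota 0 m) & (0 < m)%N && (0 < N)%N].

Definition tvec (x : nat) (u : nat) : int := (nth 0%N (nth [::] w x) u)%:Z.

Lemma pc_pairv x v : pairv m C (tvec x) v = pc (vec x) v.
Proof.
rewrite /pairv -(big_mkord xpredT (fun u => tvec x u * C u v)) /index_iota subn0 /pc.
by elim: (iota 0 m) => [|u s IH] /=; rewrite ?big_nil ?big_cons ?IH.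
Qed.

Lemma succE x y v : succ (vec x) (vec y) v -> forall u, (u < m)%N -> tvec y u = tvec x u + (u == v)%:Z.
Proof. by move=> /allP h u um; rewrite /tvec (eqP (h u _)) ?mem_iota. Qed.

Lemma vleE x y : vle (vec x) (vec y) <-> forall u, (u < m)%N -> tvec x u <= tvec y u.
Proof.
split=> [/allP h u um|h]; first by have := h u; rewrite mem_iota; apply.
by apply/allP => u; rewrite mem_iota => um; apply: h; lia.
Qed.

End Table.

Section Tee.
Variables (R : root_datum) (B : base R).
Local Notation I := (rd_index R).
Variable delta : I.
Hypothesis hdelta : minuscule B delta.

Lemma Nm_tee b n Y : (b <= n)%N -> diagram B n.+2 Y (teeC b n) ->
  forall u v, (u < n.+2)%N -> (v < n.+2)%N -> Nm (Y u) = Nm (Y v).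
Proof.
move=> bn dia.
have P u v : (u <= n)%N -> (v <= n)%N -> Nm (Y u) = Nm (Y v).
  have h w : (w < n)%N -> teeC b n w w.+1 = -1 /\ teeC b n w.+1 w = -1.
    by move=> wn; split; cartan.
  exact: (Nm_path (or_intror dia) h).
have E u : (u < n.+2)%N -> Nm (Y u) = Nm (Y b).
  move=> un; have [->|lu] : u = n.+1 \/ (u <= n)%N by lia.
    by apply: (Nm_edge dia); rewrite //; cartan.
  exact: P.
by move=> u v um vm; rewrite !E.
Qed.

Lemma tee_stair_NRP n Y : (1 < n)%N -> Y 0%N = delta -> diagram B n.+2 Y (teeC 1 n) ->
  NRP_rowmotion (minuscule_poset B delta).
Proof.
move=> n1 Y0 dia.
(* The vectors of type B unfolded: their coefficient at node 0 is shared between the nodes 0 and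
   [n + 1]. *)
pose f (x : cell) (u : nat) : int := if u == 0%N then 1 else if u == n.+1 then (0 < x.1)%N%:Z
  else (u <= x.2)%N%:Z + (u < x.1)%N%:Z.
have dm : (0 < n.+2)%N by [].
have S0 : stair n (0, 0)%N by [].
have pe x : pairv n.+2 (teeC 1 n) (f x) n.+1 = 2 * (0 < x.1)%N%:Z - ((1 <= x.2)%N%:Z + (1 < x.1)%N%:Z).
  by rewrite pairT_extra; [rewrite /f; ifs|lia].
have R0 s : (s <= n)%N -> isroot B n.+2 Y (f (0, s)%N).
  elim: s => [|s IH] sn.
    by apply: (isroot_ext (isroot_unit dia dm)) => u um; rewrite /f /=; ifs.
  apply: (isroot_up dia (IH (ltnW sn)) (v := s.+1)); first by lia.
    by rewrite pairT; [rewrite /f /when /=; ifs|lia].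
  by move=> u um; rewrite /f /=; ifs.
have RS x : stair n x -> isroot B n.+2 Y (f x).
  case: x => r s; rewrite /stair /=; elim: r => [|r IH] Sx; first by apply: R0; lia.
  case: r IH Sx => [|r] IH Sx.
    apply: (isroot_up dia (IH _) (v := n.+1)); [lia|lia|rewrite pe /=; lia|].
    by move=> u um; rewrite /f /=; ifs.
  apply: (isroot_up dia (IH _) (v := r.+1)); [lia|lia| |].
    by rewrite pairT; [rewrite /f /when /=; ifs|lia].
  by move=> u um; rewrite /f /=; ifs.
apply: (grid_model hdelta dia dm Y0 (stair_region n) (f := f)); last exact: stair_NRP.
- by move=> x Sx; split; [exact: RS|rewrite /f /=; lia].
- move=> [r s] v; rewrite /stair /= => Sx vm nv.
  have [e|vn] : v = n.+1 \/ (v <= n)%N by lia.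
    rewrite e pe /= => neg; have [r0 s0] : r = 0%N /\ (0 < s)%N by lia.
    split; first by lia.
    by exists (r.+1, s); rewrite /=; [lia|move=> u um; rewrite /f /=; ifs].
  rewrite pairT // /f /when /= => neg.
  have [e|e] : v = s.+1 \/ (v = r /\ r < s)%N by move: neg; ifs.
    split; first by ifs.
    by exists (r, s.+1); rewrite /=; [lia|move=> u um; ifs].
  split; first by ifs.
  by exists (r.+1, s); rewrite /=; [lia|move=> u um; ifs].
- apply: (low_delta hdelta dia dm Y0 S0) => [|u um]; last by rewrite /f /=; ifs.
  by apply: Nm_tee dia; lia.
- move=> [r s] [r' s']; rewrite /stair gridnbE /= => Sx Sy /orP[] /andP[/eqP er /eqP es]; subst r' s'.
    by exists (if r == 0%N then n.+1 else r); [ifs|move=> u um; rewrite /f /=; ifs].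
  by exists s.+1; [lia|move=> u um; rewrite /f /=; ifs].
- by move=> [r s] [r' s']; rewrite /stair /le2 /= => Sx Sy xy u um; rewrite /f /=; ifs.
- move=> [r s] [r' s']; rewrite /stair /le2 /= => Sx Sy h'.
  have := h' s (ltac:(lia)); have := h' r.-1 (ltac:(lia)); have := h' n.+1 (ltac:(lia)); rewrite /f /=; ifs.
Qed.

Lemma tee_propeller_NRP b Y : (0 < b)%N -> Y 0%N = delta -> diagram B b.+3 Y (teeC b b.+1) ->
  NRP_rowmotion (minuscule_poset B delta).
Proof.
move=> b0 Y0 dia.
(* Past the fork the roots of type D come back towards delta: the second indicator counts the nodes
   from [2b + 2 - s] to [b] once more. *)
pose f (x : cell) (u : nat) : int := if u == b.+2 then (0 < x.1)%N%:Z
  else (u <= x.2)%N%:Z + [&& 0 < x.1, b.*2.+2 <= u + x.2 & u <= b]%N%:Z.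
have dm : (0 < b.+3)%N by [].
have S0 : propeller b (0, 0)%N by [].
have pe x : pairv b.+3 (teeC b b.+1) (f x) b.+2 = 2 * (0 < x.1)%N%:Z - ((b <= x.2)%N%:Z + ((0 < x.1) && (b.+2 <= x.2))%N%:Z).
  by rewrite pairT_extra; [rewrite /f; ifs|lia].
have R0 s : (s <= b.+1)%N -> isroot B b.+3 Y (f (0, s)%N).
  elim: s => [|s IH] sn.
    by apply: (isroot_ext (isroot_unit dia dm)) => u um; rewrite /f /=; ifs.
  apply: (isroot_up dia (IH (ltnW sn)) (v := s.+1)); first by lia.
    by rewrite pairT; [rewrite /f /when /=; ifs|lia].
  by move=> u um; rewrite /f /=; ifs.
have R1 s : (s <= b.+1)%N -> isroot B b.+3 Y (f (1, b + s)%N).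
  elim: s => [|s IH] sb.
    apply: (isroot_up dia (R0 b _) (v := b.+2)); [lia|lia|rewrite pe /=; lia|].
    by move=> u um; rewrite /f /=; ifs.
  case: (posnP s) => s0.
    apply: (isroot_up dia (IH _) (v := b.+1)); [lia|lia| |].
      by rewrite pairT; [rewrite /f /when /=; ifs|lia].
    by move=> u um; rewrite /f /=; ifs.
  apply: (isroot_up dia (IH _) (v := (b.+1 - s)%N)); [lia|lia| |].
    by rewrite pairT; [rewrite /f /when /=; ifs|lia].
  by move=> u um; rewrite /f /=; ifs.
have RS x : propeller b x -> isroot B b.+3 Y (f x).
  case: x => r s; rewrite /propeller /= => Sx; case: r Sx => [|[|r]] Sx; last by exfalso; lia.
    by apply: R0; lia.
  have bs : (b <= s)%N by lia.
  by rewrite -(subnKC bs); apply: R1; lia.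
apply: (grid_model hdelta dia dm Y0 (propeller_region b) (f := f)); last exact: propeller_NRP.
- by move=> x Sx; split; [exact: RS|rewrite /f /=; lia].
- move=> [r s] v; rewrite /propeller /= => Sx vm nv.
  have [e|vn] : v = b.+2 \/ (v <= b.+1)%N by lia.
    rewrite e pe /= => neg; have [r0 s0] : r = 0%N /\ (b <= s)%N by lia.
    split; first by lia.
    by exists (r.+1, s); rewrite /=; [lia|move=> u um; rewrite /f /=; ifs].
  rewrite pairT // /f /when /= => neg.
  have e : (s <= b /\ v = s.+1)%N \/ (r = 1 /\ b < s /\ v + s = b.*2.+1 /\ 0 < v)%N.
    by move: neg; ifs.
  split; first by case: e => e; ifs.
  by exists (r, s.+1); rewrite /=; [lia|move=> u um; case: e => e; ifs].
- apply: (low_delta hdelta dia dm Y0 S0) => [|u um]; last by rewrite /f /=; ifs.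
  by apply: Nm_tee dia; lia.
- move=> [r s] [r' s']; rewrite /propeller gridnbE /= => Sx Sy /orP[] /andP[/eqP er /eqP es]; subst r' s'.
    by exists b.+2; [lia|move=> u um; rewrite /f /=; ifs].
  exists (if (s <= b)%N then s.+1 else (b.*2.+1 - s)%N); first by ifs.
  by move=> u um; rewrite /f /=; ifs.
- by move=> [r s] [r' s']; rewrite /propeller /le2 /= => Sx Sy xy u um; rewrite /f /=; ifs.
- move=> [r s] [r' s']; rewrite /propeller /le2 /= => Sx Sy h'.
  have := h' b.+2 (ltac:(lia)); have [h|h] := leqP s b.+1.
    by have := h' s (ltac:(lia)); rewrite /f /=; ifs.
  by have := h' (b.*2.+2 - s)%N (ltac:(lia)); rewrite /f /=; ifs.
Qed.

Lemma table_NRP b n Y w up low rk rot RR : (b <= n)%N -> Y 0%N = delta -> diagram B n.+2 Y (teeC b n) ->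
  table_check n.+2 (teeC b n) w up -> table_ok (size w) up low rk rot RR ->
  (exists2 x, tS (size w) x & trk rk x = RR) -> field_NRP (tS (size w)) (tnb up) RR ->
  NRP_rowmotion (minuscule_poset B delta).
Proof.
move=> bn Y0 dia /and5P[c1 c2 c3 c4 /and3P[c5 c6 /andP[_ N0]]] ok top.
have sg := table_sg ok; have dm : (0 < n.+2)%N by [].
have iN x : tS (size w) x -> x \in iota 0 (size w) by rewrite mem_iota.
have im v : (v < n.+2)%N -> v \in iota 0 n.+2 by rewrite mem_iota.
have [hs inj _ _] := dia.
have t0 u : (u < n.+2)%N -> tvec w 0 u = (u == 0%N)%:Z.
  by move=> um; rewrite /tvec (eqP (allP c6 u (im u um))).
have rt x : tS (size w) x -> isroot B n.+2 Y (tvec w x).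
  elim/ltn_ind: x => x IH xN; have /orP[/eqP->|/hasP[y]] := allP c1 x (iN x xN).
    by apply: (isroot_ext (isroot_unit dia dm)) => u um; rewrite t0.
  rewrite mem_iota => yx /hasP[v]; rewrite mem_iota => vm /andP[/eqP e sc].
  have yN : tS (size w) y by rewrite /tS in xN *; nlia.
  apply: (isroot_up dia (IH y _ yN) (v := v)); [nlia|nlia|by rewrite pc_pairv|exact: succE].
apply: (model_NRP hdelta dia dm Y0 (f := tvec w) _ _ _ _ _ (sg_rk sg) (sg_le sg) (sg_low sg) top).
- by move=> x xN; split; [exact: rt|rewrite /tvec (eqP (allP c5 x (iN x xN)))].
- move=> x v xN vm nv neg; have /or3P[] := allP (allP c2 x (iN x xN)) v (im v vm).
  + by rewrite (negbTE nv).
  + by rewrite -pc_pairv leNgt neg.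
  + case/andP => /eqP e /hasP[y yN sc]; split; first by rewrite pc_pairv.
    by exists y; [move: yN; rewrite mem_iota|exact: succE].
- move=> a Ma ha; rewrite (antidominant_simply_laced hdelta dia dm Y0 _ Ma ha).
    exists 0%N => // u um; rewrite t0 // -Y0 cf_simple ?hs //; congr (nat_of_bool _)%:Z.
    by apply/eqP/eqP => [/inj->|->].
  by move=> u um; rewrite -Y0; apply: (Nm_tee bn dia).
- move=> x y xN yN xy; have /implyP/(_ xy)/hasP[v] := allP (allP c3 x (iN x xN)) y (iN y yN).
  by rewrite mem_iota => vm sc; exists v; [|exact: succE].
- move=> x y xN yN xy nxy.
  have /implyP := allP (allP c4 x (iN x xN)) y (iN y yN); rewrite nxy andbT.
  case/(_ (introT idP (proj2 (vleE _ _ _ _) xy)))/andP => /hasP[z zN /andP[zy xz]] /hasP[z' zN' /andP[xz' zy']].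
  split; [exists z|exists z']; split=> //.
  + by move: zN; rewrite mem_iota.
  + exact/vleE.
  + by move: zN'; rewrite mem_iota.
  + exact/vleE.
Qed.

(** Rows are numbered as in [e6_up]; the last coefficient belongs to the hanging node of
    [teeC 2 4]. *)
Definition e6_vec : seq (seq nat) :=
  [:: [:: 1; 0; 0; 0; 0; 0]; [:: 1; 1; 0; 0; 0; 0]; [:: 1; 1; 1; 0; 0; 0]; [:: 1; 1; 1; 0; 0; 1];
   [:: 1; 1; 1; 1; 0; 0]; [:: 1; 1; 1; 1; 0; 1]; [:: 1; 1; 1; 1; 1; 0]; [:: 1; 1; 2; 1; 0; 1];
   [:: 1; 1; 1; 1; 1; 1]; [:: 1; 2; 2; 1; 0; 1]; [:: 1; 1; 2; 1; 1; 1]; [:: 1; 2; 2; 1; 1; 1];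
   [:: 1; 1; 2; 2; 1; 1]; [:: 1; 2; 2; 2; 1; 1]; [:: 1; 2; 3; 2; 1; 1]; [:: 1; 2; 3; 2; 1; 2]].
Definition e7_vec : seq (seq nat) :=
  [:: [:: 1; 0; 0; 0; 0; 0; 0]; [:: 1; 1; 0; 0; 0; 0; 0]; [:: 1; 1; 1; 0; 0; 0; 0]; [:: 1; 1; 1; 1; 0; 0; 0];
   [:: 1; 1; 1; 1; 0; 0; 1]; [:: 1; 1; 1; 1; 1; 0; 0]; [:: 1; 1; 1; 1; 1; 0; 1]; [:: 1; 1; 1; 1; 1; 1; 0];
   [:: 1; 1; 1; 1; 1; 1; 1]; [:: 1; 1; 1; 2; 1; 0; 1]; [:: 1; 1; 1; 2; 1; 1; 1]; [:: 1; 1; 2; 2; 1; 0; 1];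
   [:: 1; 1; 1; 2; 2; 1; 1]; [:: 1; 1; 2; 2; 1; 1; 1]; [:: 1; 2; 2; 2; 1; 0; 1]; [:: 1; 1; 2; 2; 2; 1; 1];
   [:: 1; 2; 2; 2; 1; 1; 1]; [:: 1; 1; 2; 3; 2; 1; 1]; [:: 1; 2; 2; 2; 2; 1; 1]; [:: 1; 1; 2; 3; 2; 1; 2];
   [:: 1; 2; 2; 3; 2; 1; 1]; [:: 1; 2; 3; 3; 2; 1; 1]; [:: 1; 2; 2; 3; 2; 1; 2]; [:: 1; 2; 3; 3; 2; 1; 2];
   [:: 1; 2; 3; 4; 2; 1; 2]; [:: 1; 2; 3; 4; 3; 1; 2]; [:: 1; 2; 3; 4; 3; 2; 2]].

Lemma e6_check : table_check 6 (teeC 2 4) e6_vec e6_up. Proof. by vm_compute. Qed.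
Lemma e7_check : table_check 7 (teeC 3 5) e7_vec e7_up. Proof. by vm_compute. Qed.

Theorem dynkin_NRP : NRP_rowmotion (minuscule_poset B delta).
Proof.
case: (dynkin hdelta) => [[n [Y [Y0]]]|]; last exact: line_NRP.
case=> [[n0 dia]|[n0 dia]|[b [dia]]]; [exact: typeB_NRP dia|exact: typeC_NRP dia|].
case=> [[eb n1]|[b0 en]|[eb en]|[eb en]]; subst b || subst n.
- exact: tee_stair_NRP dia.
- exact: tee_propeller_NRP dia.
- subst n; apply: (table_NRP _ Y0 dia e6_check e6_ok _ e6_NRP) => //.
  by exists 15%N.
- subst n; apply: (table_NRP _ Y0 dia e7_check e7_ok _ e7_NRP) => //.
  by exists 26%N.
Qed.

End Tee.

Theorem theorem1p2 (R : root_datum) (B : base R) (delta : rd_index R)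
  (hdelta : minuscule B delta) :
  NRP_rowmotion (minuscule_poset B delta).
Proof. exact: dynkin_NRP hdelta. Qed.
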